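(* There are absolute constants $C>0$ and $d_0$ such that for all $d\ge d_0$, $$\lambda(d)\le C\, d^{-1/4}(\log d)^{3/4}.$$ That is, $\lambda(d)=O(d^{-1/4}\log^{3/4}d)$.
   Context: Consider $\mathbb{Z}^d$ with its usual nearest-neighbor graph. For a graph $\Sigma$ write $\mathcal I(\Sigma)$ for the collection of independent sets of $\Sigma$ (sets of vertices spanning no edges). For a finite graph $\Sigma$ and $\lambda>0$, the hard-core measure with activity $\lambda$ on $\Sigma$ is the probability measure on $\mathcal I(\Sigma)$ given by $\mu(I)=\lambda^{|I|}/Z$, where $Z=\sum_{I'\in\mathcal I(\Sigma)}\lambda^{|I'|}$. For an infinite graph $\Sigma$ with vertex set $V$, a probability measure $\mu$ on $\mathcal I(\Sigma)$ is hard-core with activity $\lambda$ if, for $\mathbf I$ chosen according to $\mu$ and every finite $W\subset V$, the conditional distribution of $\mathbf I\cap W$ given $\mathbf I\cap(V\setminus W)$ is $\mu$-a.s. the hard-core measure with activity $\lambda$ on the subgraph induced by $\{w\in W: w \text{ has no neighbor in } \mathbf I\cap(V\setminus W)\}$. At least one such measure always exists; the model is said to have a phase transition (at activity $\lambda$) if there is more than one. Define $\lambda(d)$ to be the supremum of those $\lambda>0$ for which the hard-core model with activity $\lambda$ on $\mathbb{Z}^d$ does not have a phase transition. *)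

(* Defs.v *)
From HB Require Import structures.
From mathcomp Require Import all_boot all_order all_algebra finmap.
From mathcomp Require Import all_classical all_reals all_analysis.

Set Implicit Arguments.
Unset Strict Implicit.
Unset Printing Implicit Defensive.

Import Order.TTheory GRing.Theory Num.Theory.

Local Open Scope classical_set_scope.
Local Open Scope ring_scope.

Section Graph.
Variables (V : choiceType) (adj : rel V).

Definition independent (I : set V) : Prop :=
  forall u v, I u -> I v -> ~~ adj u v.

Definition indset : Type := {I : set V | independent I}.

HB.instance Definition _ := gen_eqMixin indset.
HB.instance Definition _ := gen_choiceMixin indset.

Lemma independent_set0 : independent set0.
Proof. by []. Qed.

HB.instance Definition _ :=
  isPointed.Build indset (exist independent set0 independent_set0).

Definition occupied (v : V) : set indset := [set I | sval I v].

(* the product sigma-algebra of 2^V, restricted to the independent sets *)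
Definition indsetM := g_sigma_algebraType (range occupied).

(* sigma-algebra generated by the random set I `\` W *)
Definition outside (W : {fset V}) : set_system indsetM :=
  <<s occupied @` [set v | v \notin W] >>.

Definition free_sites (W : {fset V}) (I : indsetM) : {fset V} :=
  [fset w in W | `[< forall v, v \notin W -> sval I v -> ~~ adj w v >]]%fset.

Section Hardcore.
Variables (R : realType) (lambda : R).

(* hard-core measure on the subgraph induced by the finite set U, given by its
   point masses and extended by 0 to the finite sets A that are not
   independent sets of this subgraph *)
Definition hardcore_fin (U A : {fset V}) : R :=
  if (A `<=` U)%fset && `[< independent [set` A] >] then
    lambda ^+ #|` A| /
    \sum_(B <- fpowerset U | `[< independent [set` B] >]) lambda ^+ #|` B|
  else 0.

End Hardcore.
End Graph.

(* f is a version of the conditional probability of the event A given the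
   sub-sigma-algebra F *)
Definition is_cond_prob d (T : measurableType d) (R : realType)
    (mu : probability T R) (F : set_system T) (A : set T) (f : T -> R) : Prop :=
  (forall B : set R, measurable B -> F (f @^-1` B)) /\
  (forall E, F E -> mu (A `&` E) = \int[mu]_(x in E) (f x)%:E)%E.

Section Model.
Variables (V : choiceType) (adj : rel V) (R : realType).

(* Since I `&` W has finitely many possible values A, its conditional
   distribution is determined by the conditional probabilities of the
   events I `&` W = A. *)
Definition is_hardcore (lambda : R) (mu : probability (indsetM adj) R) : Prop :=
  forall W A : {fset V}, (A `<=` W)%fset ->
    is_cond_prob mu (outside W)
      [set I : indsetM adj | sval I `&` [set` W] = [set` A]]
      (fun I => hardcore_fin adj lambda (free_sites W I) A).

(* Measures are compared on measurable sets only: the underlying functions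
   set T -> \bar R may differ elsewhere. *)
Definition phase_transition (lambda : R) : Prop :=
  exists mu nu : probability (indsetM adj) R,
    [/\ is_hardcore lambda mu, is_hardcore lambda nu &
        exists2 E, measurable E & mu E <> nu E].

End Model.

Definition latadj (d : nat) : rel 'rV[int]_d :=
  fun x y => \sum_(i < d) `|x 0 i - y 0 i| == 1.

(* The supremum is taken in \bar R: sup in R would be 0 for an unbounded set. *)
Definition lambda_hc (R : realType) (d : nat) : \bar R :=
  ereal_sup [set l%:E | l in
    [set l : R | 0 < l /\ ~ phase_transition (@latadj d) l]].

(* Main.v *)
(** Finite volume: on a discrete torus cut along a wall, force the independent
    set to agree on the wall with one of the two parity classes ("even" sites).
    If a given odd site v is occupied, the component around v of the occupied
    odd sites and their neighbours is enclosed by a contour W, all of whose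
    inner boundary sites are even and empty, together with their outer
    neighbours.  Shifting the part of I inside W by one lattice step t vacates
    the sites x of W with x - t outside W; as any subset of these can then be
    occupied, the shift gains weight exponential in the boundary size.  There
    are too many contours to sum over directly.  Following the approximation idea of
    Sapozhenko, W is therefore replaced by a pair (F, S) with F <= even part of
    W and odd part of W <= S, close enough to W that few pairs are needed, and
    the gain is estimated for all W compatible with the same (F, S) at once, by
    a randomised decoder.  For lam >> d^(-1/4) (log d)^(3/4) this makes the
    occupation probability of v at most 1/(64 d^2), whereas an even site is
    occupied with probability of order min(lam, 1) >= 1/d.

    Infinite volume: along an ultrafilter the cylinder probabilities of both
    boundary conditions converge.  The limits are realised by probability
    measures (images of Lebesgue measure under nested intervals), which are
    hard-core because the single-site flip identity passes to the limit.  The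
    two measures give the origin different occupation probabilities. *)
From HB Require Import structures.
From mathcomp Require Import all_boot all_order all_algebra zify ring lra.
Set Implicit Arguments.
Unset Strict Implicit.
Unset Printing Implicit Defensive.
Import Order.TTheory GRing.Theory Num.Theory.
Local Open Scope ring_scope.

(** * The torus and its wall *)

(** The exponents come from one balance. Let L be the excess of a contour, its number of even sites
    minus its number of odd sites; the shift vacates exactly L sites. With l about log d and a
    cut-off psi for neighbour counts, the data behind a pair (F, S) consist of sets of size O(L l /
    psi), coming from a covering argument, and of sets of size O(L psi / d), coming from averages
    over directions. Both are of order L (l / d)^(1/2) for psi about (d l)^(1/2). Each site of data
    costs a factor polynomial in d, so there are exp (O(L l^(3/2) d^(-1/2))) pairs. The obstacle on
    the side of the gain is that W is known only through (F, S), so the decoder must find out which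
    vacated sites were filled. One class of vacated sites is filled with probability q, the other
    with probability pr, and the decoding weights add up to at most 1 if pr / lam + kap <= 1 and kap
    <= pr, where kap is about q / lam. For small lam this allows pr of order lam and q of order
    lam^2, hence a factor exp (- c lam^2 L). It beats the number of pairs once lam^2 is a large
    multiple of d^(-1/2) l^(3/2). *)

Section Torus.
Variables (d p : nat).
Hypothesis p_even : ~~ odd p.
Hypothesis p_gt1 : (1 < p)%N.
Local Notation Zn := 'I_p.+2.
Local Notation T := ('rV[Zn]_d).
Local Notation D := ('I_d * bool)%type.

Definition stp (t : D) : T := if t.2 then delta_mx 0 t.1 else - delta_mx 0 t.1.
Definition opp (t : D) : D := (t.1, ~~ t.2).
Definition par (x : T) : bool := odd (\sum_i nat_of_ord (x 0%R i)).
(** Two adjacent layers in each direction: the sites off the wall form a box, and no step from such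
    a site wraps around. *)
Definition wall : {set T} := [set x : T | [exists i, (x 0 i == 0) || (x 0 i == -1)]].

Lemma stpN t : stp (opp t) = - stp t.
Proof. by rewrite /stp /opp; case: t => i [] //=; rewrite opprK. Qed.

Lemma oppK : involutive opp.
Proof. by case=> i b; rewrite /opp /= negbK. Qed.

Lemma stpE t (j : 'I_d) :
  stp t 0 j = if j == t.1 then (if t.2 then 1 else -1) else 0.
Proof.
rewrite /stp; case: t => i b; rewrite /fst /snd; case: b; rewrite !mxE eqxx andTb;
  by case: (j == i); rewrite ?oppr0.
Qed.

Lemma Zn_1N1 : (1 : Zn) != -1.
Proof. apply/eqP => /(congr1 (fun a : Zn => nat_of_ord (a + 1)%R)).
rewrite addNr; have -> : nat_of_ord (1 + 1 : Zn) = ((1 %% p.+2 + 1 %% p.+2) %% p.+2)%N by [].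
rewrite (@modn_small 1 p.+2) // (@modn_small (1 + 1)) //; lia. Qed.

Lemma Zn_10 : (1 : Zn) != 0. Proof. by []. Qed.

Lemma stp_inj : injective stp.
Proof.
move=> [i b] [j c] E.
have := congr1 (fun x : T => x 0 i) E; rewrite !stpE /= eqxx.
case: eqP => [<-|_].
  case: b E; case: c => //= _ /eqP; first by rewrite (negbTE Zn_1N1).
  by rewrite eq_sym (negbTE Zn_1N1).
by case: b E => _ /eqP; rewrite ?oppr_eq0 (negbTE Zn_10).
Qed.

Lemma odd_Zn_add1 (a : Zn) : odd (a + 1)%R = ~~ odd a.
Proof.
have -> : nat_of_ord (a + 1)%R = ((a + 1 %% p.+2) %% p.+2)%N by [].
rewrite odd_mod; last by rewrite /= negbK; apply: negbTE.
by rewrite oddD (@modn_small 1) //= addbT.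
Qed.

Lemma par_stp x t : par (x + stp t) = ~~ par x.
Proof.
have par1 (y : T) i : par (y + stp (i, true)) = ~~ par y.
  rewrite /par (bigD1 i) //= [in RHS](bigD1 i) //= !oddD.
  rewrite -[in RHS]addNb; congr addb.
    by rewrite !mxE !eqxx /= odd_Zn_add1.
  congr odd; apply: eq_bigr => j ji; by rewrite mxE stpE ifN // addr0.
case: t => i [] //.
have E : x = x + stp (i, false) + stp (i, true).
  by rewrite -addrA -[(i, false)]/(opp (i, true)) stpN addNr addr0.
by rewrite [in RHS]E par1 negbK.
Qed.

Lemma line_coord (x : T) i b k (j : 'I_d) : j != i -> (x + stp (i, b) *+ k) 0 j = x 0 j.
Proof.
by move=> ji; elim: k => [|k IH]; rewrite ?mulr0n ?addr0 // mulrS addrCA mxE stpE ifN // add0r.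
Qed.

Lemma line_coordi (x : T) i b k : (x + stp (i, b) *+ k) 0 i = x 0 i + (if b then 1 else -1) *+ k.
Proof.
elim: k => [|k IH]; first by rewrite !mulr0n !addr0.
by rewrite !mulrS addrCA mxE stpE /= eqxx IH addrCA.
Qed.

Lemma line_wall (x : T) i b : exists k, x + stp (i, b) *+ k \in wall.
Proof.
exists (if b then nat_of_ord (- x 0 i) else nat_of_ord (x 0%R i)).
rewrite inE; apply/existsP; exists i; apply/orP; left.
rewrite line_coordi; case: b; first by rewrite -[1 *+ _]/(_%:R) natr_Zp addrN.
by rewrite mulNrn -[1 *+ _]/(_%:R) natr_Zp addrN.
Qed.

Definition offline (i : 'I_d) (x y : T) := [forall j, (j != i) ==> (x 0 j == y 0 j)].

(** Every line in direction [i] meets the wall, so following it from a site of [C] one leaves [C];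
    sites on different lines give different exits. This serves as the isoperimetric inequality. *)
Lemma exit_card i b (C Z : {set T}) :
  [disjoint C & wall] -> Z \subset C ->
  {in Z &, forall x y, offline i x y -> x = y} ->
  (#|Z| <= #|[set x in C | (x + stp (i, b))%R \notin C]|)%N.
Proof.
move=> Cw ZC Zl; set E := [set x in C | _].
have ex x : exists k, (x \notin C) || (x + stp (i, b) *+ k \notin C).
  have [k xk] := line_wall x i b; exists k.
  by rewrite orbC; apply/orP; left; apply/negP => /(disjointFr Cw); rewrite xk.
pose f x := x + stp (i, b) *+ (ex_minn (ex x)).-1.
have fE : {in Z, forall x, f x \in E}.
  move=> x /(subsetP ZC) xC; rewrite /f; case: ex_minnP => -[|k].
    by rewrite mulr0n addr0 xC.
  rewrite xC /= => kC min; rewrite !inE -addrA -mulrSr kC andbT.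
  by apply: contraT => H; have := min k; rewrite H ltnn => /(_ isT).
rewrite -(@card_in_imset _ _ f Z); first by apply/subset_leq_card/subsetP => _ /imsetP[x xZ ->]; apply: fE.
move=> x y xZ yZ fxy; apply: Zl => //.
apply/forallP => j; apply/implyP => ji.
have := congr1 (fun z : T => z 0 j) fxy; rewrite /f !line_coord // => /eqP //.
Qed.

End Torus.

Definition steps (T : finZmodType) (D : finType) (e : D -> T) (A : {set T}) : rel T :=
  [rel x y | [&& x \in A, y \in A & [exists t, y == x + e t]]].

(** * Connectivity of the edge boundary of a contour *)

Section Cut.
Variables (d p : nat).
Hypothesis p_even : ~~ odd p.
Hypothesis p_gt1 : (1 < p)%N.
Local Notation Zn := 'I_p.+2.
Local Notation T := ('rV[Zn]_d).
Local Notation D := ('I_d * bool)%type.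
Local Notation e := (@stp d p).
Local Notation wall := (wall d p).
Local Notation conn A := (connect (@steps T _ e A)).
Variables (i0 i1 : 'I_d) (W : {set T}) (v0 : T) (om : T -> D -> bool).
Hypothesis i01 : i1 != i0.
Hypothesis W_wall : [disjoint W & wall].
Hypothesis W_conn : {in W, forall x, conn W v0 x}.
Hypothesis W_out : {in ~: W, forall x, exists2 w, w \in wall & conn (~: W) x w}.
Hypothesis om_sym : forall (x : T) t, om (x + e t) (opp t) = om x t.
Hypothesis om_closed : forall x t t', om x t (+) om (x + e t) t' = om x t' (+) om (x + e t') t.
Hypothesis om_cut : forall x t, om x t -> (x \in W) != (x + e t \in W).

Lemma wall_coord (x : T) i : (x 0 i == 0) || (x 0 i == -1) -> x \in wall.
Proof. by move=> xi; rewrite inE; apply/existsP; exists i. Qed.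

Lemma om_wall x t : x \in wall -> x + e t \in wall -> om x t = false.
Proof.
move=> xw yw; apply/negP => /om_cut.
by rewrite (disjointFl W_wall xw) (disjointFl W_wall yw).
Qed.

(* A closed Z/2-valued 1-cochain [om] that vanishes on the wall has the potential
   [ray_parity]: the sum of [om] along the ray from x to the wall. *)
Let ray_parity (x : T) : bool := \big[addb/false]_(j < x 0 i0) om (x + e (i0, false) *+ j) (i0, false).

(** Adds up the squares between two parallel rays: everything cancels except the two end rungs, and
    the far one lies in the wall. *)
Lemma ray_parity_transverse x (t : D) : t.1 != i0 -> ray_parity x (+) ray_parity (x + e t) = om x t.
Proof.
move=> ti; rewrite /ray_parity [in RHS]/=.
have xt : (x + e t) 0 i0 = x 0 i0 by rewrite mxE stpE ifN 1?eq_sym // addr0.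
rewrite xt -big_split /=.
have H n : \big[addb/false]_(j < n) (om (x + e (i0, false) *+ j) (i0, false) (+)
    om (x + e t + e (i0, false) *+ j) (i0, false)) =
    om x t (+) om (x + e (i0, false) *+ n) t.
  elim: n => [|n IH]; first by rewrite big_ord0 mulr0n addr0 addbb.
  rewrite big_ord_recr /= IH [x + e t + _]addrAC mulrSr addrA.
  set y := x + _ *+ n; have := om_closed y (i0, false) t.
  case: (om x t); case: (om y t); case: (om y (i0, false)); case: (om (y + e t) (i0, false));
  by case: (om (y + e (i0, false)) t).
rewrite H -[RHS]addbF; congr addb; apply: om_wall.
  apply: (@wall_coord _ i0); rewrite line_coordi mulNrn.
  by rewrite -[1 *+ _]/(_%:R) natr_Zp addrN eqxx.
apply: (@wall_coord _ i0); rewrite mxE stpE ifN 1?eq_sym // addr0 line_coordi mulNrn.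
by rewrite -[1 *+ _]/(_%:R) natr_Zp addrN eqxx.
Qed.

Lemma Zn_pred (a : Zn) : a != 0 -> nat_of_ord a = (nat_of_ord (a - 1)%R).+1.
Proof.
move=> a0; have E : a = (a - 1) + 1 by rewrite subrK.
have : nat_of_ord a = (((a - 1)%R + 1 %% p.+2) %% p.+2)%N by rewrite {1}E.
rewrite (@modn_small 1) //.
have := ltn_ord (a - 1); rewrite leq_eqVlt => /orP[/eqP H|H].
  have -> : ((a - 1)%R + 1)%N = p.+2 by rewrite addn1.
  by rewrite modnn => H0; case/eqP: a0; apply: val_inj.
by rewrite modn_small addn1.
Qed.

Lemma ray_parity_down (x : T) : x 0 i0 != 0 -> ray_parity x (+) ray_parity (x + e (i0, false)) = om x (i0, false).
Proof.
move=> x0; rewrite /ray_parity (Zn_pred x0) big_ord_recl mulr0n addr0.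
have -> : (x + e (i0, false)) 0 i0 = x 0 i0 - 1 by rewrite mxE stpE eqxx.
rewrite [in X in _ (+) _ (+) X](eq_bigr (fun j : 'I_(x 0 i0 - 1)%R => om (x + e (i0, false) *+ (lift ord0 j)) (i0, false))).
  by rewrite -addbA addbb addbF.
by move=> j _; rewrite -addrA -mulrS.
Qed.

(** For a step along the ray direction the two rays differ by one edge, unless the step wraps
    around; off the wall it does not. *)
Lemma ray_parity_step x t : x \notin wall -> ray_parity x (+) ray_parity (x + e t) = om x t.
Proof.
move=> xw; have [ti|] := eqVneq t.1 i0; last exact: ray_parity_transverse.
have x0 : x 0 i0 != 0 by apply: contra xw => x0; apply: (@wall_coord _ i0); rewrite x0.
have xN : x 0 i0 != -1 by apply: contra xw => x1; apply: (@wall_coord _ i0); rewrite x1 orbT.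
case: t ti => i [] /= ->; last exact: ray_parity_down.
have E : x + e (i0, true) + e (i0, false) = x.
  by rewrite -[(i0, false)]/(opp (i0, true)) stpN addrK.
have := @ray_parity_down (x + e (i0, true)); rewrite E addbC => ->.
  exact: (om_sym x (i0, true)).
by rewrite mxE stpE eqxx /= addr_eq0.
Qed.

(** If a coordinate other than [i0] puts x on the wall, the whole ray stays in that face, where [om]
    vanishes. A site with [x 0 i0 = -1] is moved along [i1] inside its own face, which does not
    change the parity, until its [i1] coordinate is 0. This is where a second direction is used. *)
Lemma ray_parity_wall x : x \in wall -> ray_parity x = false.
Proof.
have other (y : T) i : i != i0 -> (y 0 i == 0) || (y 0 i == -1) -> ray_parity y = false.
  move=> ii0 yi; rewrite /ray_parity big1 // => j _; apply: om_wall.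
    by apply: (@wall_coord _ i); rewrite line_coord.
  by rewrite -addrA -mulrSr; apply: (@wall_coord _ i); rewrite line_coord.
rewrite inE => /existsP[i]; have [->{i}|] := eqVneq i i0; last exact: other.
case/orP=> [/eqP x0|/eqP xN]; first by rewrite /ray_parity x0 big_ord0.
have H n : ray_parity (x + e (i1, false) *+ n) = ray_parity x.
  elim: n => [|n <-]; first by rewrite mulr0n addr0.
  rewrite mulrSr addrA; set y := x + _ *+ n.
  have yi0 k : (x + e (i1, false) *+ k) 0 i0 = -1 by rewrite line_coord 1?eq_sym.
  have := @ray_parity_transverse y (i1, false) i01; rewrite om_wall; first by case: (ray_parity y); case: (ray_parity _).
    by apply: (@wall_coord _ i0); rewrite yi0 eqxx orbT.
  by apply: (@wall_coord _ i0); rewrite -addrA -mulrSr yi0 eqxx orbT.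
rewrite -(H (x 0 i1)); apply: (other _ i1) => //.
by rewrite line_coordi mulNrn -[1 *+ _]/(_%:R) natr_Zp addrN eqxx.
Qed.

(** A site outside [W] reaches the wall without crossing a cut edge, so the potential keeps its
    value on the wall. *)
Lemma ray_parity_out x : x \notin W -> ray_parity x = false.
Proof.
move=> xW; have [|w ww] := W_out (x := x); first by rewrite inE.
case/connectP=> s; elim: s x xW => [|y s IH] x xW /=; first by move=> _ <-; exact: ray_parity_wall.
case/andP=> /and3P[_ yW /existsP[t /eqP yE]] ps lw.
have [xw|xw] := boolP (x \in wall); first exact: ray_parity_wall.
have yW' : y \notin W by rewrite inE in yW.
have := ray_parity_step t xw; rewrite -yE (IH y) // addbF => ->.
by apply/negP => /om_cut; rewrite -yE (negbTE xW) (negbTE yW').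
Qed.

Lemma ray_parity_in x : x \in W -> ray_parity x = ray_parity v0.
Proof.
move=> xW; case/connectP: (W_conn xW) => s; elim/last_ind: s x xW => [|s y IH] x xW; first by move=> _ ->.
rewrite rcons_path last_rcons => /andP[ps /and3P[lW yW /existsP[t /eqP yE]]] ->.
have <- := IH _ lW ps erefl.
have := @ray_parity_step (last v0 s) t; rewrite (disjointFr W_wall lW) -yE => /(_ isT).
case H : (om _ _); last by case: (ray_parity _); case: (ray_parity _).
by have := om_cut H; rewrite -yE lW yW.
Qed.

(* The edge boundary of W is connected through squares. *)
Lemma cut_connected :
  (forall x t, om x t = false) \/ (forall x t, (x \in W) != (x + e t \in W) -> om x t).
Proof.
have H x t : x \in W -> x + e t \notin W -> om x t = ray_parity v0.
  move=> xW yW; rewrite -(@ray_parity_step x t) ?(disjointFr W_wall xW) //.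
  by rewrite (ray_parity_in xW) (ray_parity_out yW) addbF.
have H2 x t : (x \in W) != (x + e t \in W) -> om x t = ray_parity v0.
  have [xW|xW] := boolP (x \in W); first by move=> yW; apply: H => //; case: (_ \in W) yW.
  rewrite eq_sym => yW; rewrite -om_sym; apply: H; first by case: (_ \in W) yW.
  by rewrite stpN addrK.
case E : (ray_parity v0); [right|left] => x t; first by move/H2 ->.
by apply/negP => Hom; have := om_cut Hom => /H2; rewrite Hom E.
Qed.
End Cut.

(** * Paths inside a set of sites *)

Section Steps.
Variables (T : finZmodType) (D : finType) (e : D -> T) (opp : D -> D).
Hypothesis eN : forall t, e (opp t) = - e t.
Local Notation conn A := (connect (@steps T _ e A)).

Lemma steps_sym A : symmetric (steps e A).
Proof.
move=> x y; rewrite /steps /= andbCA; congr [&& _, _ & _].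
by apply/existsP/existsP => -[t /eqP E]; exists (opp t); rewrite E eN addrK.
Qed.

Lemma conn_sym A : connect_sym (steps e A).
Proof. exact: sym_connect_sym (@steps_sym A). Qed.

Lemma conn_in A x y : conn A x y -> x \in A -> y \in A.
Proof.
case/connectP => s; elim/last_ind: s y => [|s z IH] y; first by move=> _ ->.
by rewrite rcons_path last_rcons => /andP[_ /and3P[_ zA _]] ->.
Qed.

Lemma conn_inl A x y : conn A x y -> y \in A -> x \in A.
Proof. by rewrite conn_sym; apply: conn_in. Qed.

Lemma conn_step (A : {set T}) x t : x \in A -> x + e t \in A -> conn A x (x + e t).
Proof. by move=> xA yA; apply: connect1; rewrite /steps /= xA yA; apply/existsP; exists t. Qed.

Lemma conn_sub (A B : {set T}) x y : A \subset B -> conn A x y -> conn B x y.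
Proof.
move=> AB; apply: connect_sub => u v /and3P[uA vA uv]; apply: connect1.
by rewrite /steps /= !(subsetP AB).
Qed.

Lemma conn_closed (A B : {set T}) x y : x \in B ->
  (forall u t, u \in B -> u + e t \in A -> u + e t \in B) -> conn A x y -> conn B x y.
Proof.
move=> xB cl /connectP[s]; elim: s x xB => [|z s IH] x xB /=; first by move=> _ ->.
case/andP => /and3P[xA zA /existsP[t /eqP zE]] ps ly.
have zB : z \in B by rewrite zE; apply: cl; rewrite -?zE.
by apply: connect_trans (IH z zB ps ly); rewrite zE; apply: conn_step; rewrite -?zE.
Qed.

Lemma conn_next (A : {set T}) x y : conn A x y -> x != y -> exists t, (x \in A) && (x + e t \in A).
Proof.
case/connectP => -[|z s] /=; first by move=> _ ->; rewrite eqxx.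
by case/andP => /and3P[xA zA /existsP[t /eqP zE]] _ _ _; exists t; rewrite -zE xA.
Qed.
End Steps.

(** * Contours *)

Section Contour.
Variables (d p : nat).
Hypothesis p_even : ~~ odd p.
Hypothesis p_gt1 : (1 < p)%N.
Local Notation Zn := 'I_p.+2.
Local Notation T := ('rV[Zn]_d).
Local Notation D := ('I_d * bool)%type.
Local Notation e := (@stp d p).
Local Notation wall := (wall d p).
Local Notation conn A := (connect (@steps T _ e A)).

(** [b] is the parity occupied on the wall; sites of this parity are the even ones of the overview.
    The last two fields, no detached part and no hole, are what [cut_connected] asks for. *)
Record contour (b : bool) (v0 : T) (W : {set T}) : Prop := Contour {
  contour_wall : [disjoint W & wall];
  contour_start : v0 \in W;
  contour_par : par v0 = ~~ b;
  contour_bd : forall x t, x \in W -> x + e t \notin W -> par x = b;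
  contour_conn : {in W, forall x, conn W v0 x};
  contour_out : {in ~: W, forall x, exists2 w, w \in wall & conn (~: W) x w} }.

Definition ok (b : bool) (I : {set T}) : bool :=
  [forall x, forall t, (x \in I) ==> (x + e t \notin I)] &&
  [forall x in wall, (x \in I) == (par x == b)].

Lemma okP (b : bool) (I : {set T}) : reflect ((forall x t, x \in I -> x + e t \notin I) /\
   {in wall, forall x, (x \in I) = (par x == b)}) (ok b I).
Proof.
apply: (iffP andP) => -[H1 H2]; split.
- by move=> x t xI; move/forallP/(_ x)/forallP/(_ t): H1; rewrite xI.
- by move=> x xw; move/forall_inP/(_ x xw)/eqP: H2.
- by apply/forallP => x; apply/forallP => t; apply/implyP; apply: H1.
- by apply/forall_inP => x xw; apply/eqP; apply: H2.
Qed.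

Section Construction.
Variables (b : bool) (v0 : T) (I : {set T}) (i0 : 'I_d).

Definition odd_part : {set T} := [set x in I | par x != b].
Definition odd_nbhd : {set T} := [set x | (x \in odd_part) || [exists t, x + e t \in odd_part]].
Definition cluster : {set T} := [set x | conn odd_nbhd v0 x].
(** The cluster with its holes filled: all sites that it cuts off from the wall. *)
Definition contour_of : {set T} :=
  [set z | ~~ [exists w in wall, conn (~: cluster) z w]].

Hypothesis okI : ok b I.
Hypothesis v0I : v0 \in I.
Hypothesis v0b : par v0 = ~~ b.

Let indI x t : x \in I -> x + e t \notin I. Proof. by have [H _] := okP _ _ okI; apply: H. Qed.
Let wallI x : x \in wall -> (x \in I) = (par x == b). Proof. by have [_ H] := okP _ _ okI; apply: H. Qed.

Let v0o : v0 \in odd_part. Proof. by rewrite inE v0I v0b; case: b. Qed.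

Let v0B : v0 \in odd_nbhd. Proof. by rewrite inE v0o. Qed.

Lemma cluster_nbhd x : x \in cluster -> x \in odd_nbhd.
Proof. by rewrite inE => /conn_in; apply. Qed.

Lemma cluster_step x t : x \in cluster -> x + e t \in odd_nbhd -> x + e t \in cluster.
Proof.
move=> xA yB; rewrite inE; apply: connect_trans (_ : conn _ x _); first by rewrite inE in xA.
by apply: conn_step => //; apply: cluster_nbhd.
Qed.

Lemma odd_nbhd_wall x : x \in odd_nbhd -> x \notin wall.
Proof.
rewrite inE => xB; apply/negP => xw.
case/orP: xB => [|/existsP[t]]; first by rewrite inE wallI //; case: eqP.
rewrite inE => /andP[yI yb]; have := @indI _ (opp t) yI; rewrite stpN addrK wallI //.
by move: yb; rewrite par_stp //; case: (par x); case: b.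
Qed.

Lemma notin_contourP z : reflect (exists2 w, w \in wall & conn (~: cluster) z w) (z \notin contour_of).
Proof. by rewrite inE negbK; apply: (iffP exists_inP). Qed.

Lemma cluster_contour : cluster \subset contour_of.
Proof.
apply/subsetP => x xA; apply: contraT => /notin_contourP[w ww xw].
have wA : w \notin cluster by apply: contraL ww => /cluster_nbhd /odd_nbhd_wall.
by have := conn_inl (@stpN d p) xw; rewrite !in_setC xA wA => /(_ isT).
Qed.

Lemma notin_contour_step x t : x \notin contour_of -> x + e t \notin cluster ->
  x + e t \notin contour_of.
Proof.
move=> xW yA; have xA : x \notin cluster by apply: contra xW; apply/subsetP/cluster_contour.
case/notin_contourP: xW => w ww xw; apply/notin_contourP; exists w => //.
apply: connect_trans xw; rewrite (conn_sym (@stpN d p)).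
by apply: conn_step; rewrite in_setC.
Qed.

(** A step out of the filled cluster starts in the cluster and ends off it. So [x] is not an
    occupied odd site, whose neighbours all join the cluster; it is an even neighbour of one, hence
    empty. Then [x + e t] is odd, and if occupied it would join the cluster too. *)
Lemma contour_of_edge x t : x \in contour_of -> x + e t \notin contour_of ->
  [/\ x \in cluster, par x = b, x \notin I & x + e t \notin I].
Proof.
move=> xW yW.
have xA : x \in cluster.
  apply: contraLR xW => xA; have := @notin_contour_step _ (opp t) yW.
  by rewrite stpN addrK; apply.
have yA : x + e t \notin cluster by apply: contra yW; apply/subsetP/cluster_contour.
have xo : x \notin odd_part.
  apply: contra yA => xo; apply: cluster_step => //; rewrite inE; apply/orP; right.
  by apply/existsP; exists (opp t); rewrite stpN addrK.
have xb : par x = b /\ x \notin I.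
  have := cluster_nbhd xA; rewrite inE (negbTE xo) /= => /existsP[s]; rewrite inE => /andP[zI zb].
  have xb : par x = b by move: zb; rewrite par_stp //; case: (par x); case: b.
  by split=> //; apply/negP => /(@indI _ s); rewrite zI.
case: xb => xb xI; split=> //.
apply: contra yA => yI; apply: cluster_step => //.
by rewrite inE inE yI par_stp // xb; case: b.
Qed.

Lemma contour_of_contour : contour b v0 contour_of.
Proof.
have v0W : v0 \in contour_of by apply: (subsetP cluster_contour); rewrite inE connect0.
have WC : [disjoint contour_of & wall].
  rewrite disjoint_subset; apply/subsetP => x xW; rewrite inE; apply/negP => xw.
  by case/notin_contourP: xW; exists x.
have clW x : x \in cluster -> conn contour_of v0 x.
  rewrite inE => xA; apply: (conn_sub cluster_contour).
  apply: conn_closed xA; first by rewrite inE.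
  exact: cluster_step.
split=> //.
- by move=> x t xW /(contour_of_edge xW)[].
- move=> x xW; have [xA|xA] := boolP (x \in cluster); first exact: clW.
  (* A site in a hole is joined to the cluster by a ray: the ray meets the cluster before it can
     reach the wall, and up to there it stays in the filled set. *)
  pose y k := x + e (i0, true) *+ k.
  have yS k : y k.+1 = y k + e (i0, true) by rewrite /y mulrSr addrA.
  have [k kw] := line_wall x i0 true.
  have ex : exists k, y k \in cluster.
    have [/existsP[j yj]|/existsPn H] := boolP [exists j : 'I_k.+1, y j \in cluster]; first by exists j.
    case/notin_contourP: xW; exists (y k) => //.
    have H' j : (j <= k)%N -> y j \notin cluster by rewrite -ltnS => jk; apply: (H (Ordinal jk)).
    elim: k {kw H} H' => [|k IH] H'; first by rewrite /y mulr0n addr0.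
    apply: connect_trans (IH _) _; first by move=> j jk; apply: H'; apply: leqW.
    by rewrite yS; apply: conn_step; rewrite in_setC -?yS H'.
  case: (ex_minnP ex) => j yj jmin.
  have yW i : (i < j)%N -> y i \in contour_of.
    elim: i => [|i IH] ij; first by rewrite /y mulr0n addr0.
    have := IH (ltnW ij); apply: contraLR; rewrite yS => /(@notin_contour_step _ (opp (i0, true))).
    rewrite stpN addrK; apply; apply/negP => /jmin.
    by rewrite leqNgt (ltnW ij).
  apply: connect_trans (clW _ yj) _; rewrite (conn_sym (@stpN d p)).
  have cW i : (i <= j)%N -> conn contour_of x (y i).
    elim: i => [|i IH] ij; first by rewrite /y mulr0n addr0.
    apply: connect_trans (IH (ltnW ij)) _; rewrite yS; apply: conn_step; first exact: yW.
    rewrite -yS; case: (ltngtP i.+1 j) ij => // [ij _|-> _]; first exact: yW.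
    exact: (subsetP cluster_contour).
  exact: cW.
- move=> x; rewrite inE => xW; case/notin_contourP: (xW) => w ww xw; exists w => //.
  apply: conn_closed xw; first by rewrite inE.
  by move=> u t; rewrite !in_setC; apply: notin_contour_step.
Qed.
End Construction.
End Contour.

Local Close Scope ring_scope.

Lemma card_bigcup_leq (I X : finType) (A : pred I) (F : I -> {set X}) :
  #|\bigcup_(i | A i) F i| <= \sum_(i | A i) #|F i|.
Proof.
elim/big_rec2: _ => [|i n U _ H]; first by rewrite cards0.
by apply: leq_trans (leq_card_setU _ _) _; rewrite leq_add2l.
Qed.

(** * Greedy coverings in bipartite graphs *)

Section Cover.
Variables (X Y : finType) (R : X -> Y -> bool) (A : {set X}) (M : {set Y}) (k : nat).
Hypothesis k_gt0 : 0 < k.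
Hypothesis deg : {in A, forall x, k <= #|[set y in M | R x y]|}.

Definition missed (A' : {set X}) (U : {set Y}) := [set x in A' | ~~ [exists y in U, R x y]].

Lemma half_cover (A' : {set X}) : A' \subset A ->
  exists2 U : {set Y}, U \subset M & #|U| * k <= 2 * #|M| /\ 2 * #|missed A' U| <= #|A'|.
Proof.
move=> A'A; have [n0|n_gt0] := posnP #|A'|.
  exists set0; rewrite ?sub0set ?cards0 //; split=> //.
  by rewrite n0 leqn0 muln_eq0 /= -leqn0 -n0; apply/subset_leq_card/subsetP => x; rewrite inE => /andP[].
pose cov (U : {set Y}) := [set x in A' | [exists y in U, R x y]].
(* A maximiser of [f] works: by averaging, some site of M covers many missed elements. *)
pose f (U : {set Y}) := #|cov U| * (2 * #|M|) + (#|M| - #|U|) * (k * #|A'|).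
have [U UM Umax] := @arg_maxnP _ set0 (fun U : {set Y} => U \subset M) f (sub0set M).
exists U => //; have cU := subset_leq_card UM.
have covle V : #|cov V| <= #|A'| by apply/subset_leq_card/subsetP => x; rewrite inE => /andP[].
split.
  have := Umax _ (sub0set M); rewrite /f cards0 subn0.
  have -> : #|cov set0| = 0.
    by apply/eqP; rewrite cards_eq0; apply/eqP/setP => x; rewrite !inE; case: existsP => [[y]|_]; rewrite ?inE ?andbF.
  rewrite mul0n add0n mulnBl => H.
  rewrite -(leq_pmul2r n_gt0).
  have H1 := leq_mul (covle U) (leqnn (2 * #|M|)).
  have H2 := leq_mul cU (leqnn (k * #|A'|)); lia.
have new u : u \in M -> #|[set x in missed A' U | R x u]| * (2 * #|M|) <= k * #|A'|.
  move=> uM; have [uU|uU] := boolP (u \in U).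
    suff -> : [set x in missed A' U | R x u] = set0 by rewrite cards0.
    apply/setP => x; rewrite !inE; apply/negbTE/negP => /andP[/andP[_ /negP H] xu].
    by apply: H; apply/exists_inP; exists u.
  have := Umax (u |: U); rewrite subUset sub1set uM UM => /(_ isT); rewrite /f /=.
  have -> : cov (u |: U) = cov U :|: [set x in missed A' U | R x u].
    apply/setP => x; rewrite !inE; case: (x \in A') => //=.
    have [/exists_inP[y yU xy]|/negP H] := boolP [exists y in U, R x y].
      by apply/exists_inP; exists y => //; rewrite inE yU orbT.
    apply/exists_inP/idP => [[y]|xu]; last by exists u; rewrite // inE set11.
    rewrite !inE => /orP[/eqP -> //|yU xy]; case: H; apply/exists_inP; by exists y.
  rewrite cardsU (_ : _ :&: _ = set0); last first.
    apply/setP => x; rewrite !inE; case: (x \in A') => //=.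
    by case: [exists y in U, R x y].
  rewrite cards0 subn0 cardsU1 uU /=.
  have uUM : #|U| < #|M|.
    by apply: proper_card; rewrite properE UM; apply/subsetPn; exists u.
  have -> : #|M| - #|U| = (#|M| - (1 + #|U|)).+1 by lia.
  rewrite mulSn mulnDl; lia.
have M_gt0 : 0 < #|M|.
  have /card_gt0P[x xA] := n_gt0.
  have := deg (subsetP A'A _ xA); have : #|[set y in M | R x y]| <= #|M|.
    by apply/subset_leq_card/subsetP => y; rewrite inE => /andP[].
  lia.
have S1 : \sum_(u in M) #|[set x in missed A' U | R x u]| * (2 * #|M|) <= #|M| * (k * #|A'|).
  by rewrite -sum_nat_const; apply: leq_sum => u; apply: new.
have S2 : k * #|missed A' U| <= \sum_(u in M) #|[set x in missed A' U | R x u]|.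
  rewrite (eq_bigr (fun u => \sum_(x in missed A' U) R x u)); last first.
    by move=> u _; rewrite -sum1dep_card big_mkcondr.
  rewrite exchange_big /= mulnC -sum_nat_const; apply: leq_sum => x xm.
  have xA : x \in A by apply: (subsetP A'A); move: xm; rewrite inE => /andP[].
  apply: leq_trans (deg xA) _; rewrite -sum1dep_card big_mkcondr.
  by apply: leq_sum => y _; case: (R x y).
rewrite -big_distrl /= in S1.
have : k * #|missed A' U| * (2 * #|M|) <= #|M| * (k * #|A'|).
  by apply: leq_trans S1; rewrite leq_pmul2r // muln_gt0.
have -> : k * #|missed A' U| * (2 * #|M|) = #|M| * (k * (2 * #|missed A' U|)) by lia.
by rewrite leq_pmul2l // leq_pmul2l.
Qed.

Lemma iter_cover j : exists2 U : {set Y}, U \subset M &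
  #|U| * k <= 2 * j * #|M| /\ 2 ^ j * #|missed A U| <= #|A|.
Proof.
elim: j => [|j [U UM [cU mU]]].
  exists set0; first exact: sub0set.
  rewrite cards0; split=> //; rewrite mul1n.
  by apply/subset_leq_card/subsetP => x; rewrite inE => /andP[].
have mA : missed A U \subset A by apply/subsetP => x; rewrite inE => /andP[].
have [V VM [cV mV]] := half_cover mA.
exists (U :|: V); first by rewrite subUset UM.
split; first by have [cUV _] := leq_card_setU U V; have := leq_mul cUV (leqnn k); nia.
have : missed A (U :|: V) \subset missed (missed A U) V.
  apply/subsetP => x; rewrite !inE => /andP[-> /negP H] /=; apply/andP; split.
    apply/negP => /exists_inP[y yU xy]; apply: H; apply/exists_inP; exists y => //.
    by rewrite inE yU.
  apply/negP => /exists_inP[y yU xy]; apply: H; apply/exists_inP; exists y => //.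
  by rewrite inE yU orbT.
move/subset_leq_card => H; rewrite expnS; nia.
Qed.

(** Halving the uncovered part [j] times leaves at most [#|M| / k] elements, which get one chosen
    neighbour each. The loss over the fractional cover of weight [#|M| / k] is the usual
    logarithm. *)
Lemma log_cover j : #|A| * k <= 2 ^ j * #|M| -> exists2 U : {set Y}, U \subset M &
  #|U| * k <= (2 * j).+1 * #|M| /\ {in A, forall x, exists2 y, y \in U & R x y}.
Proof.
move=> Aj; have [U UM [cU mU]] := iter_cover j.
have cov x : x \in A -> exists y, (y \in M) && R x y.
  move=> xA; have /card_gt0P[y] := leq_trans k_gt0 (deg xA).
  by rewrite inE => yy; exists y.
pose pk x : {set Y} := if [pick y | (y \in M) && R x y] is Some y then [set y] else set0.
exists (U :|: \bigcup_(x in missed A U) pk x).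
  rewrite subUset UM; apply/bigcupsP => x _; rewrite /pk.
  by case: pickP => [y /andP[yM _]|_]; rewrite ?sub0set // sub1set.
split.
  have cV : #|\bigcup_(x in missed A U) pk x| <= #|missed A U|.
    apply: leq_trans (card_bigcup_leq _ _) _; rewrite -sum1_card; apply: leq_sum => x _.
    by rewrite /pk; case: pickP => [y _|_]; rewrite ?cards1 ?cards0.
  have : #|missed A U| * k <= #|M|.
    have p2 : 0 < 2 ^ j by rewrite expn_gt0.
    rewrite -(leq_pmul2l p2) mulnA; apply: leq_trans Aj.
    exact: leq_mul.
  have [cUV _] := leq_card_setU U (\bigcup_(x in missed A U) pk x).
  have := leq_mul cUV (leqnn k); have := leq_mul cV (leqnn k); nia.
move=> x xA; have [/exists_inP[y yU xy]|nU] := boolP [exists y in U, R x y].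
  by exists y => //; rewrite inE yU.
have [y yM] := cov x xA.
have [z zpk xz] : exists2 z, z \in pk x & R x z.
  rewrite /pk; case: pickP => [z /andP[_ xz]|/(_ y)]; last by rewrite yM.
  by exists z => //; rewrite inE.
exists z => //; rewrite inE; apply/orP; right; apply/bigcupP; exists x => //.
by rewrite inE xA.
Qed.
End Cover.

Lemma arith_components d z u v : 4 <= d -> z * (d - 2) <= v -> v <= d.*2 * u -> z <= 4 * u.
Proof.
move=> d4 H1 H2; rewrite -(@leq_pmul2r (d - 2)); last by lia.
apply: leq_trans H1 _; apply: leq_trans H2 _; rewrite -mul2n.
have H : d <= 2 * (d - 2) by lia.
have := leq_mul (leqnn (2 * u)) H; lia.
Qed.

Lemma arith_direction d psi l L n s : 0 < d -> n * d.*2 <= psi * s -> s <= 2 * L ->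
  psi * psi <= d * l -> n * psi <= l * L.
Proof.
move=> d0 H1 H2 H3; rewrite -(leq_pmul2l d0).
have H4 := leq_trans H1 (leq_mul (leqnn psi) H2).
have H5 : n * d <= psi * L by rewrite -mul2n in H4; lia.
have H6 := leq_mul H5 (leqnn psi); have H7 := leq_mul H3 (leqnn L); lia.
Qed.

(** The summands are the sizes of the eight data sets of [approximation]. In units of [l * L / psi]
    they contribute at most [48 * (1 + 4 + 6 + 6)], then 2 and 2. *)
Lemma arith_total psi l L u z a1 g1 a2 g2 p q n : 0 < l ->
  u * psi <= (8 * (2 * l.+1).+1 + 8 * l) * L -> z <= 4 * u -> a1 <= 6 * u -> g1 <= 6 * u ->
  (a2 * psi) + (g2 * psi) <= 2 * L -> p <= n -> q <= n -> n * psi <= l * L ->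
  (u + (z + (a1 + (g1 + (a2 + (g2 + (p + (q + 0)))))))) * psi <= 822 * l * L.
Proof.
move=> l0 Hu Hz Ha Hg H2 Hp Hq Hn.
have {}Hu : u * psi <= 48 * (l * L).
  apply: leq_trans Hu _; have : L <= l * L by rewrite leq_pmull.
  by lia.
have H6 : L <= l * L by rewrite leq_pmull.
have H7 := leq_mul Hz (leqnn psi); have H8 := leq_mul Ha (leqnn psi); have H9 := leq_mul Hg (leqnn psi).
have H10 := leq_mul Hp (leqnn psi); have H11 := leq_mul Hq (leqnn psi).
lia.
Qed.

(** * Approximation of contours *)

Section Graph.
Variables (T : finZmodType) (D : finType) (e : D -> T) (opp : D -> D) (par : T -> bool) (d : nat).
Hypothesis eN : forall t, e (opp t) = (- e t)%R.
Hypothesis oppK : involutive opp.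
Hypothesis e_inj : injective e.
Hypothesis par_e : forall x t, par (x + e t)%R = ~~ par x.
Hypothesis cardD : #|D| = d.*2.

Implicit Types (A B S : {set T}) (x y z u v : T) (t s : D).

Definition deg (A : {set T}) (x : T) : nat := #|[set t | (x + e t)%R \in A]|.
Definition nbhd (A : {set T}) : {set T} := [set x | [exists t, (x + e t)%R \in A]].

Lemma nbhdP A x : reflect (exists t, (x + e t)%R \in A) (x \in nbhd A).
Proof. by rewrite inE; apply: existsP. Qed.

Lemma addeK x t : (x + e t + e (opp t))%R = x.
Proof. by rewrite eN addrK. Qed.

(** Double counting: every directed edge is replaced by its reverse. *)
Lemma edges_count (P : T -> D -> bool) :
  \sum_x #|[set t | P x t]| = \sum_x #|[set t | P (x + e t)%R (opp t)]|.
Proof.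
have E (Q : T -> D -> bool) : \sum_x #|[set t | Q x t]| = \sum_t \sum_x Q x t.
  rewrite exchange_big /=; apply: eq_bigr => x _; rewrite -sum1dep_card big_mkcond.
  by apply: eq_bigr => t _; case: (Q x t).
rewrite !E (reindex_inj (inv_inj oppK)) /=; apply: eq_bigr => t _.
by rewrite (reindex_inj (addIr (e t))) /=.
Qed.

Lemma sum_in (A : {set T}) (P : T -> D -> bool) :
  \sum_(x in A) #|[set t | P x t]| = \sum_x #|[set t | (x \in A) && P x t]|.
Proof.
rewrite big_mkcond; apply: eq_bigr => x _; case: (x \in A) => //=.
by apply/esym/eqP; rewrite cards_eq0; apply/eqP/setP => t; rewrite !inE.
Qed.

Lemma deg_sym A B : \sum_(x in A) deg B x = \sum_(y in B) deg A y.
Proof.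
rewrite /deg !sum_in edges_count; apply: eq_bigr => x _; congr #|pred_of_set _|.
by apply/setP => t; rewrite !inE addeK andbC.
Qed.

Lemma deg_le A x : deg A x <= d.*2.
Proof. by rewrite -cardD max_card. Qed.

Lemma sum_deg A B : \sum_(x in B) deg A x <= d.*2 * #|A|.
Proof.
by rewrite deg_sym mulnC -sum_nat_const; apply: leq_sum => y _; exact: deg_le.
Qed.

Lemma card_deg_ge (A S : {set T}) k : {in S, forall x, k <= deg A x} -> #|S| * k <= d.*2 * #|A|.
Proof.
move=> H; apply: leq_trans (sum_deg A S).
by rewrite -sum_nat_const; apply: leq_sum.
Qed.

Lemma card_nbhd A : #|nbhd A| <= d.*2 * #|A|.
Proof.
rewrite -[X in X <= _]muln1; apply: card_deg_ge => x /nbhdP[t xt].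
by apply/card_gt0P; exists t; rewrite inE.
Qed.

Definition adj : rel T := [rel x y | [exists t, y == (x + e t)%R]].

Lemma deg_adj A x : deg A x = #|[set y in A | adj x y]|.
Proof.
rewrite /deg -(card_imset _ (inj_comp (@addrI T x) e_inj)).
apply: eq_card => y; rewrite !inE; apply/imsetP/andP.
  by case=> t; rewrite inE => xt ->; split=> //; apply/existsP; exists t.
by case=> yA /existsP[t /eqP yE]; exists t => //; rewrite inE -yE.
Qed.

(** * A small set whose neighbourhood meets every cut edge *)

Section Cutset.
Variables (b : bool) (W : {set T}) (L psi l j : nat).
Hypothesis W_bd : forall x t, x \in W -> (x + e t)%R \notin W -> par x = b.
Hypothesis W_nbr : forall x, exists t, ((x + e t)%R \in W) = (x \in W).

Definition cut (x : T) (t : D) : bool := (x \in W) != ((x + e t)%R \in W).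
Definition cutdeg (x : T) : nat := #|[set t | cut x t]|.

Hypothesis W_tot : \sum_x cutdeg x = 4 * (d * L).
Hypothesis psi_gt0 : 0 < psi.
Hypothesis psi_led : psi <= d.
Hypothesis psi_sq : psi * psi <= d * l.
Hypothesis j_large : d.*2 <= 2 ^ j.

Lemma cut_par x t : cut x t -> par x = ~~ (b (+) (x \in W)).
Proof.
rewrite /cut; case: (boolP (x \in W)) => xW.
  by case: (boolP (_ \in W)) => // yW _; rewrite (W_bd xW yW) addbT negbK.
case: (boolP (_ \in W)) => // yW _.
have := @W_bd _ (opp t) yW; rewrite addeK => /(_ xW); rewrite par_e addbF.
by case: (par x) => <-.
Qed.

Lemma cutC x t : cut (x + e t)%R (opp t) = cut x t.
Proof. by rewrite /cut addeK eq_sym. Qed.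

(** Otherwise the parallel edge from [x + e t] would be cut as well, and its end inside [W] would
    have the wrong parity. *)
Lemma cut_add x s t : cut x s -> cut x t || cut (x + e s)%R t.
Proof.
move=> xs; apply: contraT; rewrite negb_or /cut !negbK => /andP[/eqP xt /eqP st].
have zc : cut (x + e t)%R s by rewrite /cut -xt addrAC -st.
by have := cut_par zc; rewrite par_e (cut_par xs) -xt; case: (_ (+) _).
Qed.

Lemma cutdeg_add x s : cut x s -> d.*2 <= cutdeg x + cutdeg (x + e s)%R.
Proof.
move=> xs; rewrite -cardD -cardsT.
apply: leq_trans (leq_card_setU _ _).1; apply/subset_leq_card/subsetP => t _.
by rewrite !inE cut_add.
Qed.

(** [VH] are the sites of nearly full cut degree. [X1] is small enough to be put into the separating
    set as a whole, whereas [Tg] is only covered by neighbourhoods of sites of [M], at a logarithmic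
    loss. *)
Let M : {set T} := [set v | psi <= cutdeg v].
Let VH : {set T} := [set v | d.*2 < cutdeg v + psi].
Let same_high v := [set t | ((v \in W) == ((v + e t)%R \in W)) && ((v + e t)%R \in VH)].
Let X1 : {set T} := [set v | d <= 2 * #|same_high v|].
Let Tg : {set T} := [set v | d <= 2 * deg M v].

Let card_cutdeg (S : {set T}) k : {in S, forall x, k <= cutdeg x} -> #|S| * k <= 4 * (d * L).
Proof.
move=> H; rewrite -W_tot (bigID (mem S)) /= -sum_nat_const.
by apply: leq_trans (leq_addr _ _); apply: leq_sum.
Qed.

Let d_gt0 : 0 < d. Proof. exact: leq_trans psi_gt0 psi_led. Qed.

(** A site of [VH] has fewer than [psi] uncut edges and there are at most [4 * L] such sites, so
    double counting gives [#|X1| * d <= 8 * L * psi]; then [psi_sq] applies. *)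
Let card_X1 : #|X1| * psi <= 8 * l * L.
Proof.
have cVH : #|VH| <= 4 * L.
  have := @card_cutdeg VH d; rewrite [4 * _]mulnCA [#|_| * _]mulnC leq_pmul2l //; apply.
  by move=> v; rewrite inE; lia.
have cX : #|X1| * d <= 2 * (#|VH| * psi).
  have -> : #|X1| * d = \sum_(v in X1) d by rewrite sum_nat_const.
  apply: (@leq_trans (\sum_(v in X1) 2 * #|same_high v|)).
    by apply: leq_sum => v; rewrite inE.
  rewrite -big_distrr leq_mul2l /=.
  apply: (@leq_trans (\sum_v #|same_high v|)).
    by rewrite [X in _ <= X](bigID (mem X1)) leq_addr.
  rewrite edges_count.
  have -> : #|VH| * psi = \sum_(v in VH) psi by rewrite sum_nat_const.
  rewrite [X in _ <= X]big_mkcond; apply: leq_sum => v _; case: ifPn => vV; last first.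
    rewrite leqn0 cards_eq0; apply/eqP/setP => t; rewrite !inE addeK.
    by rewrite inE in vV; rewrite (negbTE vV) andbF.
  have : #|[set t | cut v t]| + #|~: [set t | cut v t]| = d.*2 by rewrite cardsC cardD.
  rewrite -/(cutdeg v); move: vV; rewrite inE => vV E.
  apply: (@leq_trans #|~: [set t | cut v t]|); last lia.
  apply/subset_leq_card/subsetP => t; rewrite !inE addeK => /andP[/eqP H _].
  by rewrite /cut H eqxx.
rewrite -(leq_pmul2l d_gt0).
have H2 := leq_mul cX (leqnn psi).
have H3 := leq_mul (leqnn (2 * #|VH|)) psi_sq.
have H4 := leq_mul cVH (leqnn (2 * (d * l))).
lia.
Qed.

Let cover : exists2 U : {set T}, U \subset M &
  #|U| * psi <= 8 * (2 * j).+1 * L /\ {in Tg, forall x, x \in nbhd U}.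
Proof.
have k_gt0 : 0 < uphalf d by lia.
have dg : {in Tg, forall x, uphalf d <= #|[set y in M | adj x y]|}.
  by move=> x; rewrite inE -deg_adj; lia.
have Tj : #|Tg| * uphalf d <= 2 ^ j * #|M|.
  apply: leq_trans (leq_mul j_large (leqnn #|M|)).
  by apply: card_deg_ge => x; rewrite inE; lia.
have [U UM [cU covU]] := log_cover k_gt0 dg Tj.
exists U => //; split.
  have cM : #|M| * psi <= 4 * (d * L) by apply: card_cutdeg => x; rewrite inE.
  rewrite -(leq_pmul2l d_gt0).
  have H1 := leq_mul cU (leqnn (2 * psi)).
  have H2 := leq_mul cM (leqnn (2 * (2 * j).+1)).
  have dk : d <= 2 * uphalf d by lia.
  have H3 := leq_mul dk (leqnn (#|U| * psi)).
  lia.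
by move=> x /covU[y yU /existsP[t /eqP yE]]; apply/nbhdP; exists t; rewrite -yE.
Qed.

(** One end [v] of a cut edge has cut degree at least [d]. A neighbour [v'] of [v] on the same side
    has the wrong parity for cut edges. Hence, for a cut direction [t] at [v], the edge from
    [v + e t] to [v' + e t] is cut, and its ends have total cut degree at least [d.*2]: the former
    is in [M] or the latter in [VH]. So [v] has many neighbours in [M], or [v'] is in [X1]. *)
Lemma separating_set : exists U : {set T},
  [/\ #|U| * psi <= (8 * (2 * j).+1 + 8 * l) * L,
      forall x t, cut x t -> (x \in nbhd U) || ((x + e t)%R \in nbhd U) &
      forall u, u \in U -> exists x, (0 < cutdeg x) && ((x == u) || adj u x)].
Proof.
have [U UM [cU covU]] := cover.
exists (U :|: X1); split.
- have [c _] := leq_card_setU U X1; have := leq_mul c (leqnn psi).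
  have := card_X1; lia.
- have high v s : cut v s -> d <= cutdeg v -> v \in nbhd (U :|: X1).
    move=> vs dv; have [s' vs'] := W_nbr v.
    have v'W t : ((v + e s' + e t)%R \in W) = (v \in W).
      have := @cut_par (v + e s')%R t; rewrite /cut vs'.
      rewrite par_e (cut_par vs).
      by case: eqP => [->//|_ /(_ isT)]; case: (_ (+) _).
    have : d <= #|[set t | cut v t && ((v + e t)%R \in M)]| + #|same_high (v + e s')%R|.
      apply: (leq_trans dv); apply: leq_trans (leq_card_setU _ _).1.
      apply/subset_leq_card/subsetP => t; rewrite !inE v'W vs' eqxx /= => vt.
      rewrite vt /=; have [//|ltM] := leqP psi (cutdeg (v + e t)%R).
      have c' : cut (v + e t)%R s' by rewrite /cut addrAC v'W eq_sym.
      have := cutdeg_add c'; move=> H; rewrite addrAC in H; apply: leq_ltn_trans H _; by rewrite addnC ltn_add2l.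
    have : #|[set t | cut v t && ((v + e t)%R \in M)]| <= deg M v.
      by apply/subset_leq_card/subsetP => t; rewrite !inE => /andP[].
    move=> H1 H2; have [hT|hT] := leqP d (2 * deg M v).
      have : v \in Tg by rewrite inE.
      by move/covU/nbhdP => [t tU]; apply/nbhdP; exists t; rewrite inE tU.
    apply/nbhdP; exists s'; rewrite inE; apply/orP; right; rewrite inE.
    by lia.
  move=> x t xt; have := cutdeg_add xt; have [dx|dx] := leqP d (cutdeg x).
    by move=> _; rewrite (high x t).
  move=> H; apply/orP; right; apply: (high _ (opp t)); first by rewrite cutC.
  by lia.
- move=> u; rewrite inE => /orP[/(subsetP UM)|].
    by rewrite inE => H; exists u; rewrite eqxx andbT; apply: leq_trans H.
  rewrite inE => H; have : 0 < #|same_high u| by lia.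
  case/card_gt0P => t; rewrite !inE => /andP[_ H2]; exists (u + e t)%R.
  apply/andP; split; first by lia.
  by apply/orP; right; apply/existsP; exists t.
Qed.
End Cutset.

(** * Reconstruction of W away from the separating neighbourhood *)

Section Fat.
Variables (V0 W wall : {set T}) (t0 : D).
Local Notation conn A := (connect (@steps T _ e A)).
Hypothesis d_gt2 : 2 < d.
Hypothesis V0_sep : forall x t, x \notin V0 -> (x + e t)%R \notin V0 -> (x \in W) = ((x + e t)%R \in W).
Hypothesis W_wall : [disjoint W & wall].
Hypothesis exits : forall (C : {set T}) z, [disjoint C & wall] -> z \in C ->
  deg C z <= #|[set x in C | (x + e t0)%R \notin C]| + 2.

(** A fat site lies in a component of the complement of [V0] that is wide enough to have many exits
    if it avoids the wall; only O([#|V0|]) sites are not fat. *)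
Definition fat : {set T} := [set v in ~: V0 | d <= deg (~: V0) v].
Definition reached (Z : {set T}) : {set T} := [set v in fat | [exists z in Z, conn (~: V0) v z]].

Lemma degC A x : deg A x + deg (~: A) x = d.*2.
Proof.
rewrite -cardD -(cardsC [set t | (x + e t)%R \in A]); congr (_ + _).
by apply: eq_card => t; rewrite !inE.
Qed.

Lemma card_notfat : #|~: fat| <= 3 * #|V0|.
Proof.
pose thin : {set T} := [set v | d <= deg V0 v].
have : ~: fat \subset V0 :|: thin.
  apply/subsetP => v; rewrite !inE negb_and negbK; case: (v \in V0) => //=.
  by have := degC V0 v; lia.
move/subset_leq_card => H; have [H2 _] := leq_card_setU V0 thin.
have : #|thin| * d <= d.*2 * #|V0| by apply: card_deg_ge => x; rewrite inE.
by rewrite -muln2 -mulnA mulnC leq_pmul2l; lia.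
Qed.

Lemma component_sub x y : x \in W -> x \notin V0 -> conn (~: V0) x y -> y \in W.
Proof.
move=> xW xV0 xy; have: conn (W :\: V0) x y.
  apply: conn_closed xy; first by rewrite inE xW xV0.
  move=> u t; rewrite !inE => /andP[uV uW] vV; rewrite vV.
  by rewrite -(V0_sep uV vV).
by move/conn_in; rewrite !inE xW xV0 => /(_ isT) /andP[].
Qed.

(** Off [V0] no edge is cut, so each component lies inside [W] or outside. One that contains a fat
    site of [W] avoids the wall and has at least [d - 2] exits along [t0], all into [V0]; different
    components have different exits. [Z] keeps one exit for each of these components. *)
Lemma fat_components : exists Z : {set T},
  [/\ #|Z| * (d - 2) <= #|V0|, {in Z, forall z, (z + e t0)%R \in V0} & W :&: fat = reached Z].
Proof.
pose r := fingraph.root (steps e (~: V0)).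
have csym := conn_sym eN (~: V0).
pose C x : {set T} := [set u | conn (~: V0) x u].
pose E x : {set T} := [set u in C x | (u + e t0)%R \notin C x].
pose R : {set T} := r @: (W :&: fat).
have RE x : x \in R -> d - 2 <= #|E x| /\ {in E x, forall u, (u + e t0)%R \in V0}.
  case/imsetP => v; rewrite !inE => /and3P[vW vV0 vd] ->.
  have Cv : C (r v) = C v.
    by apply/setP => u; rewrite !inE (same_connect csym (connect_root _ v)).
  have Cw : [disjoint C v & wall].
    rewrite disjoint_subset; apply/subsetP => u; rewrite !inE => /(component_sub vW vV0) uW.
    by rewrite (disjointFr W_wall).
  have vC : v \in C v by rewrite inE connect0.
  rewrite /E Cv; split.
    have := exits Cw vC; have : deg (~: V0) v <= deg (C v) v.
      apply/subset_leq_card/subsetP => t; rewrite !inE => vt.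
      by apply: conn_step; rewrite inE.
    by rewrite -/(E v); lia.
  move=> u; rewrite !inE => /andP[vu]; apply: contraR => uV0.
  apply: connect_trans (vu) _; apply: conn_step; rewrite inE //.
  by have := conn_in vu; rewrite !inE => /(_ vV0).
have sumE : \sum_(x in R) #|E x| <= #|V0|.
  rewrite (eq_bigr (fun x => \sum_u (u \in E x))); last first.
    by move=> x _; rewrite -sum1_card big_mkcond; apply: eq_bigr => u _; case: (_ \in _).
  rewrite exchange_big /=.
  apply: (@leq_trans (\sum_u ((u + e t0)%R \in V0))); last first.
    rewrite (reindex_inj (addIr (- e t0)%R)) /= -sum1_card [X in _ <= X]big_mkcond.
    by apply: leq_sum => u _; rewrite subrK; case: (_ \in _).
  apply: leq_sum => u _; rewrite (bigID (pred1 (r u))) /= [X in _ + X]big1 ?addn0.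
    case: (boolP (r u \in R)) => rR; last first.
      rewrite big_pred0 // => x; apply/negbTE; apply: contra rR.
      by case/andP => xR /eqP <-.
    rewrite (big_pred1 (r u)); last by move=> x /=; case: eqP => [->|_]; rewrite ?rR ?andbF.
    by case: (boolP (u \in E (r u))) => // /((RE _ rR).2) ->.
  move=> x /andP[xR xru]; apply/eqP; rewrite eqb0; apply: contra xru.
  rewrite !inE => /andP[xu _]; case/imsetP: xR => v _ ->{x} in xu *.
  rewrite eq_sym; apply/eqP; apply/(fingraph.rootP csym).
  by rewrite csym; apply: connect_trans xu; apply: connect_root.
pose Z := [set odflt x [pick u in E x] | x in R].
have pkE x : x \in R -> odflt x [pick u in E x] \in E x.
  move=> xR; case: pickP => //= E0; have [] := RE _ xR.
  by rewrite (eq_card0 E0); lia.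
exists Z; split.
- apply: leq_trans (leq_mul (leq_imset_card _ _) (leqnn _)) _; apply: leq_trans sumE.
  by rewrite -sum_nat_const; apply: leq_sum => x /RE[].
- by move=> _ /imsetP[x xR ->]; apply: (RE _ xR).2; apply: pkE.
- apply/setP => v; apply/setIP/setIdP => -[].
    move=> vW vf; split=> //.
    have rR : r v \in R by apply: imset_f; rewrite inE vW.
    apply/exists_inP; exists (odflt (r v) [pick u in E (r v)]); first exact: imset_f.
    have := pkE _ rR; rewrite inE => /andP[]; rewrite inE => + _.
    by apply: connect_trans; apply: connect_root.
  move=> vf /exists_inP[z /imsetP[x xR zE] vz]; split=> //.
  have := pkE _ xR; rewrite -zE inE => /andP[]; rewrite inE => xz _.
  case/imsetP: xR => u; rewrite inE => /andP[uW uf] xE.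
  have uV : u \notin V0 by move: uf; rewrite !inE => /andP[].
  apply: (component_sub uW uV); apply: connect_trans (connect_root _ u) _.
  by rewrite -/(r u) -xE; apply: connect_trans xz _; rewrite csym.
Qed.
End Fat.

(** A maximiser of [f] works: adding [y] to [R] gains [deg (B :\: nbhd R) y] covered sites and loses
    [k]. *)
Lemma greedy (Q B : {set T}) k : exists2 R : {set T}, R \subset Q &
  [/\ #|R| * k <= #|B|, {in R, forall x, exists t, (x + e t)%R \in B} &
      {in Q, forall y, deg (B :\: nbhd R) y <= k}].
Proof.
pose Q' := [set y in Q | [exists t, (y + e t)%R \in B]].
pose f (R : {set T}) := #|B :&: nbhd R| + (#|Q'| - #|R|) * k.
have [R RQ Rmax] := @arg_maxnP _ set0 (fun R : {set T} => R \subset Q') f (sub0set _).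
have cR := subset_leq_card RQ.
exists R; first by apply: subset_trans RQ _; apply/subsetP => x; rewrite inE => /andP[].
split.
- have := Rmax _ (sub0set _); rewrite /f cards0 subn0.
  have := subset_leq_card (subsetIl B (nbhd R)).
  have := leq_mul cR (leqnn k); rewrite mulnBl; lia.
- by move=> x /(subsetP RQ); rewrite inE => /andP[_ /existsP].
- move=> y yQ; have [yQ'|yQ'] := boolP (y \in Q'); last first.
    rewrite /deg (_ : [set _ | _] = set0) ?cards0 //; apply/setP => t; rewrite !inE.
    apply/negbTE; apply: contra yQ' => /andP[_ tB]; rewrite inE yQ.
    by apply/existsP; exists t.
  have [yR|yR] := boolP (y \in R).
    rewrite /deg (_ : [set _ | _] = set0) ?cards0 //; apply/setP => t; rewrite !inE.
    apply/negbTE; rewrite negb_and negbK; apply/orP; left.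
    by apply/existsP; exists (opp t); rewrite addeK.
  have := Rmax (y |: R); rewrite subUset sub1set yQ' RQ => /(_ isT); rewrite /f.
  have -> : #|B :&: nbhd (y |: R)| = #|B :&: nbhd R| + deg (B :\: nbhd R) y.
    rewrite deg_adj -cardsUI (_ : (B :&: nbhd R) :&: _ = set0) ?cards0 ?addn0; last first.
      apply/setP => x; rewrite !inE; by case: (x \in B) => //=; case: [exists t, (x + e t)%R \in R].
    apply: eq_card => x; rewrite !inE; case: (x \in B) => /=; last by rewrite andbF.
    have [/existsP[t tR]|nx] := boolP [exists t, (x + e t)%R \in R].
      by apply/existsP; exists t; rewrite inE tR orbT.
    rewrite /=; apply/existsP/existsP => -[t].
      rewrite !inE => /orP[/eqP xy|tR]; last by case/existsP: nx; exists t.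
      by exists (opp t); rewrite -xy addeK.
    by move=> /eqP ->; exists (opp t); rewrite addeK !inE eqxx.
  have yQR : #|R| < #|Q'|.
    by apply: proper_card; rewrite properE RQ; apply/subsetPn; exists y.
  rewrite cardsU1 yR /=; have -> : #|Q'| - #|R| = (#|Q'| - (1 + #|R|)).+1 by lia.
  rewrite /geq /= mulSn; lia.
Qed.

(** * Refinement of a sandwich *)

Section Refine.
Variables (b : bool) (W : {set T}) (L : nat).
Hypothesis W_bd : forall x t, x \in W -> (x + e t)%R \notin W -> par x = b.
Definition evens : {set T} := [set x | par x == b].
Local Notation A := (W :\: evens).
Local Notation G := (W :&: evens).
Hypothesis W_half : \sum_(x in G) deg (~: A) x = d.*2 * L.

Lemma odd_nbr y t : y \in A -> (y + e t)%R \in G.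
Proof.
rewrite !inE => /andP[yb yW]; rewrite par_e; apply/andP; split.
  by apply: contraT => /(W_bd yW) yb'; rewrite yb' eqxx in yb.
by case: (par y) yb; case: b.
Qed.

Lemma even_nbr x t : x \in evens -> x \notin G -> (x + e t)%R \notin A.
Proof. by move=> _; apply: contra => /(@odd_nbr _ (opp t)); rewrite addeK. Qed.

(** [RA] will consist of odd sites of [W], whose neighbours are all in [W], and [RG] of even sites
    outside [W], whose neighbours are all outside [W]. Neither definition mentions [W], so the
    refinement can be decoded. *)
Definition refine_S (k : nat) (F S RA RG : {set T}) : {set T} :=
  [set y in S :\: nbhd RG | deg (~: (F :|: nbhd RA)) y <= k].
Definition refine_F (k : nat) (F S RA RG : {set T}) : {set T} :=
  F :|: nbhd RA :|: [set x in evens | k < deg (refine_S k F S RA RG) x].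

Definition sandwich (F S : {set T}) := [&& A \subset S, S \subset ~: evens & F \subset G].
(** Together with [sandwich] this is Sapozhenko's notion of a psi-approximation, at level [k]. *)
Definition tight (k : nat) (F S : {set T}) := 
  {in S, forall y, deg (~: F) y <= k} /\ {in evens :\: F, forall x, deg S x <= k}.

Lemma deg_subset A B x : A \subset B -> deg A x <= deg B x.
Proof. by move=> AB; apply/subset_leq_card/subsetP => t; rewrite !inE; apply: (subsetP AB). Qed.

Lemma refine_exists k F S : sandwich F S -> exists RA RG : {set T},
  [/\ #|RA| * k <= #|G :\: F|, #|RG| * k <= #|S :\: A|,
      {in RA, forall x, exists t, (x + e t)%R \in G :\: F} &
      {in RG, forall x, exists t, (x + e t)%R \in S :\: A}] /\
  [/\ sandwich (refine_F k F S RA RG) (refine_S k F S RA RG),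
      tight k (refine_F k F S RA RG) (refine_S k F S RA RG),
      F \subset refine_F k F S RA RG & refine_S k F S RA RG \subset S].
Proof.
case/and3P => AS So FG.
have [RA RAA [cA nA dA]] := greedy A (G :\: F) k.
have [RG RGE [cG nG dG]] := greedy (evens :\: G) (S :\: A) k.
exists RA, RG; split; first by split.
set S2 := refine_S _ _ _ _ _; set F2 := refine_F _ _ _ _ _.
have NAG : nbhd RA \subset G.
  apply/subsetP => x /nbhdP[t /(subsetP RAA) xt].
  by have := odd_nbr (opp t) xt; rewrite addeK.
have S2S : S2 \subset S by apply/subsetP => y; rewrite !inE => /andP[/andP[]].
have FF2 : F \subset F2 by apply/subsetP => x xF; rewrite !inE xF.
split=> //; last first.
  split.
    move=> y; rewrite inE => /andP[_]; apply: leq_trans; apply: deg_subset.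
    by rewrite setCS; apply: subsetUl.
  move=> x; rewrite !inE negb_or -!andbA negb_and -leqNgt => /and3P[_ H xe].
  by rewrite xe /= in H.
apply/and3P; split.
- apply/subsetP => y yA; rewrite inE; apply/andP; split.
    rewrite inE (subsetP AS _ yA) andbT; apply/nbhdP => -[t /(subsetP RGE)].
    rewrite inE => /andP[yG _]; by rewrite (odd_nbr t yA) in yG.
  apply: leq_trans (dA y yA); apply/subset_leq_card/subsetP => t.
  rewrite !inE negb_or => /andP[yF ->].
  by have := odd_nbr t yA; rewrite !inE yF => ->.
- exact: subset_trans So.
- rewrite !subUset FG NAG /=; apply/subsetP => x; rewrite inE => /andP[xe H].
  apply: contraLR H => xG; rewrite -leqNgt.
  have xQ : x \in evens :\: G by rewrite inE xG.
  apply: leq_trans (dG x xQ); apply/subset_leq_card/subsetP => t.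
  rewrite [in X in X -> _]inE => yS; rewrite inE inE.
  move: yS; rewrite inE => /andP[]; rewrite inE => /andP[-> yS _].
  by rewrite inE yS andbT even_nbr.
Qed.

(** Counts the [d.*2 * L] edges from [G] to the complement of [A]: each site of [S :\: A] has at
    least [d.*2 - k] of them coming from [F], and each site of [G :\: F] sends at least as many out
    of [S]. *)
Lemma tight_size k F S : sandwich F S -> tight k F S -> k <= d.*2 ->
  (#|S :\: A| + #|G :\: F|) * (d.*2 - k) <= d.*2 * L.
Proof.
case/and3P => AS So FG [tS tF] kd; rewrite -W_half.
rewrite (big_setID F) /= (setIidPr FG) mulnDl; apply: leq_add.
  apply: (@leq_trans (\sum_(x in F) deg (S :\: A) x)).
    rewrite deg_sym -sum_nat_const; apply: leq_sum => y; rewrite inE => /andP[_ /tS].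
    by have := degC F y; lia.
  by apply: leq_sum => x _; apply: deg_subset; apply/subsetP => y; rewrite !inE => /andP[].
rewrite -sum_nat_const; apply: leq_sum => x; rewrite inE => /andP[xF].
rewrite inE => /andP[xW xe].
have : x \in evens :\: F by rewrite inE xF.
move/tF => H; have := degC S x.
have : deg (~: S) x <= deg (~: A) x by apply: deg_subset; rewrite setCS.
lia.
Qed.

(** An average over directions. The edges from [S] to sites outside [F] number at most [k] for each
    site of [S :\: A]; those from [A] end in [G :\: F], at most [k] at each site. *)
Lemma tight_direction k F S : 0 < d -> sandwich F S -> tight k F S ->
  exists t, #|[set y in S | (y + e t)%R \notin F]| * d.*2 <= k * (#|S :\: A| + #|G :\: F|).
Proof.
move=> d_gt0 /and3P[AS So FG] [tS tF].
have tot : \sum_t #|[set y in S | (y + e t)%R \notin F]| <= k * (#|S :\: A| + #|G :\: F|).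
  have -> : \sum_t #|[set y in S | (y + e t)%R \notin F]| = \sum_(y in S) deg (~: F) y.
    rewrite (eq_bigr (fun t => \sum_(y in S) ((y + e t)%R \notin F))); last first.
      by move=> t _; rewrite -sum1dep_card big_mkcondr; apply: eq_bigr => y _; case: (_ \in _).
    rewrite exchange_big /=; apply: eq_bigr => y _; rewrite /deg -sum1dep_card [RHS]big_mkcond.
    by apply: eq_bigr => t _; rewrite inE; case: (_ \in _).
  rewrite (big_setID A) /= (setIidPr AS) addnC mulnDr; apply: leq_add.
    rewrite mulnC -sum_nat_const; apply: leq_sum => y; rewrite inE => /andP[_]; exact: tS.
  apply: (@leq_trans (\sum_(y in A) deg (G :\: F) y)).
    apply: leq_sum => y yA; apply/subset_leq_card/subsetP => t; rewrite !inE => ->.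
    by have := odd_nbr t yA; rewrite !inE.
  rewrite deg_sym mulnC -sum_nat_const; apply: leq_sum => x; rewrite inE => /andP[xF].
  rewrite inE => /andP[_ xe]; apply: leq_trans (tF x _); last by rewrite inE xF.
  exact: deg_subset.
have /card_gt0P[t1 _] : 0 < #|D| by rewrite cardD; lia.
have [t _ tmin] := @arg_minnP _ t1 predT (fun t => #|[set y in S | (y + e t)%R \notin F]|) isT.
exists t; rewrite -cardD mulnC -sum_nat_const; apply: leq_trans tot.
by apply: leq_sum => s _; apply: tmin.
Qed.
End Refine.

(** * Coding sets of sites by walks *)

Definition disp (s : seq D) : T := (\sum_(t <- s) e t)%R.

Lemma disp_cat (s1 s2 : seq D) : disp (s1 ++ s2) = (disp s1 + disp s2)%R.
Proof. exact: big_cat. Qed.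

Lemma disp_rev (s : seq D) : disp (rev s) = disp s.
Proof. by apply: perm_big; rewrite perm_rev. Qed.

Lemma disp_opp (s : seq D) : disp (map opp s) = (- disp s)%R.
Proof. by rewrite /disp big_map (eq_bigr (fun t => - e t)%R) ?sumrN. Qed.

Definition near (k : nat) (x y : T) : Prop := exists2 s : seq D, size s <= k & y = (x + disp s)%R.

Lemma near_sym (k : nat) x y : near k x y -> near k y x.
Proof.
case=> s sk ->; exists (map opp s); rewrite ?size_map //.
by rewrite disp_opp addrK.
Qed.

Lemma near_trans (k l : nat) x y z : near k x y -> near l y z -> near (k + l) x z.
Proof.
case=> s sk -> [r rl ->]; exists (s ++ r); first by rewrite size_cat leq_add.
by rewrite disp_cat addrA.
Qed.

Lemma near0 x : near 0 x x.
Proof. by exists [::] => //; rewrite /disp big_nil addr0. Qed.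

Lemma near1 x t : near 1 x (x + e t)%R.
Proof. by exists [:: t] => //; rewrite /disp big_seq1. Qed.

Lemma near_le (k l : nat) x y : k <= l -> near k x y -> near l x y.
Proof. by move=> kl [s sk ->]; exists s => //; apply: leq_trans kl. Qed.

Lemma near_nbhd A x : x \in nbhd A -> exists2 u, u \in A & near 1 x u.
Proof. by case/nbhdP => t xt; exists (x + e t)%R => //; apply: near1. Qed.

Section Walk.
Variables (b0 : T) (X : {set T}) (K : nat).
Hypothesis b0X : b0 \in X.
Hypothesis X_conn : forall Y : {set T}, Y \subset X -> b0 \in Y -> Y != X ->
  exists y x, [/\ y \in Y, x \in X :\: Y & near K y x].

Definition visits (r : seq D) x : Prop := exists r1 r2, r = r1 ++ r2 /\ x = (b0 + disp r1)%R.

(** A detour [u] and its way back are inserted after [ra]. Their total displacement is zero, so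
    every site visited before is still visited. *)
Lemma visits_insert (ra rb u : seq D) x : visits (ra ++ rb) x \/ x = (b0 + disp (ra ++ u))%R ->
  visits (ra ++ u ++ rev (map opp u) ++ rb) x.
Proof.
case=> [[r1 [r2 [E ->]]]|->]; last by exists (ra ++ u), (rev (map opp u) ++ rb); rewrite catA.
have [r1a|/ltnW ar1] := leqP (size r1) (size ra).
  exists r1, (drop (size r1) ra ++ u ++ rev (map opp u) ++ rb); split=> //.
  rewrite [RHS]catA; congr (_ ++ _); rewrite -{1}(cat_take_drop (size r1) ra); congr (_ ++ _).
  by have := congr1 (take (size r1)) E; rewrite takel_cat // take_size_cat.
exists (ra ++ u ++ rev (map opp u) ++ drop (size ra) r1), r2; split; last first.
  rewrite !disp_cat disp_rev disp_opp [(disp u + _)%R]addrA subrr add0r -disp_cat.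
  congr (_ + disp _)%R; rewrite -{1}(cat_take_drop (size ra) r1); congr (_ ++ _).
  by have := congr1 (take (size ra)) E; rewrite take_size_cat // takel_cat.
rewrite -!catA; do 3!congr (_ ++ _).
by have := congr1 (drop (size ra)) E; rewrite drop_size_cat // drop_cat; case: ltnP => [_ //|Es];
  have -> : size ra = size r1 by [apply/eqP; rewrite eqn_leq ar1]; rewrite subnn drop0 drop_size.
Qed.

Lemma walk_exists : exists2 r : seq D, size r <= 2 * K * #|X|.-1 & {in X, forall x, visits r x}.
Proof.
have H n : n < #|X| -> exists2 Y : {set T}, [/\ Y \subset X, b0 \in Y & #|Y| = n.+1] &
    exists2 r : seq D, size r <= 2 * K * n & {in Y, forall x, visits r x}.
  elim: n => [|n IH] nX.
    exists [set b0]; first by rewrite sub1set set11 cards1.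
    exists [::] => // x /set1P ->; exists [::], [::]; split=> //.
    by rewrite /disp big_nil addr0.
  have [Y [YX bY cY] [r rn rY]] := IH (ltnW nX).
  have YnX : Y != X by apply: contraTneq nX => <-; rewrite cY ltnn.
  have [y [x [yY]]] := X_conn YX bY YnX; rewrite inE => /andP[xY xX] [u uK xE].
  exists (x |: Y); first by rewrite subUset sub1set xX YX inE bY orbT cardsU1 xY cY.
  have [ra [rb [rE yE]]] := rY y yY.
  exists (ra ++ u ++ rev (map opp u) ++ rb).
    by rewrite !size_cat size_rev size_map; have := congr1 size rE; rewrite size_cat; lia.
  move=> z /setU1P[->|zY]; apply: visits_insert; last by left; rewrite -rE; apply: rY.
  by right; rewrite xE yE disp_cat addrA.
have X_gt0 : 0 < #|X| by apply/card_gt0P; exists b0.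
have [|Y [YX _ cY] [r rn rY]] := H #|X|.-1; first by rewrite prednK.
exists r => // x xX; apply: rY; suff -> : Y = X by [].
by apply/eqP; rewrite eqEcard YX cY prednK // leqnn.
Qed.
End Walk.

(** A walk of length [n] and, for each of the [k] sets, the times at which the walk is in it; there
    are [n.+1] times. *)
Definition code (k n : nat) := (n.-tuple D * {ffun 'I_k -> {set 'I_n.+1}})%type.

Definition decode_set (k n : nat) (b0 : T) (c : code k n) (i : 'I_k) : {set T} :=
  [set (b0 + disp (take (nat_of_ord i) c.1))%R | i : 'I_n.+1 in c.2 i].

Lemma card_code k n : #|{: code k n}| = d.*2 ^ n * 2 ^ (n.+1 * k).
Proof.
by rewrite card_prod card_tuple cardD card_ffun card_ord -cardsT -powersetT card_powerset cardsT card_ord expnM.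
Qed.

Lemma encode k n K b0 (Xs : 'I_k -> {set T}) :
  let X := b0 |: \bigcup_i Xs i in
  0 < d -> 2 * K * (\sum_i #|Xs i|) <= n ->
  (forall Y : {set T}, Y \subset X -> b0 \in Y -> Y != X ->
    exists y x, [/\ y \in Y, x \in X :\: Y & near K y x]) ->
  exists c : code k n, forall i, decode_set b0 c i = Xs i.
Proof.
move=> X d_gt0 Kn X_conn; have [r rn rX] := walk_exists (setU11 _ _) X_conn.
have cX : #|X|.-1 <= \sum_i #|Xs i|.
  rewrite -/X; apply: leq_trans (card_bigcup_leq _ _).
  by rewrite /X cardsU1; case: (_ \notin _) => //=; apply: leq_pred.
have {}rn : size r <= n by apply: leq_trans rn _; apply: leq_trans (leq_mul (leqnn _) cX) _.
have /card_gt0P[t1 _] : 0 < #|D| by rewrite cardD; lia.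
have sr : size (r ++ nseq (n - size r) t1) == n by rewrite size_cat size_nseq subnKC.
pose w : n.-tuple D := Tuple sr.
exists (w, [ffun i => [set j : 'I_n.+1 | (b0 + disp (take j w))%R \in Xs i]]) => i.
apply/setP => x; apply/imsetP/idP => [[j /=]|xX].
  by rewrite ffunE inE => jX ->.
have [|r1 [r2 [rE xE]]] := rX x; first by rewrite inE; apply/orP; right; apply/bigcupP; exists i.
have r1n : size r1 < n.+1 by rewrite ltnS; apply: leq_trans rn; rewrite rE size_cat leq_addr.
have tw : take (size r1) w = r1 by rewrite /= rE -catA take_size_cat.
exists (Ordinal r1n) => /=; first by rewrite ffunE inE tw -xE.
by rewrite tw.
Qed.

(** On each 4-cycle, all the cut edges among its four edges get the same value; uncut edges are
    unconstrained. *)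
Definition square_cut (W : {set T}) (cl : T -> D -> bool) := forall x t t', exists c : bool,
  [/\ cut W x t -> cl x t = c, cut W (x + e t)%R t' -> cl (x + e t)%R t' = c,
      cut W x t' -> cl x t' = c & cut W (x + e t')%R t -> cl (x + e t')%R t = c].

(* A class of cut edges closed under sharing a 4-cycle is empty or everything. *)
Definition cut_conn (W : {set T}) := forall cl : T -> D -> bool,
  (forall x t, cl (x + e t)%R (opp t) = cl x t) -> square_cut W cl ->
  (forall x t, cut W x t -> cl x t = false) \/ (forall x t, cut W x t -> cl x t).

(** * Connectivity of the data sets *)

Section Connected.
Variables (W U X : {set T}).
Hypothesis W_cut : cut_conn W.
Hypothesis U_sep : forall x t, cut W x t -> (x \in nbhd U) || ((x + e t)%R \in nbhd U).
Hypothesis U_cut : forall u, u \in U -> exists x, (0 < cutdeg W x) && ((x == u) || adj u x).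
Hypothesis UX : U \subset X.
Hypothesis X_U : {in X, forall x, exists2 u, u \in U & near 3 x u}.

Lemma cut_edge_end x t : cut W x t ->
  exists w s, (w = x \/ w = (x + e t)%R) /\ (w + e s)%R \in U.
Proof.
move/U_sep => /orP[] /nbhdP[s sU]; [exists x, s|exists (x + e t)%R, s]; tauto.
Qed.

Lemma near_edge x t w w' : w = x \/ w = (x + e t)%R -> w' = x \/ w' = (x + e t)%R -> near 1 w w'.
Proof.
have n0 := near_le (leq0n 1) (near0 _).
case=> -> [] ->; try exact: n0; first exact: near1.
exact/near_sym/near1.
Qed.

Lemma square_near x t t' (w w' : T) :
  w \in [:: x; (x + e t)%R; (x + e t')%R; (x + e t + e t')%R] ->
  w' \in [:: x; (x + e t)%R; (x + e t')%R; (x + e t + e t')%R] -> near 2 w w'.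
Proof.
have n2 (r : seq D) y : size r <= 2 -> near 2 y (y + disp r)%R by exists r.
have d2 (t1 t2 : D) : disp [:: t1; t2] = (e t1 + e t2)%R by rewrite /disp !big_cons big_nil addr0.
have d1 (t1 : D) : disp [:: t1] = e t1 by rewrite /disp big_cons big_nil addr0.
have H0 y : near 2 y y by exists [::]; rewrite // /disp big_nil addr0.
have Ha y t1 : near 2 y (y + e t1)%R by rewrite -d1; apply: n2.
have Hb y t1 t2 : near 2 y (y + e t1 + e t2)%R by rewrite -addrA -d2; apply: n2.
have Hc : near 2 (x + e t)%R (x + e t')%R.
  have -> : (x + e t' = x + e t + (e (opp t) + e t'))%R by rewrite addrA addeK.
  by rewrite -d2; apply: n2.
have Hd : near 2 (x + e t')%R (x + e t + e t')%R by rewrite addrAC.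
rewrite !inE => /or4P[] /eqP -> /or4P[] /eqP ->; try by [apply: H0|apply: Ha|apply: Hb|exact: Hc|exact: Hd];
  apply: near_sym; by [apply: H0|apply: Ha|apply: Hb|exact: Hc|exact: Hd].
Qed.

Definition nearb (k : nat) (x y : T) := [exists i : 'I_k.+1, exists r : (nat_of_ord i).-tuple D, y == (x + disp r)%R].

Lemma nearP k x y : reflect (near k x y) (nearb k x y).
Proof.
apply: (iffP existsP) => [[i /existsP[r /eqP ->]]|[r rk ->]].
  by exists r; rewrite // size_tuple -ltnS.
by exists (Ordinal (rk : size r < k.+1)); apply/existsP; exists (in_tuple r).
Qed.

(** Suppose no jump of length 4 leaves [Y]. Consider the cut edges with an end adjacent to
    [U :&: Y]. If two cut edges share a 4-cycle, sites of [U] adjacent to their ends are within 1 +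
    2 + 1 = 4 of each other, so this class is closed under 4-cycles, and by [W_cut] it is empty or
    everything. But it contains a cut edge near a site of [U] in [Y] and misses one near a site of
    [U] outside [Y]. *)
Lemma X_connected b0 (Y : {set T}) : b0 \in X -> Y \subset X -> b0 \in Y -> Y != X ->
  exists y x, [/\ y \in Y, x \in X :\: Y & near 4 y x].
Proof.
move=> b0X YX bY YnX.
have [/exists_inP[y yY /exists_inP[x xX /nearP yx]]|H] :=
  boolP [exists y in Y, [exists x in X :\: Y, nearb 4 y x]]; first by exists y, x.
have far u v : u \in Y -> v \in U -> near 4 u v -> v \in Y.
  move=> uY vU uv; apply: contraNT H => vY; apply/exists_inP; exists u => //.
  by apply/exists_inP; exists v; [rewrite inE vY (subsetP UX)|apply/nearP].
pose U1 := U :&: Y.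
pose cl x t := (x \in nbhd U1) || ((x + e t)%R \in nbhd U1).
have clP x t : cl x t -> exists w s, (w = x \/ w = (x + e t)%R) /\ (w + e s)%R \in U1.
  case/orP=> /nbhdP[s sU]; [exists x, s|exists (x + e t)%R, s]; tauto.
have clI x t w s : (w = x \/ w = (x + e t)%R) -> (w + e s)%R \in U1 -> cl x t.
  by case=> -> wU; apply/orP; [left|right]; apply/nbhdP; exists s.
have key x1 t1 x2 t2 (q : seq T) : (forall u v, u \in q -> v \in q -> near 2 u v) ->
    {subset [:: x1; (x1 + e t1)%R; x2; (x2 + e t2)%R] <= q} -> cut W x1 t1 -> cl x2 t2 -> cl x1 t1.
  move=> qn sub /cut_edge_end[w [s [wE wU]]] /clP[w' [s' [wE' wU']]].
  apply: (clI _ _ w s wE); rewrite inE wU /=; move: wU'; rewrite inE => /andP[_ wY'].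
  apply: (far _ _ wY' wU).
  have n2 : near 2 w' w.
    apply: qn; apply: sub; rewrite !inE; first by case: wE' => ->; rewrite eqxx ?orbT.
    by case: wE => ->; rewrite eqxx ?orbT.
  exact: (near_trans (near_trans (near_sym (near1 w' s')) n2) (near1 w s)).
have clsym x t : cl (x + e t)%R (opp t) = cl x t by rewrite /cl addeK orbC.
have clsq : square_cut W cl.
  move=> x t t'; pose q := [:: x; (x + e t)%R; (x + e t')%R; (x + e t + e t')%R].
  have qn u v : u \in q -> v \in q -> near 2 u v by apply: square_near.
  have E : (x + e t' + e t = x + e t + e t')%R by rewrite addrAC.
  exists [|| cut W x t && cl x t, cut W (x + e t)%R t' && cl (x + e t)%R t',
             cut W x t' && cl x t' | cut W (x + e t')%R t && cl (x + e t')%R t].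
  split=> c; apply/idP/idP => [->|/or4P[] /andP[c' cl']]; rewrite ?c ?orbT //;
    apply: key qn _ c cl' => z; rewrite !inE ?E => /or4P[] ->; rewrite ?orbT //.
have near_cut u : u \in U -> exists x t w s, [/\ cut W x t, (w = x \/ w = (x + e t)%R),
    (w + e s)%R \in U & near 3 u (w + e s)%R].
  move=> uU; have [x /andP[/card_gt0P[t]]] := U_cut uU; rewrite inE => xt ux.
  have n1 : near 1 u x.
    case/orP: ux => [/eqP ->|/existsP[r /eqP ->]]; last exact: near1.
    exact: near_le (near0 _).
  have [w [s [wE wU]]] := cut_edge_end xt; exists x, t, w, s; split=> //.
  have n2 : near 1 x w by apply: near_edge wE; left.
  exact: (near_trans (near_trans n1 n2) (near1 w s)).
have [/existsP[u1 u1U]|noU1] := boolP [exists u, u \in U1]; last first.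
  have [u uU bu] := X_U b0X; case/negP: noU1; apply/existsP; exists u; rewrite inE uU.
  by apply: far bY uU _; apply: near_le bu.
have [x xX xY] : exists2 x, x \in X & x \notin Y.
  by apply/subsetPn; apply: contraNN YnX => XY; rewrite eqEsubset YX.
have [u2 u2U xu2] := X_U xX.
have u2Y : u2 \notin Y.
  apply: contraNN H => uY; apply/exists_inP; exists u2 => //.
  apply/exists_inP; exists x; first by rewrite inE xY.
  by apply/nearP; apply: near_le (near_sym xu2).
have u1Y : u1 \in Y by move: u1U; rewrite inE => /andP[].
have u1UU : u1 \in U by move: u1U; rewrite inE => /andP[].
have [x1 [t1 [w1 [s1 [c1 w1E w1U n1]]]]] := near_cut _ u1UU.
have [x2 [t2 [w2 [s2 [c2 w2E w2U n2]]]]] := near_cut _ u2U.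
have cl1 : cl x1 t1.
  apply: (clI _ _ w1 s1 w1E); rewrite inE w1U.
  by apply: far u1Y w1U _; apply: near_le n1.
have cl2 : ~ cl x2 t2.
  case/clP => w3 [s3 [w3E]]; rewrite inE => /andP[w3U w3Y].
  have w2Y : (w2 + e s2)%R \in Y.
    apply: far w3Y w2U _; apply: (@near_le 3) => //; have n3 := near_edge w3E w2E.
    exact: (near_trans (near_trans (near_sym (near1 w3 s3)) n3) (near1 w2 s2)).
  by case/negP: u2Y; apply: far w2Y u2U _; apply: near_le (near_sym n2).
case: (W_cut clsym clsq) => Hcl; first by rewrite Hcl in cl1.
by case: cl2; apply: Hcl.
Qed.
End Connected.

Lemma notfat_nbr (V0 : {set T}) x : 0 < d -> x \notin fat V0 -> x \in V0 \/ x \in nbhd V0.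
Proof.
move=> d_gt0; rewrite !inE negb_and negbK => /orP[->|xd]; [by left|right].
have : 0 < deg V0 x by have := degC V0 x; lia.
by case/card_gt0P => s; rewrite inE => sV; apply/existsP; exists s.
Qed.

(** The sets are, in this order: the separating set, representatives of the fat components, the
    pairs [RA], [RG] of the levels [d] and [psi], and the corrections of [F2] and [S2] along [t].
    Nothing else about [W] is used. *)
Definition decode_FS (b : bool) (psi : nat) (Xs : 'I_8 -> {set T}) (t : D) : {set T} * {set T} :=
  let X k := Xs (inord k) in
  let V0 := nbhd (X 0) in
  let F0 := reached V0 (X 1) :&: evens b in
  let S0 := (reached V0 (X 1) :|: ~: fat V0) :\: evens b in
  let F1 := refine_F b d F0 S0 (X 2) (X 3) in
  let S1 := refine_S d F0 S0 (X 2) (X 3) in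
  let F2 := refine_F b psi F1 S1 (X 4) (X 5) in
  let S2 := refine_S psi F1 S1 (X 4) (X 5) in
  (F2 :|: X 6, [set y in S2 | (y + e t)%R \in F2] :|: X 7).

(** * Approximation by few sites of data *)

Section Approximation.
Variables (b : bool) (W wall : {set T}) (L psi l : nat) (t0 : D) (b0 : T).
Hypothesis W_bd : forall x t, x \in W -> (x + e t)%R \notin W -> par x = b.
Hypothesis W_nbr : forall x, exists t, ((x + e t)%R \in W) = (x \in W).
Hypothesis W_wall : [disjoint W & wall].
Hypothesis exits : forall (C : {set T}) z, [disjoint C & wall] -> z \in C ->
  deg C z <= #|[set x in C | (x + e t0)%R \notin C]| + 2.
Local Notation A := (W :\: evens b).
Local Notation G := (W :&: evens b).
Hypothesis W_half : \sum_(x in G) deg (~: A) x = d.*2 * L.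
Hypothesis W_cut : cut_conn W.
Hypothesis b0_cut : 0 < cutdeg W b0.
Hypothesis d_ge4 : 4 <= d.
Hypothesis psi_gt0 : 0 < psi.
Hypothesis psi_led : psi <= d.
Hypothesis psi_sq : psi * psi <= d * l.
Hypothesis l_gt0 : 0 < l.
Hypothesis l_large : d.*2 <= 2 ^ l.+1.

(** Each cut edge is counted at both ends, and the ends inside [W] account for [d.*2 * L]. *)
Lemma cutdeg_total : \sum_x cutdeg W x = 4 * (d * L).
Proof.
have half : \sum_(x in W) cutdeg W x = d.*2 * L.
  rewrite -W_half (big_setID (evens b)) /= [X in _ + X]big1 ?addn0.
    apply: eq_bigr => x; rewrite !inE => /andP[xW xe]; apply: eq_card => t.
    rewrite !inE par_e (eqP xe) /cut xW; case: (_ \in W); rewrite ?andbF ?andbT //.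
    by case: b.
  move=> x; rewrite !inE => /andP[xb xW]; apply/eqP; rewrite cards_eq0; apply/eqP/setP => t.
  rewrite !inE /cut xW; apply: contraNF xb => yW; apply/eqP.
  by apply: (W_bd (t := t) xW); case: (_ \in W) yW.
rewrite (bigID (mem W)) /= half.
have -> : \sum_(x | x \notin W) cutdeg W x = \sum_(x in W) cutdeg W x; last by rewrite half; lia.
have -> : \sum_(x | x \notin W) cutdeg W x = \sum_(x in ~: W) cutdeg W x.
  by apply: eq_bigl => x; rewrite inE.
rewrite /cutdeg !sum_in edges_count; apply: eq_bigr => x _; apply: eq_card => t.
rewrite !inE /cut addeK; case: (x \in W); case: (_ \in W) => //.
Qed.

(** Two levels are needed. At level [d] the ambiguous part of size O([d * #|U|]) is handled with
    O([#|U|]) sites and shrinks to [2 * L]; only then is level [psi] affordable, with [2 * L / psi]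
    sites. Level [psi] in turn leaves few exceptions to the inclusion of [S + e t] in [F] for the
    best direction [t], and these are listed one by one. *)
Lemma approximation : exists (Xs : 'I_8 -> {set T}) (t : D),
  [/\ sandwich b W (decode_FS b psi Xs t).1 (decode_FS b psi Xs t).2,
      {in (decode_FS b psi Xs t).2, forall y, (y + e t)%R \in (decode_FS b psi Xs t).1},
      (\sum_i #|Xs i|) * psi <= 822 * l * L &
      let X := b0 |: \bigcup_i Xs i in
      forall Y : {set T}, Y \subset X -> b0 \in Y -> Y != X ->
        exists y x, [/\ y \in Y, x \in X :\: Y & near 4 y x]].
Proof.
have d_gt0 : 0 < d by lia.
have [U [cU sepU cutU]] := separating_set W_bd W_nbr cutdeg_total psi_gt0 psi_led psi_sq l_large.
pose V0 := nbhd U.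
have V0_sep x t : x \notin V0 -> (x + e t)%R \notin V0 -> (x \in W) = ((x + e t)%R \in W).
  move=> xV yV; apply/eqP; apply: contraT => /sepU.
  by rewrite (negbTE xV) (negbTE yV).
have d_gt2 : 2 < d by lia.
have [Z [cZ ZV WZ]] := fat_components d_gt2 V0_sep W_wall exits.
pose F0 := reached V0 Z :&: evens b.
pose S0 := (reached V0 Z :|: ~: fat V0) :\: evens b.
have sw0 : sandwich b W F0 S0.
  apply/and3P; split.
  - apply/subsetP => x; rewrite /S0 -WZ !in_setD in_setU in_setI in_setC => /andP[-> ->] /=.
    by case: (x \in fat V0).
  - by apply/subsetP => x; rewrite !inE => /andP[].
  - by rewrite /F0 -WZ; apply: setSI; apply: subsetIl.
have [RA1 [RG1 [[cRA1 cRG1 nRA1 nRG1] [sw1 ti1 FF1 SS1]]]] := refine_exists W_bd d sw0.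
set F1 := refine_F _ _ _ _ _ _ in sw1 ti1 FF1; set S1 := refine_S _ _ _ _ _ in sw1 ti1 SS1.
have [RA2 [RG2 [[cRA2 cRG2 nRA2 nRG2] [sw2 ti2 FF2 SS2]]]] := refine_exists W_bd psi sw1.
set F2 := refine_F _ _ _ _ _ _ in sw2 ti2 FF2; set S2 := refine_S _ _ _ _ _ in sw2 ti2 SS2.
have [t ht] := tight_direction W_bd W_half d_gt0 sw2 ti2.
(* Sites of [S2] whose translate misses [F2] are dropped, except those in [W]: these form [Q], and
   [P] contains their translates. *)
pose P := [set x in G :\: F2 | [exists y in S2, x == (y + e t)%R]].
pose Q := [set y in A | (y + e t)%R \notin F2].
pose Xl := [:: U; Z; RA1; RG1; RA2; RG2; P; Q].
exists (fun i => nth set0 Xl i), t.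
have -> : decode_FS b psi (fun i => nth set0 Xl (nat_of_ord i)) t =
    (F2 :|: P, [set y in S2 | (y + e t)%R \in F2] :|: Q).
  by rewrite /decode_FS !inordK.
have [AS2 So2 FG2] := and3P sw2.
have size1 : #|S1 :\: A| + #|G :\: F1| <= 2 * L.
  have := tight_size W_half sw1 ti1; rewrite -addnn leq_addr addnK => /(_ isT).
  by rewrite (_ : (d + d) * L = 2 * L * d) ?leq_pmul2r // addnn -mul2n mulnAC.
have size2 : #|S2 :\: A| + #|G :\: F2| <= 2 * L.
  apply: leq_trans size1; apply: leq_add; apply/subset_leq_card; first exact: setSD.
  exact: setDS.
have cV0 : #|V0| <= d.*2 * #|U| by apply: card_nbhd.
have cF : #|~: fat V0| <= 6 * #|U| * d.
  apply: leq_trans (card_notfat V0 d_gt2 W_wall) _.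
  apply: leq_trans (leq_mul (leqnn 3) cV0) _.
  by rewrite -mul2n !mulnA mulnAC.
have GF0 : G :\: F0 \subset ~: fat V0.
  apply/subsetP => x; rewrite /F0 -WZ !in_setD !in_setI in_setC.
  by case: (x \in W); case: (x \in evens b); case: (x \in fat V0).
have SA0 : S0 :\: A \subset ~: fat V0.
  apply/subsetP => x; rewrite /S0 -WZ !in_setD in_setU !in_setI in_setC.
  by case: (x \in W); case: (x \in evens b); case: (x \in fat V0).
have cZ4 : #|Z| <= 4 * #|U| := arith_components d_ge4 cZ cV0.
have cRA : #|RA1| <= 6 * #|U|.
  by rewrite -(leq_pmul2r d_gt0); apply: leq_trans cF; apply: leq_trans cRA1 (subset_leq_card GF0).
have cRG : #|RG1| <= 6 * #|U|.
  by rewrite -(leq_pmul2r d_gt0); apply: leq_trans cF; apply: leq_trans cRG1 (subset_leq_card SA0).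
pose N4 := #|[set y in S2 | (y + e t)%R \notin F2]|.
have cN4 : N4 * psi <= l * L := arith_direction d_gt0 ht size2 psi_sq.
have cP : #|P| <= N4.
  apply: leq_trans (leq_imset_card (fun y => (y + e t)%R) _); apply/subset_leq_card/subsetP => x.
  rewrite inE => /andP[]; rewrite inE => /andP[xF _] /exists_inP[y yS /eqP xE].
  by apply/imsetP; exists y => //; rewrite inE yS -xE.
have cQ : #|Q| <= N4.
  apply/subset_leq_card/subsetP => y; rewrite [y \in Q]inE => /andP[yA yF].
  by rewrite inE (subsetP AS2).
split.
- apply/and3P; split => /=.
  + apply/subsetP => y yA; rewrite inE; apply/orP.
    have [yF|yF] := boolP ((y + e t)%R \in F2); [left|right].
      by rewrite inE yF (subsetP AS2).
    by rewrite inE yA.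
  + rewrite subUset; apply/andP; split; first by apply/subsetP => y; rewrite inE => /andP[/(subsetP So2)].
    by apply/subsetP => y; rewrite inE => /andP[yA _]; apply: (subsetP So2); apply: (subsetP AS2).
  + rewrite subUset FG2; apply/subsetP => x; rewrite inE => /andP[]; rewrite inE => /andP[].
    by [].
- move=> y /=; rewrite in_setU => /orP[|]; rewrite in_set; first by case/andP=> _ yF; rewrite in_setU yF.
  case/andP=> yA yF; rewrite in_setU; apply/orP; right; rewrite in_set in_setD yF (odd_nbr W_bd) //=.
  by apply/exists_inP; exists y => //; apply: (subsetP AS2).
- rewrite !big_ord_recl big_ord0 /= /Xl /=; apply: (arith_total (n := N4)) => //.
  by apply: leq_trans (leq_add cRA2 cRG2) _; rewrite addnC.
move=> X Y YX bY YnX; apply: (X_connected W_cut sepU cutU) => //.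
- by apply/subsetP => u uU; rewrite inE; apply/orP; right; apply/bigcupP; exists ord0.
- have nV0 x : x \in V0 -> exists2 u, u \in U & near 1 x u by apply: near_nbhd.
  have nfat x : x \in ~: fat V0 -> exists2 u, u \in U & near 2 x u.
    rewrite in_setC => /(notfat_nbr d_gt0)[/nV0[u uU n]|/nbhdP[s /nV0[u uU n]]]; exists u => //.
      exact: near_le n.
    exact: near_trans (near1 x s) n.
  have step x s : (x + e s)%R \in ~: fat V0 -> exists2 u, u \in U & near 3 x u.
    by case/nfat => u uU n; exists u => //; apply: near_trans (near1 x s) n.
  have GF1 : G :\: F1 \subset ~: fat V0 by apply: subset_trans GF0; apply: setDS.
  have SA1 : S1 :\: A \subset ~: fat V0 by apply: subset_trans SA0; apply: setSD.
  have GF2 : G :\: F2 \subset ~: fat V0 by apply: subset_trans GF1; apply: setDS.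
  move=> x; rewrite inE => /orP[/set1P ->|/bigcupP[i _]].
    case/card_gt0P: b0_cut => s; rewrite inE => /sepU/orP[/nV0[u uU n]|/nV0[u uU n]]; exists u => //.
      exact: near_le n.
    by apply: near_le (near_trans (near1 b0 s) n).
  case: i => -[|[|[|[|[|[|[|[|//]]]]]]]] /= _.
  + by move=> xU; exists x => //; apply: near_le (near0 x).
  + move=> /ZV /nV0[u uU n]; exists u => //.
    by apply: near_le (near_trans (near1 x t0) n).
  + by case/nRA1 => s /(subsetP GF0) /step.
  + by case/nRG1 => s /(subsetP SA0) /step.
  + by case/nRA2 => s /(subsetP GF1) /step.
  + by case/nRG2 => s /(subsetP SA1) /step.
  + rewrite inE => /andP[/(subsetP GF2) /nfat[u uU n] _]; exists u => //.
    exact: near_le n.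
  + rewrite inE => /andP[xA xF]; apply: (step x t); apply: (subsetP GF2).
    by rewrite inE xF (odd_nbr W_bd).
- exact: setU11.
exact: bY.
Qed.
End Approximation.
End Graph.

(** * Contours on the torus: excess, exits and codes *)

Section TorusContour.
Variables (d p : nat).
Hypothesis p_even : ~~ odd p.
Hypothesis p_gt1 : 1 < p.
Local Notation Zn := 'I_p.+2.
Local Notation T := ('rV[Zn]_d).
Local Notation D := ('I_d * bool)%type.
Local Notation e := (@stp d p).
Local Notation wall := (wall d p).
Local Notation par := (@par d p).
Local Notation opp := (@opp d).
Local Notation evens b := (evens par b).
Local Notation conn A := (connect (@steps T _ e A)).
Variables (i0 i1 : 'I_d).
Hypothesis i01 : i1 != i0.

Let eN := @stpN d p.
Let oK := @oppK d.
Let e_inj := @stp_inj d p p_even p_gt1.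
Let par_e := @par_stp d p p_even.

Lemma card_dir : #|{: D}| = d.*2.
Proof. by rewrite card_prod card_ord card_bool muln2. Qed.

(** The neighbours of [z] in directions other than [i0] lie on distinct lines parallel to [i0]; the
    two along [i0] are given up. *)
Lemma exits_deg (C : {set T}) z : [disjoint C & wall] -> z \in C ->
  deg e C z <= #|[set x in C | (x + e (i0, true))%R \notin C]| + 2.
Proof.
move=> Cw zC.
pose Z := [set (z + e t)%R | t in [set t : D | ((z + e t)%R \in C) && (t.1 != i0)]].
have cZ : deg e C z <= #|Z| + 2.
  rewrite card_imset; last by move=> s t /addrI /e_inj.
  have <- : #|[set (i0, true); (i0, false)]| = 2 by rewrite cards2 xpair_eqE eqxx.
  apply: leq_trans (leq_card_setU _ _).1; apply/subset_leq_card/subsetP => -[i c].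
  rewrite !inE => -> /=; case: eqP => //= ->; case: c; rewrite eqxx ?orbT //.
apply: leq_trans cZ _; rewrite leq_add2r; apply: exit_card => //.
  by apply/subsetP => _ /imsetP[t + ->]; rewrite inE => /andP[].
move=> _ _ /imsetP[[i c] + ->] /imsetP[[j c'] + ->]; rewrite !inE /= => /andP[_ ii0] /andP[_ ji0].
move/forallP/(_ i); rewrite ii0 !mxE !stpE /= eqxx /= => /eqP /addrI.
case: (eqVneq i j) => [->|ij]; last by case: c => /eqP; rewrite ?oppr_eq0 oner_eq0.
case: c; case: c' => //= /eqP; rewrite ?(negbTE (Zn_1N1 p_even p_gt1)) // eq_sym (negbTE (Zn_1N1 p_even p_gt1)) //.
Qed.

Section OneContour.
Variables (b : bool) (v0 : T) (W : {set T}).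
Hypothesis cW : contour b v0 W.
Local Notation A := (W :\: evens b).
Local Notation G := (W :&: evens b).

(** For a contour this is the number of boundary edges in any one direction, by [card_exit]. *)
Definition excess (b : bool) (W : {set T}) : nat := #|W :&: evens b| - #|W :\: evens b|.

Let W_bd := contour_bd cW.
Let W_wall := contour_wall cW.
Let v0W := contour_start cW.

Lemma contour_start_nbr t : (v0 + e t)%R \in W.
Proof. by apply: contraT => /(W_bd v0W); rewrite (contour_par cW); case: b. Qed.

Lemma contour_nbr x : exists t, ((x + e t)%R \in W) = (x \in W).
Proof.
have [xW|xW] := boolP (x \in W).
  have [->|xv] := eqVneq x v0; first by exists (i0, true); rewrite contour_start_nbr.
  have := contour_conn cW xW; rewrite (conn_sym eN) => /conn_next/(_ xv)[t /andP[_ tW]].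
  by exists t.
have [w ww xw] : exists2 w, w \in wall & conn (~: W) x w by apply: (contour_out cW); rewrite inE.
have [xE|xw0] := eqVneq x w; last first.
  by have [t /andP[_]] := conn_next xw xw0; rewrite inE => /negbTE tW; exists t.
move: ww; rewrite -xE inE => /existsP[i xi].
have [j ji] : exists j, j != i.
  by have [E|E] := eqVneq i i0; [exists i1; rewrite E|exists i0; rewrite eq_sym].
exists (j, true); apply: (disjointFl W_wall); apply: (@wall_coord _ _ _ i).
have ij : i != j by [rewrite eq_sym]; by rewrite mxE stpE ifN // addr0.
Qed.

Lemma contour_odd_nbr y t : y \in A -> (y + e t)%R \in G.
Proof. exact: (odd_nbr par_e W_bd). Qed.

Lemma deg_odd y : y \in A -> deg e G y = d.*2.
Proof.
move=> yA; rewrite -card_dir /deg -[RHS]cardsT; apply: eq_card => t.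
by rewrite in_set contour_odd_nbr // in_setT.
Qed.

Lemma excess_half : \sum_(x in G) deg e (~: A) x = d.*2 * excess b W.
Proof.
have H : \sum_(x in G) deg e A x + \sum_(x in G) deg e (~: A) x = d.*2 * #|G|.
  rewrite -big_split /= mulnC -sum_nat_const; apply: eq_bigr => x _.
  exact: (degC _ card_dir).
have H2 : \sum_(x in G) deg e A x = d.*2 * #|A|.
  by rewrite (deg_sym eN oK) mulnC -sum_nat_const; apply: eq_bigr => y; apply: deg_odd.
rewrite /excess mulnBr -H -H2; lia.
Qed.

(** Exits are even, and an even site of [W] is an exit unless it is a translate by [e (opp t)] of an
    odd site of [W]; all these translates are even sites of [W]. *)
Lemma card_exit t : #|[set x in W | (x + e t)%R \notin W]| = excess b W.
Proof.
have -> : [set x in W | (x + e t)%R \notin W] = G :\: [set (y + e (opp t))%R | y in A].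
  apply/setP => x; rewrite in_setD in_set; have [xW|xW] := boolP (x \in W); last by rewrite in_setI (negbTE xW) andbF.
  apply/idP/andP => [yW|[xA]].
    split; last by rewrite in_setI xW inE (W_bd xW yW) eqxx.
    apply/imsetP => -[y]; rewrite inE => /andP[_ yW'] E; case/negP: yW.
    by rewrite E -{2}(oK t) (addeK eN) // .
  rewrite in_setI inE => /andP[_ xe]; apply: contra xA => yW.
  apply/imsetP; exists (x + e t)%R; last by rewrite (addeK eN).
  by rewrite !inE yW (par_e) (eqP xe); case: b.
rewrite cardsD (_ : G :&: _ = [set (y + e (opp t))%R | y in A]); last first.
  by apply/setIidPr/subsetP => _ /imsetP[y yA ->]; apply: contour_odd_nbr.
by rewrite card_imset //; apply: addIr.
Qed.

Lemma excess_ge : d.*2 <= excess b W + 2.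
Proof.
have -> : d.*2 = deg e W v0.
  by rewrite -card_dir -cardsT; apply: eq_card => t; rewrite !in_set contour_start_nbr.
by rewrite -(card_exit (i0, true)); apply: exits_deg.
Qed.

Lemma contour_cut_conn : cut_conn e opp W.
Proof.
move=> cl cls clq.
have Wconn := contour_conn cW; have Wout := contour_out cW.
pose om x t := cut e W x t && cl x t.
have [|||om0|om1] := @cut_connected d p i0 i1 W v0 om i01 W_wall Wconn Wout.
- by move=> x t; rewrite /om cls (cutC eN).
- move=> x t t'; have [c [c1 c2 c3 c4]] := clq x t t'.
  have E (s : bool) (q : bool) : (s -> q = c) -> s && q = s && c by case: s => // ->.
  rewrite /om (E _ _ c1) (E _ _ c2) (E _ _ c3) (E _ _ c4) /cut addrAC.
  by case: c {c1 c2 c3 c4 E}; rewrite ?andbF ?andbT //;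
     do 4?case: (_ \in W).
- by move=> x t /andP[].
- by left=> x t xt; have := om0 x t; rewrite /om xt.
- by right=> x t xt; have := om1 x t xt; rewrite /om xt.
Qed.

(** Provides a start on the contour for the coding walk. The sites of the ray from [v0] up to its
    first exit lie on distinct lines parallel to [i1], and each of these lines leaves [W]. So the
    start costs only a factor equal to the excess. *)
Lemma ray_exit : exists j : 'I_(excess b W), let b0 := (v0 + e (i0, true) *+ j)%R in
  0 < cutdeg e W b0.
Proof.
pose y k := (v0 + e (i0, true) *+ k)%R.
have yS k : y k.+1 = (y k + e (i0, true))%R by rewrite /y mulrSr addrA.
have ex : exists k, y k \notin W.
  by have [k kw] := line_wall v0 i0 true; exists k; rewrite (disjointFl W_wall kw).
case: (ex_minnP ex) => -[|j]; first by rewrite /y mulr0n addr0 v0W.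
move=> yj jmin.
have yW k : k <= j -> y k \in W by move=> kj; apply: contraT => /jmin; rewrite ltnNge kj.
pose Z := [set y (nat_of_ord k) | k : 'I_j.+1].
have yinj k k' : k < k' -> k' <= j -> y k 0%R i0 = y k' 0%R i0 -> False.
  move=> kk' k'j E; case/negP: yj.
  have Ey : y k = y k'.
    apply/rowP => i; have [->//|ii0] := eqVneq i i0.
    by rewrite /y !line_coord.
  have -> : y j.+1 = y (k + (j.+1 - k')).
    have -> : j.+1 = k' + (j.+1 - k') by lia.
    by rewrite {1}/y mulrnDr addrA -/(y k') -Ey /y -addrA -mulrnDr; congr (_ + _ *+ _)%R; lia.
  by apply: yW; lia.
have jL : j < excess b W.
  rewrite -(card_exit (i1, true)); have <- : #|Z| = j.+1.
    rewrite card_imset ?card_ord // => k k' E; apply: val_inj => /=.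
    case: (ltngtP k k') => // kk'; exfalso.
      by apply: (yinj _ _ kk' (leq_ord k')); rewrite E.
    by apply: (yinj _ _ kk' (leq_ord k)); rewrite E.
  apply: exit_card => //; first by apply/subsetP => _ /imsetP[k _ ->]; apply: yW; rewrite -ltnS.
  move=> _ _ /imsetP[k _ ->] /imsetP[k' _ ->] /forallP/(_ i0); rewrite eq_sym i01 /= => /eqP E.
  case: (ltngtP k k') => [kk'|kk'|->] //; exfalso.
    by apply: (yinj _ _ kk' (leq_ord k')).
  by apply: (yinj _ _ kk' (leq_ord k)).
exists (Ordinal jL) => /=; apply/card_gt0P; exists (i0, true).
by rewrite inE /cut -/(y j) -yS (yW j) // (negbTE yj).
Qed.

Variables (psi l : nat).
Hypothesis d_ge4 : 4 <= d.
Hypothesis psi_gt0 : 0 < psi.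
Hypothesis psi_led : psi <= d.
Hypothesis psi_sq : psi * psi <= d * l.
Hypothesis l_gt0 : 0 < l.
Hypothesis l_large : d.*2 <= 2 ^ l.+1.

(** The factor 8 is [2 * 4]: jumps of length at most 4, travelled there and back. *)
Definition walk_length (psi l L : nat) : nat := 8 * ((822 * l * L) %/ psi).
Definition contour_code (psi l L : nat) : finType :=
  ('I_L * (D * code (D : finType) 8 (walk_length psi l L)))%type.
Definition contour_decode (b : bool) (v0 : T) (psi l L : nat) (c : contour_code psi l L) : ({set T} * {set T}) * D :=
  (decode_FS e par d b psi (decode_set e (v0 + e (i0, true) *+ c.1)%R c.2.2) c.2.1, c.2.1).

Lemma contour_approximation : exists c : contour_code psi l (excess b W),
  let FS := contour_decode b v0 c in
  sandwich par b W FS.1.1 FS.1.2 /\ {in FS.1.2, forall y, (y + e FS.2)%R \in FS.1.1}.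
Proof.
have [j b0cut] := ray_exit.
have [Xs [t [sw sh tot con]]] := approximation eN oK e_inj par_e card_dir W_bd contour_nbr W_wall
  exits_deg excess_half contour_cut_conn b0cut d_ge4 psi_gt0 psi_led psi_sq l_gt0 l_large.
have d_gt0 : 0 < d by apply: leq_trans d_ge4.
have Hn : 2 * 4 * (\sum_i #|Xs i|) <= walk_length psi l (excess b W).
  by rewrite /walk_length; apply: leq_mul => //; rewrite leq_divRL.
have [c cE] := encode eN card_dir d_gt0 Hn con.
exists (j, (t, c)); rewrite /contour_decode /= !cE.
by split; [exact: sw|exact: sh].
Qed.
End OneContour.

Lemma card_contour_code psi l L : #|contour_code psi l L| =
  L * (d.*2 * (d.*2 ^ (walk_length psi l L) * 2 ^ ((walk_length psi l L).+1 * 8))).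
Proof.
have H := @card_code D d card_dir 8 (walk_length psi l L).
rewrite /contour_code card_prod [in X in _ * X]card_prod card_ord H.
by rewrite [X in _ * (X * _)]card_dir.
Qed.
End TorusContour.

Local Open Scope ring_scope.

(** * The flow *)

Section Decoder.
Variables (R : realFieldType) (P : eqType) (B J : finType).
Variables (N : P -> {set B}) (occ : pred P) (a : bool -> R) (kap : R).
Hypothesis a_ge0 : forall o, 0 <= a o.
Hypothesis kap_ge0 : 0 <= kap.
Hypothesis a_kap : forall o, a o + kap <= 1.

(* The list l is read site by site, K being the part of the second class already
   known; a step [~~ c x] reveals the neighbours N x at the cost [kap]. *)
Fixpoint decoder_weight (l : seq P) (K : {set B}) (c : pred P) : R :=
  if l is x :: l' then
    if N x \subset K then (if c x && occ x then 0 else 1) * decoder_weight l' K c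
    else if c x then a (occ x) * decoder_weight l' K c
    else kap * decoder_weight l' (K :|: N x) c
  else 1.

Definition revealed (l : seq P) (K : {set B}) (c : pred P) : {set B} :=
  K :|: \bigcup_(x <- l | ~~ c x) N x.

Lemma revealed_cons x l K c :
  revealed (x :: l) K c = if c x then revealed l K c else revealed l (K :|: N x) c.
Proof. by rewrite /revealed big_cons; case: (c x) => //=; rewrite setUA. Qed.

(** A Kraft-type inequality: at each site the branch weights add up to at most 1. If [N x] is
    already known, both answers weigh 1, but an occupied [x] then admits only [~~ c x], and for an
    empty [x] the answer need not be recovered. *)
Lemma sum_decoder_weight (l : seq P) (K : {set B}) (c : J -> pred P) (Q : {set J}) :
  {in Q &, forall i j, revealed l K (c i) = revealed l K (c j) ->
     {in l, forall x, c i x && occ x = c j x && occ x} -> i = j} ->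
  \sum_(i in Q) decoder_weight l K (c i) <= 1.
Proof.
elim: l K Q => [|x l IH] K Q inj /=.
  have cQ : (#|Q| <= 1)%N.
    by apply/card_le1_eqP => i j iQ jQ; apply: inj => //; rewrite /revealed !big_nil.
  by rewrite sumr_const -(mulr_natr 1) mul1r lern1.
have [NK|NK] := boolP (N x \subset K).
  rewrite (bigID (fun i => c i x && occ x)) /= big1 ?add0r; last first.
    by move=> i /andP[_ ->]; rewrite mul0r.
  rewrite (eq_bigr (fun i => decoder_weight l K (c i))); last first.
    by move=> i /andP[_ /negbTE ->]; rewrite mul1r.
  rewrite (eq_bigl (fun i => i \in [set i in Q | ~~ (c i x && occ x)])); last by move=> i; rewrite inE.
  apply: IH => i j; rewrite !inE => /andP[iQ ix] /andP[jQ jx] E H; apply: inj => //.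
    by rewrite !revealed_cons (setUidPl NK) E !if_same.
  by move=> y; rewrite inE => /orP[/eqP ->|/H //]; rewrite (negbTE ix) (negbTE jx).
rewrite (bigID (fun i => c i x)) /=.
rewrite (eq_bigr (fun i => a (occ x) * decoder_weight l K (c i))); last by move=> i /andP[_ ->].
rewrite [X in _ + X](eq_bigr (fun i => kap * decoder_weight l (K :|: N x) (c i))); last first.
  by move=> i /andP[_ /negbTE ->].
rewrite -!mulr_sumr; apply: le_trans (a_kap (occ x)); apply: lerD; apply: ler_piMr => //.
  rewrite (eq_bigl (fun i => i \in [set i in Q | c i x])); last by move=> i; rewrite inE.
  apply: IH => i j; rewrite !inE => /andP[iQ ix] /andP[jQ jx] E H; apply: inj => //.
    by rewrite !revealed_cons ix jx.
  by move=> y; rewrite inE => /orP[/eqP ->|/H //]; rewrite ix jx.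
rewrite (eq_bigl (fun i => i \in [set i in Q | ~~ c i x])); last by move=> i; rewrite inE.
apply: IH => i j; rewrite !inE => /andP[iQ ix] /andP[jQ jx] E H; apply: inj => //.
  by rewrite !revealed_cons (negbTE ix) (negbTE jx).
by move=> y; rewrite inE => /orP[/eqP ->|/H //]; rewrite (negbTE ix) (negbTE jx).
Qed.

(** [N x] is not yet known when the decoder reads [x], so the answer at [x] has a price. *)
Definition specified (l : seq P) (K : {set B}) (c : pred P) (x : P) : bool :=
  ~~ (N x \subset K :|: \bigcup_(y <- take (index x l) l | ~~ c y) N y).

Definition site_weight (s o : bool) : R := if s then a o else (~~ o)%:R.

(** Each factor [kap] reveals at least one new site, and [kap <= 1]. *)
Lemma decoder_weight_ge (l : seq P) (K : {set B}) (c : pred P) : uniq l -> kap <= 1 ->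
  kap ^+ #|revealed l K c :\: K| *
    \prod_(x <- l | c x) site_weight (specified l K c x) (occ x) <= decoder_weight l K c.
Proof.
move=> + kap1; have a1 o : 0 <= a o by [].
have sw0 s o : 0 <= site_weight s o by rewrite /site_weight; case: s.
elim: l K => [|x l IH] K /=; first by rewrite big_nil mulr1 exprn_ile1.
move=> /andP[xl ul]; rewrite big_cons revealed_cons.
have spec0 : specified (x :: l) K c x = ~~ (N x \subset K).
  by rewrite /specified /= eqxx big_nil setU0.
have specS y : y \in l -> specified (x :: l) K c y = specified l (if c x then K else K :|: N x) c y.
  move=> yl; rewrite /specified /=; have -> /= : (x == y) = false.
    by apply/negbTE; apply: contraNneq xl => ->.
  by rewrite big_cons; case: (c x) => //=; rewrite setUA.
have prodS K' : (if c x then K else K :|: N x) = K' ->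
    \prod_(y <- l | c y) site_weight (specified (x :: l) K c y) (occ y) =
    \prod_(y <- l | c y) site_weight (specified l K' c y) (occ y).
  by move=> <-; rewrite big_seq_cond [RHS]big_seq_cond; apply: eq_bigr => y /andP[yl _]; rewrite specS.
have pg K' : 0 <= \prod_(y <- l | c y) site_weight (specified l K' c y) (occ y).
  by apply: prodr_ge0 => y _.
rewrite spec0; case: (boolP (c x)) => cx.
  rewrite (prodS K) ?cx //; case: ifP => NK /=.
    rewrite mulrCA; case: (occ x); rewrite ?mul0r ?mul1r //; exact: IH.
  by rewrite mulrCA; apply: ler_wpM2l => //; apply: IH.
rewrite (prodS (K :|: N x)) ?(negbTE cx) //; case: ifP => NK /=.
  by rewrite (setUidPl NK) mul1r; apply: IH.
apply: le_trans (ler_wpM2l kap_ge0 (IH (K :|: N x) ul)).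
rewrite mulrA; apply: ler_wpM2r => //; rewrite -exprS; apply: ler_wiXn2l => //.
apply: (@leq_trans (#|N x :\: K| + #|revealed l (K :|: N x) c :\: (K :|: N x)|)%N).
  by rewrite -add1n leq_add2r card_gt0 setD_eq0 NK.
rewrite -cardsUI (_ : _ :&: _ = set0) ?cards0 ?addn0; last first.
  by apply/setP => z; rewrite !inE; case: (z \in N x); rewrite ?orbT ?andbF.
apply/subset_leq_card/subsetP => z; rewrite !inE.
by case: (z \in K) => //=; case: (z \in N x).
Qed.
End Decoder.

(** * Summation over the ways to fill a set *)

Section Fibers.
Variables (R : comNzRingType) (V : finType).

Lemma sum_fiber (Q B : {set V}) (g : V -> bool -> R) : [disjoint B & Q] ->
  \sum_(J : {set V} | J :\: Q == B) \prod_(x in Q) g x (x \in J) =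
  \prod_(x in Q) (g x true + g x false).
Proof.
move=> BQ.
transitivity (\prod_x ((if x \in Q then g x true else (x \in B)%:R) + (if x \in Q then g x false else (x \notin B)%:R))); last first.
  rewrite (bigID (mem Q)) /= [X in _ * X]big1 ?mulr1; last first.
    by move=> x /negbTE ->; case: (x \in B); rewrite ?addr0 ?add0r.
  by apply: eq_bigr => x ->.
rewrite bigA_distr big_mkcond; apply: eq_bigr => J _; rewrite [RHS](bigID (mem Q)) /=.
case: eqP => [JB|/eqP JB].
  rewrite [X in _ * X]big1 ?mulr1; last first.
    move=> x xQ; have := congr1 (fun S : {set V} => x \in S) JB; rewrite inE xQ /= (negbTE xQ) => ->.
    by case: (x \in B).
  by apply: eq_bigr => x ->; case: (x \in J).
have [/existsP[x /andP[xQ xJ]]|/existsPn H] := boolP [exists x, (x \notin Q) && ((x \in J) != (x \in B))].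
  rewrite [X in _ * X](bigD1 x) //= (negbTE xQ).
  by case: (x \in J) xJ; case: (x \in B) => // _; rewrite mul0r mulr0.
case/eqP: JB; apply/setP => x; rewrite inE; have := H x; have := disjointFr BQ (x := x).
by case: (x \in B); case: (x \in Q); case: (x \in J) => //= /(_ isT).
Qed.

(** The filling of [Q2] may depend on that of [Q1], so it is summed out before it. *)
Lemma sum_fiber2 (Q1 Q2 B : {set V}) (f : V -> bool -> R) (g : {set V} -> V -> bool -> R) :
  [disjoint B & Q1] -> [disjoint B & Q2] -> [disjoint Q1 & Q2] ->
  (forall x, f x true + f x false = 1) -> (forall H x, g H x true + g H x false = 1) ->
  \sum_(J : {set V} | J :\: (Q1 :|: Q2) == B)
     ((\prod_(x in Q1) f x (x \in J)) * \prod_(x in Q2) g (J :\: Q2) x (x \in J)) = 1.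
Proof.
move=> B1 B2 Q12 f1 g1.
rewrite (partition_big (fun J => J :\: Q2) (fun H => H :\: Q1 == B)) /=; last first.
  by move=> J; rewrite setUC -setDDl.
rewrite (eq_bigr (fun H : {set V} => \prod_(x in Q1) f x (x \in H))).
  by rewrite sum_fiber // big1.
move=> H /eqP HB.
have H2 : [disjoint H & Q2].
  rewrite disjoint_subset; apply/subsetP => x xH; rewrite inE; apply/negP => x2.
  have [x1|x1] := boolP (x \in Q1); first by rewrite (disjointFr Q12 x1) in x2.
  have : x \in B by rewrite -HB inE x1.
  by move/(disjointFr B2); rewrite x2.
rewrite (eq_bigl (fun J : {set V} => J :\: Q2 == H)); last first.
  move=> J; case: (eqVneq (J :\: Q2) H) => [E|]; rewrite ?andbF // andbT.
  by rewrite setUC -setDDl E HB eqxx.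
rewrite (eq_bigr (fun J : {set V} => (\prod_(x in Q1) f x (x \in H)) * \prod_(x in Q2) g H x (x \in J))).
  by rewrite -mulr_sumr sum_fiber // [X in _ * X]big1 ?mulr1.
move=> J /eqP JH; rewrite JH; congr (_ * _); apply: eq_bigr => x x1.
by rewrite -JH inE (disjointFr Q12 x1).
Qed.
End Fibers.

(** * The flow from compatible sets to filled sets *)

Section Flow.
Variables (R : realFieldType) (V : finType) (lam q p : R).
Variables (X0 X1 X2 : {set V}) (r : rel V) (Cs : {set {set V}}).
Variables (Wt base : {set V} -> {set V}) (okJ : pred {set V}) (K : nat).
Implicit Types (I J H S : {set V}).
Hypothesis lam_gt0 : 0 < lam.
Hypothesis q_ge0 : 0 <= q.
Hypothesis q_lt1 : q < 1.
Hypothesis p_ge0 : 0 <= p.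
Hypothesis p_le1 : p <= 1.
(** With weight [lam^-1] per filled site, a factor [1 - q] can be taken out of every vacated site of
    [X0] and [X2]; a filled one then keeps [kap]. *)
Let kap := q / (lam * (1 - q)).
Hypothesis p_kap : p / lam + kap <= 1.
Hypothesis kap_p : kap <= p.
Hypothesis X01 : [disjoint X0 & X1].
Hypothesis X02 : [disjoint X0 & X2].
Hypothesis X12 : [disjoint X1 & X2].
Hypothesis X0Wt : {in Cs, forall I, X0 \subset Wt I}.
Hypothesis WtX : {in Cs, forall I, Wt I \subset X0 :|: X1 :|: X2}.
Hypothesis cover : {in Cs, forall I, {in X1 & X2, forall x y, r x y -> (x \in Wt I) || (y \in Wt I)}}.
Hypothesis minimal : {in Cs, forall I, {in X2 :&: Wt I, forall y, exists2 x, x \in X1 :\: Wt I & r x y}}.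
Hypothesis base_inj : {in Cs &, injective base}.
Hypothesis base_Wt : {in Cs, forall I, [disjoint base I & Wt I]}.
Hypothesis base_ok : {in Cs, forall I (S : {set V}), S \subset Wt I -> okJ (base I :|: S)}.
Hypothesis card_base : {in Cs, forall I, #|base I| = #|I|}.
Hypothesis K_le : {in Cs, forall I, (K <= #|Wt I :&: (X0 :|: X2)|)%N}.

Let N (J : {set V}) (x : V) : {set V} := [set z in X2 :&: J | r x z].
Let l := enum X1.
Let c (I : {set V}) : pred V := fun x => x \in Wt I.
Let a (o : bool) : R := if o then p / lam else 1 - p.
Let Q1 I := Wt I :&: (X0 :|: X2).
Let Q2 I := Wt I :&: X1.
Let spec J I x := specified (N J) l set0 (c I) x.
Let f (x : V) (o : bool) : R := if o then q else 1 - q.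
Let g I H x (o : bool) : R := if spec H I x then (if o then p else 1 - p) else (~~ o)%:R.
(** The conditional probability of [J] given [I]: vacated sites of [X0] and [X2] are filled
    independently with probability [q]; after that, vacated sites of [X1] are filled with
    probability [p] if specified and left empty otherwise. *)
Let rho I J : R := (\prod_(x in Q1 I) f x (x \in J)) * \prod_(x in Q2 I) g I (J :\: Q2 I) x (x \in J).

Let kap_ge0 : 0 <= kap.
Proof. by apply: divr_ge0 => //; apply: mulr_ge0; [exact: ltW|rewrite subr_ge0 ltW]. Qed.

Let WtE I : I \in Cs -> Wt I = Q1 I :|: Q2 I.
Proof.
move=> IC; rewrite /Q1 /Q2 -setIUr; apply/esym/setIidPl; apply: subset_trans (WtX IC) _.
by rewrite setUAC.
Qed.

Let Q12 I : [disjoint Q1 I & Q2 I].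
Proof.
rewrite disjoint_subset; apply/subsetP => x; rewrite !inE => /andP[_ x02].
rewrite negb_and; apply/orP; right; apply/negP => x1.
by case/orP: x02 => [x0|x2]; [have := disjointFr X01 x0|have := disjointFl X12 x2]; rewrite x1.
Qed.

Let disjoint_sub (A B C : {set V}) : [disjoint A & B] -> C \subset B -> [disjoint A & C].
Proof. by move=> AB CB; rewrite disjoint_sym; apply: disjointWl CB _; rewrite disjoint_sym. Qed.

Let sum_rho I : I \in Cs -> \sum_(J : {set V} | J :\: Wt I == base I) rho I J = 1.
Proof.
move=> IC; rewrite (WtE IC); apply: sum_fiber2 => //.
- by apply: disjoint_sub (base_Wt IC) _; apply: subsetIl.
- by apply: disjoint_sub (base_Wt IC) _; apply: subsetIl.
- by move=> x; rewrite /f addrC subrK.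
- by move=> H x; rewrite /g; case: (spec _ _ _); rewrite ?add0r // addrC subrK.
Qed.

Let prod_ite (Q J : {set V}) (u v : R) :
  \prod_(x in Q) (if x \in J then u else v) = u ^+ #|J :&: Q| * v ^+ #|Q :\: J|.
Proof.
rewrite (bigID (mem J)) /=; congr (_ * _).
  rewrite (eq_bigr (fun=> u)); last by move=> x /andP[_ ->].
  by rewrite prodr_const; congr (_ ^+ _); apply: eq_card => x; rewrite !inE andbC.
rewrite (eq_bigr (fun=> v)); last by move=> x /andP[_ /negbTE ->].
by rewrite prodr_const; congr (_ ^+ _); apply: eq_card => x; rewrite !inE andbC.
Qed.

(** By [cover], a site of [X1] that is not vacated reveals only vacated sites of [X2]; by [minimal],
    every filled one among these gets revealed. *)
Let revealedE I J : I \in Cs -> revealed (N J) l set0 (c I) = J :&: X2 :&: Wt I.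
Proof.
move=> IC; rewrite /revealed set0U /l big_enum_cond /=.
apply/setP => y; apply/bigcupP/idP => [[x /andP[x1 xW]]|].
  rewrite !inE => /andP[/andP[y2 ->] xy]; rewrite y2 /=.
  by have := cover IC x1 y2 xy; rewrite /c in xW; rewrite (negbTE xW).
rewrite !inE => /andP[/andP[yJ y2] yW].
have /(minimal IC)[x] : y \in X2 :&: Wt I by rewrite inE y2.
rewrite inE => /andP[xW x1] xy; exists x; first by rewrite x1.
by rewrite !inE y2 yJ.
Qed.

Let rho_le I J : I \in Cs ->
  lam^-1 ^+ #|J :&: Wt I| * rho I J <=
  (1 - q) ^+ K * decoder_weight (N J) (fun x => x \in J) a kap l set0 (c I).
Proof.
move=> IC; have q1 : 0 < 1 - q by rewrite subr_gt0.
have -> : #|J :&: Wt I| = (#|J :&: Q1 I| + #|J :&: Q2 I|)%N.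
  rewrite {1}(WtE IC) setIUr -cardsUI (_ : _ :&: (J :&: Q2 I) = set0) ?cards0 ?addn0 //.
  by rewrite setIACA (disjoint_setI0 (Q12 I)) setI0.
rewrite exprD /rho mulrACA.
have E1 : lam^-1 ^+ #|J :&: Q1 I| * \prod_(x in Q1 I) f x (x \in J) =
    (1 - q) ^+ #|Q1 I| * kap ^+ #|J :&: Q1 I|.
  rewrite /f prod_ite mulrA -exprMn -(cardsID J (Q1 I)) exprD setIC mulrAC -exprMn.
  congr (_ ^+ _ * _); rewrite /kap; field.
  by rewrite !gt_eqF.
have E2 : lam^-1 ^+ #|J :&: Q2 I| * \prod_(x in Q2 I) g I (J :\: Q2 I) x (x \in J) =
    \prod_(x <- l | c I x) site_weight a (specified (N J) l set0 (c I) x) (x \in J).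
  rewrite /l big_enum_cond /=.
  rewrite [RHS](eq_bigl (fun x => x \in Q2 I)); last by move=> x; rewrite inE andbC.
  have -> : lam^-1 ^+ #|J :&: Q2 I| = \prod_(x in Q2 I) (if x \in J then lam^-1 else 1).
    by rewrite prod_ite expr1n mulr1.
  rewrite -big_split /=; apply: eq_bigr => x xQ.
  have -> : g I (J :\: Q2 I) x (x \in J) = if spec J I x then (if x \in J then p else 1 - p) else (x \notin J)%:R.
    rewrite /g; suff -> : spec (J :\: Q2 I) I x = spec J I x by [].
    rewrite /spec; have NE y : N (J :\: Q2 I) y = N J y.
      apply/setP => z; rewrite !inE; case: (boolP (z \in X2)) => //= z2.
      by rewrite (disjointFl X12 z2) andbF.
    rewrite /specified NE; congr (~~ (_ \subset _ :|: _)); apply: eq_bigr => y _; exact: NE.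
  rewrite /site_weight -/(spec J I x) /a; case: (spec J I x); case: (x \in J); rewrite ?mul1r ?mulr0 //.
  by rewrite mulrC.
rewrite E1 E2 -mulrA.
have a0 o : 0 <= a o.
  by rewrite /a; case: o; [apply: divr_ge0 => //; exact: ltW|rewrite subr_ge0].
have D := @decoder_weight_ge R V V (N J) (fun x => x \in J) a kap a0 kap_ge0 l set0 (c I)
  (enum_uniq _) (le_trans kap_p p_le1).
have qK : 0 <= (1 - q) ^+ K by apply: exprn_ge0; exact: ltW.
apply: le_trans (ler_wpM2l qK D).
rewrite (revealedE J IC) setD0.
  have pg : 0 <= \prod_(x <- l | c I x) site_weight a (specified (N J) l set0 (c I) x) (x \in J).
    apply: prodr_ge0 => x _; rewrite /site_weight /a; case: (specified _ _ _ _ _); case: (x \in J) => //=.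
      by apply: divr_ge0 => //; exact: ltW.
    by rewrite subr_ge0.
  apply: ler_pM => //.
  + by apply: exprn_ge0; exact: ltW.
  + by apply: mulr_ge0 => //; apply: exprn_ge0.
  + by apply: ler_wiXn2l; [exact: ltW|rewrite gerBl|exact: K_le].
  apply: ler_wpM2r => //; apply: ler_wiXn2l => //; first exact: le_trans kap_p _.
  apply/subset_leq_card/subsetP => x; rewrite !inE => /andP[/andP[-> ->] ->].
  by rewrite orbT.
Qed.

Let sum_rho_le (J : {set V}) :
  \sum_(I in Cs | J :\: Wt I == base I) lam^-1 ^+ #|J :&: Wt I| * rho I J <= (1 - q) ^+ K.
Proof.
have q1 : 0 <= 1 - q by rewrite subr_ge0 ltW.
apply: (@le_trans _ _ ((1 - q) ^+ K * \sum_(I in [set I in Cs | J :\: Wt I == base I])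
    decoder_weight (N J) (fun x => x \in J) a kap l set0 (c I))).
  rewrite mulr_sumr [X in _ <= X](eq_bigl (fun I => (I \in Cs) && (J :\: Wt I == base I))); last first.
    by move=> I; rewrite inE.
  by apply: ler_sum => I /andP[IC _]; apply: rho_le.
apply: ler_piMr; first exact: exprn_ge0.
apply: sum_decoder_weight => //.
- move=> o; rewrite /a; case: o; [apply: divr_ge0 => //; exact: ltW|by rewrite subr_ge0].
- move=> o; rewrite /a; case: o => //; by rewrite -addrA gerDl addrC subr_le0.
(* The decoder's output determines [J :&: Wt I], hence [base I], which is the rest of [J], and hence
   [I]. *)
move=> I I'; rewrite !inE => /andP[IC /eqP IB] /andP[IC' /eqP IB'].
rewrite !revealedE // => E occ; apply: base_inj => //; rewrite -IB -IB'.
have occ' x : x \in X1 -> x \in J -> (x \in Wt I) = (x \in Wt I').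
  by move=> x1 xJ; have := occ x; rewrite mem_enum x1 => /(_ isT); rewrite /c xJ !andbT.
apply/setP => x; rewrite !inE; case: (boolP (x \in J)) => xJ; rewrite ?andbF // !andbT.
congr (~~ _); have [x1|x1] := boolP (x \in X1); first exact: occ'.
have [x2|x2] := boolP (x \in X2).
  by have := congr1 (fun S : {set V} => x \in S) E; rewrite !inE xJ x2.
have [x0|x0] := boolP (x \in X0); first by rewrite !(subsetP (X0Wt _)).
have out I0 : I0 \in Cs -> x \notin Wt I0.
  by move=> IC0; apply/negP => /(subsetP (WtX IC0)); rewrite !inE (negbTE x0) (negbTE x1) (negbTE x2).
by rewrite (negbTE (out _ IC)) (negbTE (out _ IC')).
Qed.

(** The weight of [I] is spread over the sets [J] according to [rho]; each [J] receives at most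
    [(1 - q) ^+ K] times its own weight. *)
Lemma flow_bound :
  \sum_(I in Cs) lam ^+ #|I| <= (1 - q) ^+ K * \sum_(J : {set V} | okJ J) lam ^+ #|J|.
Proof.
have -> : \sum_(I in Cs) lam ^+ #|I| =
    \sum_(I in Cs) \sum_(J : {set V} | J :\: Wt I == base I) lam ^+ #|J| * (lam^-1 ^+ #|J :&: Wt I| * rho I J).
  apply: eq_bigr => I IC; rewrite -[LHS]mulr1 -(sum_rho IC) mulr_sumr.
  apply: eq_bigr => J /eqP JB; rewrite [RHS]mulrA; congr (_ * _).
  have -> : #|J| = (#|J :\: Wt I| + #|J :&: Wt I|)%N by rewrite addnC cardsID.
  rewrite exprD -mulrA -exprMn mulfV ?gt_eqF // expr1n mulr1.
  by rewrite JB (card_base IC).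
rewrite (exchange_big_dep okJ) /=; last first.
  move=> I J IC /eqP JB; rewrite -(setID J (Wt I)) setUC JB; apply: base_ok => //.
  exact: subsetIr.
rewrite mulr_sumr; apply: ler_sum => J _.
rewrite -mulr_sumr mulrC; apply: ler_wpM2r; first by apply: exprn_ge0; exact: ltW.
exact: sum_rho_le.
Qed.
End Flow.

Local Close Scope ring_scope.

Lemma arith_half L n k : n < uphalf L -> L <= n + k -> uphalf L <= k.
Proof. by lia. Qed.

(** * The shift as a flow on the torus *)

Section ContourFlow.
Variables (d p : nat).
Hypothesis p_even : ~~ odd p.
Hypothesis p_gt1 : 1 < p.
Local Notation Zn := 'I_p.+2.
Local Notation T := ('rV[Zn]_d).
Local Notation D := ('I_d * bool)%type.
Local Notation e := (@stp d p).
Local Notation wall := (wall d p).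
Local Notation par := (@par d p).
Local Notation opp := (@opp d).
Local Notation evens b := (evens par b).
Variables (i0 i1 : 'I_d).
Hypothesis i01 : i1 != i0.
Variables (b : bool) (v0 : T) (F S : {set T}) (t : D).
Hypothesis SF : {in S, forall y, (y + e t)%R \in F}.
Implicit Types (I J : {set T}).

Let eN := @stpN d p.
Let par_e := @par_stp d p p_even.
Let addK x s : (x + e s + e (opp s))%R = x. Proof. exact: addeK eN x s. Qed.
Let addK' x s : (x + e (opp s) + e s)%R = x. Proof. by rewrite addrAC addK. Qed.

Variable W : {set T} -> {set T}.
Hypothesis W_contour : forall I, ok b I -> v0 \in I -> contour b v0 (W I).
Hypothesis W_edge : forall I x s, ok b I -> v0 \in I -> x \in W I -> (x + e s)%R \notin W I ->
  [/\ par x = b, x \notin I & (x + e s)%R \notin I].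

Definition compatible (L : nat) : {set {set T}} :=
  [set I | [&& ok b I, v0 \in I, sandwich par b (W I) F S & excess b (W I) == L]].
Definition vacated I : {set T} := [set x in W I | (x + e (opp t))%R \notin W I].
Definition shifted I : {set T} := [set (x + e t)%R | x in I :&: W I].
Definition flow_base I : {set T} := (I :\: W I) :|: shifted I.
(** The even sites by what [(F, S)] tells about them, for every compatible [I]: those of [X0] are
    vacated, [z + e t] in [X1] is vacated when [z] is outside [W I], and a site of [X2] is vacated
    when it is in [W I]. *)
Let X1 : {set T} := [set (y + e t)%R | y in S].
Let X2 : {set T} := evens b :\: F.
Let X0 : {set T} := F :\: X1.

Section OneSet.
Variables (L : nat) (I : {set T}).
Hypothesis IC : I \in compatible L.
Local Notation WI := (W I).

Let okI : ok b I. Proof. by move: IC; rewrite inE => /and4P[]. Qed.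
Let v0I : v0 \in I. Proof. by move: IC; rewrite inE => /and4P[]. Qed.
Let cW : contour b v0 WI. Proof. exact: W_contour. Qed.
Let AS x : x \in WI -> par x != b -> x \in S.
Proof.
move: IC; rewrite inE => /and4P[_ _ /and3P[/subsetP H _ _] _] xW xb.
by apply: H; rewrite !inE xb.
Qed.
Let FW x : x \in F -> x \in WI.
Proof. by move: IC; rewrite inE => /and4P[_ _ /and3P[_ _ /subsetP H] _] /H; rewrite inE => /andP[]. Qed.
Let Fe x : x \in F -> par x = b.
Proof. by move: IC; rewrite inE => /and4P[_ _ /and3P[_ _ /subsetP H] _] /H; rewrite !inE => /andP[_ /eqP]. Qed.
Let So x : x \in S -> par x = ~~ b.
Proof.
move: IC; rewrite inE => /and4P[_ _ /and3P[_ /subsetP H _] _] /H; rewrite !inE.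
by case: (par x); case: b.
Qed.
Let edge x s : x \in WI -> (x + e s)%R \notin WI -> [/\ par x = b, x \notin I & (x + e s)%R \notin I].
Proof. exact: W_edge. Qed.
Let indI x s : x \in I -> (x + e s)%R \notin I.
Proof. by have [H _] := okP _ _ okI; apply: H. Qed.

Lemma card_vacated : #|vacated I| = L.
Proof.
rewrite (card_exit p_even cW (opp t)).
by move: IC; rewrite inE => /and4P[_ _ _ /eqP].
Qed.

Lemma X0_vacated : X0 \subset vacated I.
Proof.
apply/subsetP => x; rewrite inE => /andP[x1 xF]; rewrite inE FW //=.
apply: contra x1 => yW; apply/imsetP; exists (x + e (opp t))%R; last by rewrite addK'.
by apply: AS => //; rewrite par_e (Fe xF); case: b.
Qed.

Let vacated_par x : x \in vacated I -> par x = b.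
Proof. by rewrite inE => /andP[xW yW]; have [] := edge xW yW. Qed.

Lemma vacated_X : vacated I \subset X0 :|: X1 :|: X2.
Proof.
apply/subsetP => x xV; rewrite !inE (vacated_par xV) eqxx.
by case: (x \in F); case: (x \in X1).
Qed.

(** [y] is adjacent to the site whose translate by [e t] is [x]. *)
Definition site_rel (x y : T) : bool := [exists s, y == (x + e (opp t) + e s)%R].

(** If the odd site [z] is in [W I], so is its neighbour [y], which is then vacated; otherwise
    [z + e t] is vacated. *)
Lemma vacated_cover : {in X1 & X2, forall x y, site_rel x y -> (x \in vacated I) || (y \in vacated I)}.
Proof.
move=> _ y /imsetP[z zS ->]; rewrite inE => /andP[yF ye]; rewrite /site_rel addK => /existsP[s /eqP yE].
have zF := SF zS; have [zW|zW] := boolP (z \in WI); last by rewrite inE FW //= addK zW.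
have yW : y \in WI.
  rewrite yE; apply: contraT => H; have [zb _ _] := edge zW H.
  by have := So zS; rewrite zb; case: b.
apply/orP; right; rewrite inE yW /=; apply: contra yF => H.
rewrite -(addK' y t); apply: SF; apply: AS => //; rewrite par_e.
by move: ye; rewrite inE => /eqP ->; case: b.
Qed.

(** Here and in [vacated_minimal1] the witness comes from a neighbour on the same side of [W I].
    Having both statements lets [X1] and [X2] exchange their roles. *)
Lemma vacated_minimal2 : {in X2 :&: vacated I, forall y, exists2 x, x \in X1 :\: vacated I & site_rel x y}.
Proof.
move=> y /setIP[_ yV]; have yb := vacated_par yV; move: yV; rewrite inE => /andP[yW _].
have [s] := contour_nbr i01 cW y; rewrite yW => sW.
have sS : (y + e s)%R \in S by apply: AS => //; rewrite par_e yb; case: b.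
exists (y + e s + e t)%R.
  by apply/setDP; split; [exact: imset_f|rewrite inE addK sW andbF].
by rewrite /site_rel addK; apply/existsP; exists (opp s); rewrite addK.
Qed.

Lemma vacated_minimal1 : {in X1 :&: vacated I, forall x, exists2 y, y \in X2 :\: vacated I & site_rel x y}.
Proof.
move=> _ /setIP[/imsetP[z zS ->]]; rewrite inE addK => /andP[_ zW].
have [s] := contour_nbr i01 cW z; rewrite (negbTE zW) => sW.
exists (z + e s)%R.
  rewrite inE inE sW /= inE; apply/andP; split; first by apply/negP => /FW; rewrite sW.
  by rewrite inE par_e (So zS); case: b.
by rewrite /site_rel addK; apply/existsP; exists s.
Qed.

Let shiftedP x : x \in shifted I -> [/\ (x + e (opp t))%R \in I, (x + e (opp t))%R \in WI & x \in WI].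
Proof.
case/imsetP => z /setIP[zI zW] ->; rewrite addK; split=> //.
by apply: contraT => H; have [_ /negP[]] := edge zW H.
Qed.

Lemma base_vacated : [disjoint flow_base I & vacated I].
Proof.
rewrite disjoint_subset; apply/subsetP => x; rewrite !inE => /orP[/andP[/negbTE -> //]|].
by case/shiftedP => _ -> ->.
Qed.

Lemma card_flow_base : #|flow_base I| = #|I|.
Proof.
rewrite -(cardsID WI I) addnC /flow_base cardsU (_ : _ :&: shifted I = set0).
  by rewrite cards0 subn0 /shifted card_imset //; apply: addIr.
apply/setP => x; rewrite in_setI in_setD in_set0; apply/negbTE/negP => /andP[/andP[xW _]].
by case/shiftedP => _ _; apply/negP.
Qed.

(** Both ends of a boundary edge are empty in [I], so the shifted part stays inside and touches
    nothing outside. A shifted neighbour of a vacated [x] would come from an occupied neighbour,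
    inside [W I], of the outer site [x + e (opp t)]. Vacated sites all have the same parity. *)
Lemma flow_base_ok (U : {set T}) : U \subset vacated I -> ok b (flow_base I :|: U).
Proof.
move=> /subsetP UV; set J := _ :|: _.
have JP x : x \in J -> [\/ (x \in I) && (x \notin WI), x \in shifted I | x \in vacated I].
  rewrite /J !in_setU in_setD => /orP[/orP[/andP[xW xI]|H]|/UV H].
  - by constructor 1; rewrite xI.
  - by constructor 2.
  - by constructor 3.
have vW x : x \in vacated I -> x \in WI by rewrite inE => /andP[].
have key x s : x \in shifted I \/ x \in vacated I -> (x + e s)%R \in I -> (x + e s)%R \in WI.
  move=> H yI; apply: contraT => yW.
  have xW : x \in WI by case: H => [/shiftedP[]|/vW].
  by have [_ _ /negP[]] := edge xW yW.
have key2 x s : x \in vacated I -> (x + e s)%R \in shifted I -> False.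
  move=> + /shiftedP[]; rewrite inE addrAC => /andP[_ xW] zI zW _.
  have := @edge _ (opp s) zW; rewrite addK => /(_ xW)[_ /negP]; exact.
apply/okP; split.
  move=> x s xJ; apply/negP => yJ.
  case/JP: xJ => [/andP[xI xW]|xsh|xv]; case/JP: yJ => [/andP[yI yW]|ysh|yv].
  - by have /negP := indI s xI.
  - have := @key _ (opp s) (or_introl ysh); rewrite addK => /(_ xI).
    by rewrite (negbTE xW).
  - have := @key _ (opp s) (or_intror yv); rewrite addK => /(_ xI).
    by rewrite (negbTE xW).
  - by have := key _ s (or_introl xsh) yI; rewrite (negbTE yW).
  - case/shiftedP: xsh => xI _ _; case/shiftedP: ysh; rewrite addrAC => yI _ _.
    by have /negP := indI s xI.
  - by have := @key2 _ (opp s) yv; rewrite addK; apply.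
  - by have := key _ s (or_intror xv) yI; rewrite (negbTE yW).
  - exact: key2 xv ysh.
  - by have := vacated_par yv; rewrite par_e (vacated_par xv); case: b.
move=> x xw; have xW := disjointFl (contour_wall cW) xw.
have [_ H] := okP _ _ okI; rewrite -(H x xw) /J !in_setU in_setD xW /=.
have -> : (x \in shifted I) = false by apply/negP => /shiftedP[_ _]; rewrite xW.
have -> : (x \in U) = false by apply/negP => /UV /vW; rewrite xW.
by rewrite !orbF.
Qed.

(** Recovers [I] from its image without knowing [W I]. An occupied site of [S] lies in [W I], since
    its translate is in [F] and ends of boundary edges are empty; a shifted site lies in [F] or in
    [S] according to its parity. *)
Lemma flow_base_decode x : (x \in I) =
  if par x == b then ((x + e t)%R \in flow_base I) && ((x + e t)%R \in S) || (x \in flow_base I) && (x \notin F)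
  else (x \in S) && ((x + e t)%R \in flow_base I) || (x \in flow_base I) && (x \notin S).
Proof.
have inb y : y \in flow_base I = (y \in I) && (y \notin WI) || (y \in shifted I).
  by rewrite /flow_base in_setU in_setD andbC.
have sh y : (y + e t)%R \in shifted I = (y \in I) && (y \in WI).
  apply/idP/andP => [/shiftedP[]|[yI yW]]; first by rewrite addK.
  by apply: imset_f; rewrite inE yI.
have SW y : y \in S -> y \in I -> y \in WI.
  move=> yS yI; apply: contraT => yW; have := @edge _ (opp t) (FW (SF yS)).
  by rewrite addK => /(_ yW)[_ _]; rewrite yI.
have shS y : y \in shifted I -> par y == b -> y \in F.
  case/shiftedP => zI zW _ yb; rewrite -(addK' y t); apply: SF; apply: AS => //.
  by rewrite par_e (eqP yb); case: b.
have shS' y : y \in shifted I -> par y != b -> y \in S.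
  by case/shiftedP => _ _ yW yb; apply: AS.
have nb y : y \in I -> y \in WI -> (y + e t)%R \in WI.
  by move=> yI yW; apply: contraT => H; have [_ /negP[]] := edge yW H.
rewrite !inb !sh; case: (boolP (par x == b)) => xb.
  have [xI|xI] := boolP (x \in I); have [xW|xW] := boolP (x \in WI) => /=.
  - by rewrite orbT AS ?nb // par_e (eqP xb); case: b.
  - rewrite (_ : x \in F = false) ?orbT //; apply/negP => /FW; by rewrite (negbTE xW).
  - apply/esym/negbTE; rewrite negb_or; apply/andP; split.
      rewrite orbF; apply/negP => /andP[/andP[yI yW] yS].
      by rewrite (SW _ yS yI) in yW.
    by apply/negP => /andP[/shS/(_ xb) ->].
  - apply/esym/negbTE; rewrite negb_or; apply/andP; split.
      rewrite orbF; apply/negP => /andP[/andP[yI yW] yS].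
      by rewrite (SW _ yS yI) in yW.
    by apply/negP => /andP[/shS/(_ xb) ->].
have [xI|xI] := boolP (x \in I); have [xW|xW] := boolP (x \in WI) => /=.
- by rewrite orbT andbT AS.
- rewrite (_ : x \in S = false) //=; apply/negP => xS; by rewrite (SW _ xS xI) in xW.
- apply/esym/negbTE; rewrite negb_or; apply/andP; split.
    rewrite orbF; apply/negP => /andP[xS /andP[yI yW]].
    by rewrite (FW (SF xS)) in yW.
  by apply/negP => /andP[/shS'/(_ xb) ->].
- apply/esym/negbTE; rewrite negb_or; apply/andP; split.
    rewrite orbF; apply/negP => /andP[xS /andP[yI yW]].
    by rewrite (FW (SF xS)) in yW.
  by apply/negP => /andP[/shS'/(_ xb) ->].
Qed.
End OneSet.

Local Open Scope ring_scope.

(** At least half of the vacated sites are in [X0 :|: X2] or in [X0 :|: X1], and that half is filled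
    with probability [q]. Treating the two cases separately, with [X1] and [X2] exchanged in the
    second, gives the factor 2. *)
Lemma contour_flow (R : realFieldType) (lam q pr : R) L :
  0 < lam -> 0 <= q -> q < 1 -> 0 <= pr -> pr <= 1 ->
  pr / lam + q / (lam * (1 - q)) <= 1 -> q / (lam * (1 - q)) <= pr ->
  \sum_(I in compatible L) lam ^+ #|I| <=
    2 * (1 - q) ^+ uphalf L * \sum_(J : {set T} | ok b J) lam ^+ #|J|.
Proof.
move=> lam0 q0 q1 pr0 pr1 Hk1 Hk2.
have [/eqP C0|/set0Pn[I1 IC1]] := boolP (compatible L == set0).
  rewrite C0 big_set0; apply: mulr_ge0; last by apply: sumr_ge0 => J _; apply: exprn_ge0; exact: ltW.
  by apply: mulr_ge0 => //; apply: exprn_ge0; rewrite subr_ge0 ltW.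
have X12 : [disjoint X1 & X2].
  rewrite disjoint_subset; apply/subsetP => _ /imsetP[y yS ->].
  by rewrite inE in_setD SF.
have X01 : [disjoint X0 & X1].
  by rewrite disjoint_subset; apply/subsetP => x; rewrite inE => /andP[x1 _]; rewrite inE.
have X02 : [disjoint X0 & X2].
  by rewrite disjoint_subset; apply/subsetP => x; rewrite inE => /andP[_ xF]; rewrite inE in_setD xF.
have inj : {in compatible L &, injective flow_base}.
  by move=> I I' IC IC' E; apply/setP => x; rewrite (flow_base_decode IC) (flow_base_decode IC') E.
pose half2 I := (uphalf L <= #|vacated I :&: (X0 :|: X2)|)%N.
rewrite (bigID half2) /= -mulrA [2]mulr2n mulrDl !mul1r; apply: lerD.
  rewrite (eq_bigl (fun I => I \in [set I in compatible L | half2 I])); last by move=> I; rewrite [RHS]in_set.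
  apply: (@flow_bound R T lam q pr X0 X1 X2 site_rel _ vacated flow_base (ok b)) => //.
  - by move=> I; rewrite in_set => /andP[/X0_vacated].
  - by move=> I; rewrite in_set => /andP[/vacated_X].
  - by move=> I; rewrite in_set => /andP[/vacated_cover].
  - by move=> I; rewrite in_set => /andP[/vacated_minimal2].
  - by move=> I I'; rewrite in_set => /andP[IC _]; rewrite in_set => /andP[IC' _]; apply: inj.
  - by move=> I; rewrite in_set => /andP[/base_vacated].
  - by move=> I; rewrite in_set => /andP[/flow_base_ok].
  - by move=> I; rewrite in_set => /andP[/card_flow_base].
  - by move=> I; rewrite in_set => /andP[_].
rewrite (eq_bigl (fun I => I \in [set I in compatible L | ~~ half2 I])); last by move=> I; rewrite [RHS]in_set.
apply: (@flow_bound R T lam q pr X0 X2 X1 (fun x y => site_rel y x) _ vacated flow_base (ok b)) => //.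
- by rewrite disjoint_sym.
- by move=> I; rewrite in_set => /andP[/X0_vacated].
- by move=> I; rewrite in_set setUAC => /andP[/vacated_X].
- by move=> I; rewrite in_set => /andP[/vacated_cover H _] x y x2 y1 xy; rewrite orbC; apply: H.
- by move=> I; rewrite in_set => /andP[/vacated_minimal1].
- by move=> I I'; rewrite in_set => /andP[IC _]; rewrite in_set => /andP[IC' _]; apply: inj.
- by move=> I; rewrite in_set => /andP[/base_vacated].
- by move=> I; rewrite in_set => /andP[/flow_base_ok].
- by move=> I; rewrite in_set => /andP[/card_flow_base].
- move=> I; rewrite in_set /half2 -ltnNge => /andP[IC H].
  have cV := card_vacated IC.
  have : (#|vacated I| <= #|vacated I :&: (X0 :|: X2)| + #|vacated I :&: (X0 :|: X1)|)%N.
    apply: leq_trans (leq_card_setU _ _).1; rewrite -setIUr; apply/subset_leq_card/subsetP => x xV.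
    rewrite in_setI xV /=; have := subsetP (vacated_X IC) x xV.
    by rewrite !in_setU => /orP[/orP[]|] ->; rewrite ?orbT.
  by rewrite cV; apply: arith_half.
Qed.
End ContourFlow.

Local Open Scope ring_scope.

(** * Finite-volume estimates *)

Section Peierls.
Variables (R : realFieldType) (d p : nat).
Hypothesis p_even : ~~ odd p.
Hypothesis p_gt1 : (1 < p)%N.
Local Notation Zn := 'I_p.+2.
Local Notation T := ('rV[Zn]_d).
Local Notation D := ('I_d * bool)%type.
Local Notation e := (@stp d p).
Local Notation wall := (wall d p).
Local Notation par := (@par d p).
Implicit Types (I J : {set T}) (b : bool) (x v : T) (P Q : pred {set T}).

Definition weight_sum (lam : R) (b : bool) (P : pred {set T}) : R :=
  \sum_(I : {set T} | ok b I && P I) lam ^+ #|I|.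
Definition gibbs (lam : R) (b : bool) (P : pred {set T}) : R :=
  weight_sum lam b P / weight_sum lam b predT.

Definition code_card (d psi l L : nat) : nat :=
  (L * (d.*2 * (d.*2 ^ (walk_length psi l L) * 2 ^ ((walk_length psi l L).+1 * 8))))%N.
Definition peierls_sum (q : R) (d psi l n : nat) : R :=
  \sum_(L < n | (d.*2 <= L + 2)%N) (code_card d psi l L)%:R * (2 * (1 - q) ^+ uphalf L).

Variable lam : R.
Hypothesis lam_gt0 : 0 < lam.

Lemma weight_sum_ge0 b P : 0 <= weight_sum lam b P.
Proof. by apply: sumr_ge0 => I _; apply: exprn_ge0; exact: ltW. Qed.

Lemma ok_evens b : ok b (evens par b).
Proof.
apply/okP; split=> [x t|x _]; rewrite !inE // par_stp // => /eqP ->; by case: b.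
Qed.

Lemma weight_sum_gt0 b : 0 < weight_sum lam b predT.
Proof.
rewrite /weight_sum (bigD1 (evens par b)) ?ok_evens //=.
apply: ltr_pwDl; first exact: exprn_gt0.
by apply: sumr_ge0 => I _; apply: exprn_ge0; exact: ltW.
Qed.

Lemma gibbs_ge0 b P : 0 <= gibbs lam b P.
Proof. by apply: divr_ge0; apply: weight_sum_ge0. Qed.

Lemma gibbsT b : gibbs lam b predT = 1.
Proof. by rewrite /gibbs divff // gt_eqF // weight_sum_gt0. Qed.

Lemma gibbsD b P Q : gibbs lam b P = gibbs lam b (predI P Q) + gibbs lam b (predI P (predC Q)).
Proof.
rewrite /gibbs -mulrDl; congr (_ / _); rewrite /weight_sum (bigID Q) /=.
by congr (_ + _); apply: eq_bigl => I; rewrite -andbA.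
Qed.

Lemma eq_gibbs b P Q : (forall I, ok b I -> P I = Q I) -> gibbs lam b P = gibbs lam b Q.
Proof.
move=> PQ; congr (_ / _); apply: eq_bigl => I; case: (boolP (ok b I)) => //= /PQ; by [].
Qed.

Lemma gibbs_sub b P Q : (forall I, ok b I -> P I -> Q I) -> gibbs lam b P <= gibbs lam b Q.
Proof.
move=> PQ; apply: ler_wpM2r; first by rewrite invr_ge0 weight_sum_ge0.
rewrite /weight_sum [X in _ <= X](bigID P) /= -[X in X <= _]addr0; apply: lerD.
  rewrite (eq_bigl (fun I => ok b I && Q I && P I)) // => I.
  by have := PQ I; case: (ok b I) => //= H; case: (P I) H; rewrite ?andbF // => ->.
by apply: sumr_ge0 => I _; apply: exprn_ge0; exact: ltW.
Qed.

Lemma gibbs_union b P (K : finType) (Q : K -> pred {set T}) :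
  (forall I, ok b I -> P I -> [exists k, Q k I]) -> gibbs lam b P <= \sum_k gibbs lam b (Q k).
Proof.
move=> PQ; rewrite /gibbs -mulr_suml; apply: ler_wpM2r; first by rewrite invr_ge0 weight_sum_ge0.
have w0 I : 0 <= lam ^+ #|I| by apply: exprn_ge0; exact: ltW.
rewrite /weight_sum (exchange_big_dep (fun I => ok b I)) /=; last by move=> k I _ /andP[].
rewrite [X in _ <= X](bigID P) /= -[X in X <= _]addr0; apply: lerD; last first.
  by apply: sumr_ge0 => I _; apply: sumr_ge0.
apply: ler_sum => I /andP[okI /(PQ I okI)/existsP[k Qk]].
by rewrite (bigD1 k) ?okI //= lerDl; apply: sumr_ge0.
Qed.

(** Adding [v] is a bijection between the two events. This one-site identity is all that is carried
    over to infinite volume. *)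
Lemma gibbs_flip b v Q : v \notin wall -> (forall I, Q (v |: I) = Q I) ->
  (forall I, Q I -> forall t, v + e t \notin I) ->
  gibbs lam b (fun I => (v \in I) && Q I) = lam * gibbs lam b (fun I => (v \notin I) && Q I).
Proof.
move=> vw Qv Qfree; rewrite /gibbs mulrA; congr (_ / _); rewrite /weight_sum mulr_sumr.
rewrite [LHS](reindex_onto (fun I : {set T} => v |: I) (fun I => I :\ v)) /=; last first.
  by move=> I /and3P[_ vI _]; rewrite setD1K.
apply: eq_big => [I|I]; last first.
  move=> /andP[_ /eqP E]; have vI : v \notin I by rewrite -E setD11.
  by rewrite cardsU1 vI exprS.
have [vI|vI] := boolP (v \in I).
  rewrite /= andbF; apply/negbTE; rewrite negb_and; apply/orP; right.
  by apply/eqP => /setP/(_ v); rewrite !inE eqxx vI.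
rewrite setU11 setU1K // eqxx !andbT /= Qv.
have [/Qfree fI|] := boolP (Q I); last by rewrite !andbF.
have vt t : (v + e t == v) = false.
  by apply/negP => /eqP E; have := par_stp p_even v t; rewrite E; case: (par v).
rewrite !andbT; apply/idP/idP => [okU|okI].
  case/okP: okU => indU wU; apply/okP; split=> [x t xI|x xw].
    have := indU x t; rewrite in_setU1 xI orbT => /(_ isT); by rewrite in_setU1 negb_or => /andP[].
  by rewrite -wU // in_setU1; case: eqP xw vw => [->->|].
case/okP: okI => indI wI; apply/okP; split.
  move=> x t; rewrite !in_setU1 negb_or => /orP[/eqP ->|xI]; first by rewrite vt fI.
  rewrite indI // andbT; apply: contraNneq (fI (opp t)) => <-.
  by rewrite (addeK (@stpN d p)).
by move=> x xw; rewrite in_setU1 wI //; case: eqP xw vw => [->->|].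
Qed.

Variables (i0 i1 : 'I_d).
Hypothesis i01 : i1 != i0.
Variables (psi l : nat) (q pr : R).
Hypothesis d_ge4 : (4 <= d)%N.
Hypothesis psi_gt0 : (0 < psi)%N.
Hypothesis psi_led : (psi <= d)%N.
Hypothesis psi_sq : (psi * psi <= d * l)%N.
Hypothesis l_gt0 : (0 < l)%N.
Hypothesis l_large : (d.*2 <= 2 ^ l.+1)%N.
Hypothesis q_ge0 : 0 <= q.
Hypothesis q_lt1 : q < 1.
Hypothesis pr_ge0 : 0 <= pr.
Hypothesis pr_le1 : pr <= 1.
Hypothesis pr_q : pr / lam + q / (lam * (1 - q)) <= 1.
Hypothesis q_pr : q / (lam * (1 - q)) <= pr.

(** A union bound over codes: if [v] is occupied, [I] is compatible with the pair decoded from some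
    code for its excess, and the flow bounds the weight of all sets compatible with one pair. *)
Lemma gibbs_odd b v : par v = ~~ b -> gibbs lam b (fun I => v \in I) <= peierls_sum q d psi l #|T|.+1.
Proof.
move=> vb; rewrite ler_pdivrMr ?weight_sum_gt0 //.
pose W I := contour_of b v I.
have Wc I : ok b I -> v \in I -> contour b v (W I) by move=> okI vI; apply: (contour_of_contour p_even i0).
have We I x s : ok b I -> v \in I -> x \in W I -> x + e s \notin W I ->
    [/\ par x = b, x \notin I & x + e s \notin I].
  by move=> okI vI xW yW; have [_] := contour_of_edge p_even okI vI vb xW yW.
pose dec L (c : contour_code d psi l L) := contour_decode i0 b v c.
pose good L (c : contour_code d psi l L) := [forall y in (dec L c).1.2, y + e (dec L c).2 \in (dec L c).1.1].
pose comp L (c : contour_code d psi l L) := compatible b v (dec L c).1.1 (dec L c).1.2 W L.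
have step L (c : contour_code d psi l L) : good L c ->
    \sum_(I in comp L c) lam ^+ #|I| <= 2 * (1 - q) ^+ uphalf L * weight_sum lam b predT.
  move=> /forall_inP SF; rewrite /weight_sum.
  rewrite [X in _ <= _ * X](eq_bigl (fun I : {set T} => ok b I)); last by move=> I; rewrite andbT.
  exact: (@contour_flow d p p_even i0 i1 i01 b v _ _ _ SF W Wc We R lam q pr L).
have step2 (L : nat) : \sum_(c : contour_code d psi l L | good L c) \sum_(I in comp L c) lam ^+ #|I| <=
    (code_card d psi l L)%:R * (2 * (1 - q) ^+ uphalf L) * weight_sum lam b predT.
  apply: (@le_trans _ _ (\sum_(c : contour_code d psi l L) 2 * (1 - q) ^+ uphalf L * weight_sum lam b predT)).
    have H0 : 0 <= 2 * (1 - q) ^+ uphalf L * weight_sum lam b predT.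
      apply: mulr_ge0; last exact: weight_sum_ge0.
      by apply: mulr_ge0 => //; apply: exprn_ge0; rewrite subr_ge0 ltW.
    rewrite [X in _ <= X](bigID (good L)) /= -[X in X <= _]addr0; apply: lerD.
      by apply: ler_sum => c; apply: step.
    by apply: sumr_ge0.
  by rewrite sumr_const card_contour_code -/(code_card d psi l L) -[X in X <= _]mulr_natl mulrA.
rewrite /peierls_sum mulr_suml.
apply: le_trans (ler_sum _ (fun (L : 'I_#|T|.+1) _ => step2 L)).
rewrite [X in _ <= X](eq_bigr (fun L : 'I_#|T|.+1 => \sum_(I : {set T} | ok b I && (v \in I))
    \sum_(c : contour_code d psi l L | good L c && (I \in comp L c)) lam ^+ #|I|)); last first.
  move=> L _; rewrite (exchange_big_dep (fun I => ok b I && (v \in I))) //=.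
  by move=> c I _; rewrite inE => /and4P[-> ->].
rewrite exchange_big /= /weight_sum; apply: ler_sum => I /andP[okI vI].
have cI := Wc I okI vI.
have [c /= [sw sh]] := contour_approximation p_even p_gt1 i01 cI d_ge4 psi_gt0 psi_led psi_sq l_gt0 l_large.
have Lb : (excess b (W I) < #|T|.+1)%N.
  by rewrite ltnS; apply: leq_trans (leq_subr _ _) (max_card _).
rewrite (bigD1 (Ordinal Lb)) /=; last by apply: (excess_ge p_even p_gt1 i0 cI).
rewrite (bigD1 c) /=; last first.
  apply/andP; split; first by apply/forall_inP.
  by rewrite inE okI vI eqxx andbT.
rewrite -addrA lerDl; apply: addr_ge0; apply: sumr_ge0 => *; last apply: sumr_ge0 => *; apply: exprn_ge0; exact: ltW.
Qed.

(** With empty neighbours, [v] is occupied with conditional probability [lam / (1 + lam)]; the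
    neighbours are odd, so each is occupied with probability at most [eps]. *)
Lemma gibbs_even b v eps : v \notin wall -> par v = b ->
  (forall u, par u = ~~ b -> gibbs lam b (fun I => u \in I) <= eps) ->
  lam / (1 + lam) * (1 - d.*2%:R * eps) <= gibbs lam b (fun I => v \in I).
Proof.
move=> vw vb Heps.
pose free I := [forall t, v + e t \notin I].
have lam1 : 0 < 1 + lam by apply: addr_gt0.
have okv I : ok b I -> v \in I -> free I.
  by case/okP => H _ vI; apply/forallP => t; apply: H.
have vt t : (v + e t == v) = false.
  by apply/negP => /eqP E; have := par_stp p_even v t; rewrite E; case: (par v).
have flip : gibbs lam b (fun I => v \in I) = lam * gibbs lam b (fun I => (v \notin I) && free I).
  rewrite -gibbs_flip //; last by move=> I /forallP.
    by apply: eq_gibbs => I okI; case: (boolP (v \in I)) => // /(okv I okI) ->.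
  by move=> I; apply: eq_forallb => t; rewrite in_setU1 vt.
have E1 : gibbs lam b free = gibbs lam b (fun I => v \in I) * ((1 + lam) / lam).
  rewrite (gibbsD b free (fun I => v \in I)).
  have -> : gibbs lam b (predI free (fun I => v \in I)) = gibbs lam b (fun I => v \in I).
    by apply: eq_gibbs => I okI /=; case: (boolP (v \in I)) => [/(okv I okI) ->|]; rewrite ?andbF.
  have -> : gibbs lam b (predI free (predC (fun I => v \in I))) = gibbs lam b (fun I => v \in I) / lam.
    by rewrite flip mulrAC divff ?gt_eqF // mul1r; apply: eq_gibbs => I _ /=; rewrite andbC.
  by field; rewrite gt_eqF.
have E2 : 1 - d.*2%:R * eps <= gibbs lam b free.
  rewrite -[X in X - _](gibbsT b) (gibbsD b predT free) lerBlDr lerD2l.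
  apply: (@le_trans _ _ (\sum_(t : D) gibbs lam b (fun I => v + e t \in I))).
    apply: gibbs_union => I _ /=; rewrite negb_forall => /existsP[t]; rewrite negbK => H.
    by apply/existsP; exists t.
  rewrite -card_dir mulr_natl -sumr_const; apply: ler_sum => t _; apply: Heps.
  by rewrite par_stp // vb.
rewrite mulrC; apply: le_trans (ler_wpM2r _ E2) _; first by apply: divr_ge0; exact: ltW.
rewrite E1 -mulrA (_ : (1 + lam) / lam * (lam / (1 + lam)) = 1) ?mulr1 //.
by field; rewrite !gt_eqF.
Qed.
End Peierls.


From mathcomp Require Import finmap.
Require Import Defs.
From mathcomp Require Import all_classical all_reals all_analysis measurable_realfun.
Import numFieldNormedType.Exports.
Local Open Scope classical_set_scope.
Local Open Scope ring_scope.

Lemma leq_uphalf2 n : (n <= uphalf n * 2)%N.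
Proof. lia. Qed.

(** * Summing the Peierls series *)

Section Numeric.
Variable R : realType.
Implicit Types (x y z : R).

Lemma pow2_le_expR n : (2 : R) ^+ n <= expR n%:R.
Proof.
rewrite -[n%:R]mulr1 expRM_natl; apply: lerXn2r; rewrite ?nnegrE ?expR_ge0 //.
by have := expR_ge1Dx (1 : R).
Qed.

Lemma pow1B_le_expR q k : 0 <= q -> q <= 1 -> (1 - q) ^+ k <= expR (- (k%:R * q)) :> R.
Proof.
move=> q0 q1; rewrite -mulrN expRM_natl; apply: lerXn2r; rewrite ?nnegrE ?expR_ge0 ?subr_ge0 //.
exact: expR_ge1Dx.
Qed.

Lemma expRN_le_pow z n : 0 < z -> expR (- z) <= (n.+1%:R / z) ^+ n.+1.
Proof.
move=> z0; rewrite expRN -invf_div exprVn lef_pV2 ?posrE ?expR_gt0 ?exprn_gt0 ?divr_gt0 //.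
have -> : expR z = expR (z / n.+1%:R) ^+ n.+1.
  by rewrite -expRM_natl mulrC mulfVK // pnatr_eq0.
apply: lerXn2r; rewrite ?nnegrE ?expR_ge0 //; first by apply: divr_ge0 => //; exact: ltW.
by apply: le_trans (expR_ge1Dx _); rewrite lerDr.
Qed.

Section Term.
Variables (d psi l L : nat) (y mu : R).
Hypothesis d_gt0 : (0 < d)%N.
Hypothesis l_gt0 : (0 < l)%N.
Hypothesis psi_gt0 : (0 < psi)%N.
Hypothesis dl : (d <= 2 ^ l)%N.
Hypothesis dL : (d <= L)%N.
Hypothesis y_gt0 : 0 < y.
Hypothesis l2_le : (l * l)%:R <= 16 * y * psi%:R.
Hypothesis dy : 1 <= d%:R * y ^+ 2.
Hypothesis mu_y : 2 ^+ 26 * y <= mu.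
Hypothesis mu1 : mu <= 1.

Let n := walk_length psi l L.
(** Up to polynomial factors, [expR z] bounds the number of codes and [expR (- (z + z))] the flow
    factor, which leaves [expR (- z)]. *)
Let z := 2 ^+ 21 * y * L%:R.

(** A step of the walk costs [d.*2 * 2 ^ 8 <= 2 ^ (10 * l)], and there are at most
    [8 * 822 * l * L / psi] steps. By [l2_le] the exponent is at most [80 * 822 * 16] times [y * L],
    and this constant is below [2 ^ 21]. *)
Lemma code_card_le : (code_card d psi l L)%:R <= 2 ^+ 9 * L%:R * d%:R * expR z.
Proof.
have H1 : (code_card d psi l L <= 2 ^ 9 * L * d * 2 ^ (10 * l * n))%N.
  rewrite /code_card -/n mulSn expnD.
  have H2 : ((d.*2 * 2 ^ 8) ^ n <= 2 ^ (10 * l * n))%N.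
    have [->|n0] := posnP n; first by rewrite muln0 !expn0.
    rewrite expnM leq_exp2r //; apply: (@leq_trans (2 ^ (l.+1) * 2 ^ 8)%N).
      by rewrite leq_mul2r /= expnS -mul2n leq_mul2l.
    by rewrite -expnD leq_exp2l //; lia.
  rewrite expnMn -(expnM 2 8) [(8 * n)%N]mulnC in H2.
  have H3 := leq_mul (leqnn (2 ^ 9 * L * d)%N) H2.
  apply: leq_trans H3; rewrite -[d.*2]mul2n; set u := (_ ^ n)%N; set v := (2 ^ (n * 8))%N.
  rewrite (_ : 2 ^ 9 = 2 * 2 ^ 8)%N //; set w := (2 ^ 8)%N; lia.
have H4 : (2 ^ 9 * L * d * 2 ^ (10 * l * n))%:R <= 2 ^+ 9 * L%:R * d%:R * expR z.
  rewrite natrM natrX [X in X * _]natrM [(2 ^ 9 * L)%:R]natrM natrX; apply: ler_wpM2l.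
    by apply: mulr_ge0 => //; apply: mulr_ge0 => //; apply: exprn_ge0.
  apply: le_trans (pow2_le_expR _) _; rewrite ler_expR /z.
  have psi0 : 0 < psi%:R :> R by rewrite ltr0n.
  rewrite -(ler_pM2r psi0).
  have H5 : (10 * l * n * psi <= 2 ^ 7 * l * (2 ^ 10 * l * L))%N.
    rewrite /n /walk_length.
    have := leq_trunc_div (822 * l * L) psi.
    set k := (_ %/ psi)%N => H.
    have H6 : (80 * l * (822 * l * L) <= 2 ^ 7 * l * (2 ^ 10 * l * L))%N by rewrite !leq_mul.
    apply: leq_trans H6; have := leq_mul (leqnn (80 * l)%N) H.
    set w := (822 * l * L)%N; lia.
  apply: (@le_trans _ _ ((2 ^ 7 * l * (2 ^ 10 * l * L))%:R)); first by rewrite -natrM ler_nat.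
  have -> : (2 ^ 7 * l * (2 ^ 10 * l * L))%:R = 2 ^+ 17 * ((l * l)%:R * L%:R) :> R.
    rewrite -[17%N]/(7 + 10)%N exprD -!(natrX R 2); set a := (2 ^ 7)%N; set c := (2 ^ 10)%N.
    by rewrite !natrM; ring.
  have L0 : 0 <= L%:R :> R by [].
  have p17 : 0 <= 2 ^+ 17 :> R by apply: exprn_ge0.
  apply: le_trans (ler_wpM2l p17 (ler_wpM2r L0 l2_le)) _.
  rewrite -[21%N]/(17 + 4)%N exprD (_ : 2 ^+ 4 = 16 :> R); last by rewrite -natrX.
  by set a := 2 ^+ 17; rewrite le_eqVlt; apply/orP; left; apply/eqP; ring.
apply: le_trans H4; by rewrite ler_nat.
Qed.

Lemma term_le : (code_card d psi l L)%:R * (2 * (1 - mu / 8) ^+ uphalf L) <=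
  (64 * d%:R ^+ 2)^-1 * (L%:R * L.+1%:R)^-1.
Proof.
have L_gt0 : (0 < L)%N by apply: leq_trans dL.
have LR : 0 < L%:R :> R by rewrite ltr0n.
have dR : 0 < d%:R :> R by rewrite ltr0n.
have mu0 : 0 <= mu by apply: le_trans mu_y; apply: mulr_ge0; [apply: exprn_ge0|exact: ltW].
have z0 : 0 < z by rewrite /z !mulr_gt0 // exprn_gt0.
have H1 : (1 - mu / 8) ^+ uphalf L <= expR (- (z + z)).
  have q0 : 0 <= mu / 8 by apply: divr_ge0.
  have q1 : mu / 8 <= 1 by rewrite ler_pdivrMr // mul1r; apply: le_trans mu1 _; rewrite (ler_nat R 1 8).
  apply: le_trans (pow1B_le_expR _ q0 q1) _.
  rewrite ler_expR lerN2.
  have H : L%:R / 2 <= (uphalf L)%:R :> R.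
    by rewrite ler_pdivrMr // -natrM ler_nat leq_uphalf2.
  apply: le_trans (ler_wpM2r q0 H).
  have := ler_wpM2r (ltW LR) mu_y; rewrite /z (_ : (2 : R) ^+ 26 = 2 ^+ 21 * 2 ^+ 5); last by rewrite -exprD.
  have -> : (2 : R) ^+ 5 = 32 by rewrite -natrX.
  move: (2 ^+ 21 : R) => w H'; apply: le_trans (_ : w * 32 * y * L%:R / 16 <= _).
    by rewrite le_eqVlt; apply/orP; left; apply/eqP; field.
  apply: le_trans (ler_wpM2r _ H') _; first by rewrite invr_ge0.
  by rewrite le_eqVlt; apply/orP; left; apply/eqP; field.
(* The 14th power, with [z ^+ 2] at least [2 ^ 42 * L ^ 2 / d] by [dy], leaves a constant times
   [d ^ 8 / L ^ 13] after the polynomial factors. As [d <= L], this is of order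
   [d ^ (-2) * L ^ (-2)] or smaller. *)
have H2 : expR (- z) <= (2 ^+ 28)^-1 * d%:R ^+ 7 / L%:R ^+ 14.
  apply: le_trans (expRN_le_pow 13 z0) _.
  have z2 : (14 / z) ^+ 2 <= 16^-1 * (d%:R / L%:R ^+ 2).
    rewrite expr_div_n ler_pdivrMr ?exprn_gt0 // -mulrA.
    have -> : d%:R / L%:R ^+ 2 * z ^+ 2 = (2 ^+ 21) ^+ 2 * (d%:R * y ^+ 2).
      by rewrite /z; set a := 2 ^+ 21; field; rewrite gt_eqF.
    have H : 2 ^+ 12 <= (2 ^+ 21) ^+ 2 :> R by rewrite -exprM ler_weXn2l // ler1n.
    have E12 : 2 ^+ 12 = 64 * 64 :> R by rewrite -[12%N]/(6 + 6)%N exprD -natrX.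
    have := ler_pM (exprn_ge0 2 (exprn_ge0 21 (ler0n R 2))) ler01 (lexx _) dy.
    rewrite mulr1; move: H; rewrite E12; set A := (2 ^+ 21) ^+ 2; set B := A * _; lra.
  rewrite -[14%N]/(2 * 7)%N exprM.
  have e0 : 0 <= (14 / z) ^+ 2 by rewrite exprn_even_ge0.
  have H7 : ((14 / z) ^+ 2) ^+ 7 <= (16^-1 * (d%:R / L%:R ^+ 2)) ^+ 7.
    apply: lerXn2r => //; rewrite nnegrE.
    by apply: le_trans z2.
  apply: le_trans H7 _; rewrite exprMn expr_div_n -exprM (_ : (16^-1 : R) ^+ 7 = (2 ^+ 28)^-1); last first.
    by rewrite exprVn -[28%N]/(4 * 7)%N exprM; congr (_ ^+ _)^-1; rewrite -natrX.
  by rewrite mulrA.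
have cc := code_card_le.
have p9 : 0 <= 2 ^+ 9 * L%:R * d%:R :> R by rewrite !mulr_ge0 // exprn_ge0.
have H3 : (code_card d psi l L)%:R * (2 * (1 - mu / 8) ^+ uphalf L) <=
    2 ^+ 9 * L%:R * d%:R * 2 * expR (- z).
  apply: (@le_trans _ _ (2 ^+ 9 * L%:R * d%:R * expR z * (2 * expR (- (z + z))))).
    apply: ler_pM => //; last by apply: ler_wpM2l.
    by apply: mulr_ge0 => //; apply: exprn_ge0; rewrite subr_ge0 ler_pdivrMr // mul1r; apply: le_trans mu1 _; rewrite (ler_nat R 1 8).
  rewrite opprD expRD; have E : expR z * expR (- z) = 1 by rewrite -expRD addrN expR0.
  rewrite (_ : _ * _ = 2 ^+ 9 * L%:R * d%:R * 2 * expR (- z) * (expR z * expR (- z))); last by set a := 2 ^+ 9; ring.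
  by rewrite E mulr1.
apply: le_trans H3 _.
have p92 : 0 <= 2 ^+ 9 * L%:R * d%:R * 2 :> R by apply: mulr_ge0.
apply: le_trans (ler_wpM2l p92 H2) _.
rewrite -invfM -[X in _ <= X]mul1r ler_pdivlMr; last by rewrite !mulr_gt0 ?exprn_gt0 // ltr0n.
have LS : L.+1%:R <= 2 * L%:R :> R by rewrite -natrM ler_nat mul2n -addnn -addn1 leq_add2l.
have H4 : 64 * d%:R ^+ 2 * (L%:R * L.+1%:R) <= 128 * d%:R ^+ 2 * L%:R ^+ 2 :> R.
  have -> : 128 * d%:R ^+ 2 * L%:R ^+ 2 = 64 * d%:R ^+ 2 * (L%:R * (2 * L%:R)) :> R by ring.
  by apply: ler_wpM2l; [rewrite mulr_ge0 // exprn_ge0|apply: ler_wpM2l].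
set c := 2 ^+ 9 * _ * _ * _ * _; have c0 : 0 <= c.
  by rewrite /c !mulr_ge0 // ?invr_ge0 ?exprn_ge0.
apply: le_trans (ler_wpM2l c0 H4) _.
have -> : c * (128 * d%:R ^+ 2 * L%:R ^+ 2) = (2 ^+ 9 * 2 * 128) / 2 ^+ 28 * (d%:R ^+ 10 / L%:R ^+ 11).
  by rewrite /c; set a := 2 ^+ 9; set b := 2 ^+ 28; field; rewrite gt_eqF // gt_eqF // exprn_gt0.
apply: mulr_ile1.
- by rewrite !mulr_ge0 // ?invr_ge0 ?exprn_ge0.
- by rewrite mulr_ge0 // ?invr_ge0 ?exprn_ge0.
- rewrite ler_pdivrMr ?exprn_gt0 // mul1r (_ : 2 ^+ 9 * 2 * 128 = 2 ^+ 17 :> R).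
    by rewrite ler_weXn2l // ler1n.
  by rewrite -[17%N]/(9 + 1 + 7)%N !exprD expr1; congr (_ * _); rewrite -natrX.
rewrite ler_pdivrMr ?exprn_gt0 // mul1r.
apply: (@le_trans _ _ (L%:R ^+ 10)).
  by apply: lerXn2r; rewrite ?nnegrE // ler_nat.
by rewrite ler_weXn2l // ler1n.
Qed.
End Term.

Lemma sum_telescope (n : nat) : \sum_(L < n) (L%:R * L.+1%:R)^-1 <= 1 :> R.
Proof.
(* The term [L = 0] vanishes because the inverse of 0 is 0. *)
suff -> : \sum_(L < n) (L%:R * L.+1%:R)^-1 = if n is n'.+1 then 1 - n%:R^-1 else 0 :> R.
  by case: n => // n; rewrite gerBl invr_ge0.
elim: n => [|n IH]; first by rewrite big_ord0.
rewrite big_ord_recr /= IH; case: n {IH} => [|n]; first by rewrite mul0r invr0 invr1 subrr addr0.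
by field; rewrite nat1r -(natrD _ 2) !pnatr_eq0 addn_eq0.
Qed.

Lemma peierls_sum_le (d psi l n : nat) (y mu : R) :
  (2 <= d)%N -> (0 < l)%N -> (0 < psi)%N -> (d <= 2 ^ l)%N -> 0 < y ->
  (l * l)%:R <= 16 * y * psi%:R -> 1 <= d%:R * y ^+ 2 -> 2 ^+ 26 * y <= mu -> mu <= 1 ->
  peierls_sum (mu / 8) d psi l n <= (64 * d%:R ^+ 2)^-1.
Proof.
move=> d2 l0 p0 dl y0 H1 H2 H3 H4.
have c0 : 0 <= (64 * d%:R ^+ 2)^-1 :> R by rewrite invr_ge0 mulr_ge0 // exprn_ge0.
apply: (@le_trans _ _ (\sum_(L < n) (64 * d%:R ^+ 2)^-1 * (L%:R * L.+1%:R)^-1)).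
  rewrite [X in _ <= X](bigID (fun L : 'I_n => (d.*2 <= L + 2)%N)) /= -[X in X <= _]addr0; apply: lerD.
    apply: ler_sum => L dL; apply: (@term_le d psi l L y mu) => //; lia.
  by apply: sumr_ge0 => L _; apply: mulr_ge0 => //; rewrite invr_ge0 mulr_ge0.
rewrite -mulr_sumr -[X in _ <= X]mulr1; apply: ler_wpM2l => //.
exact: sum_telescope.
Qed.
End Numeric.

Lemma nat_sqrt_exists n : exists s : nat, (s * s <= n)%N && (n < s.+1 * s.+1)%N.
Proof.
have ex : exists s, (s * s <= n)%N by exists 0%N.
have bd s : (s * s <= n)%N -> (s <= n)%N by case: s => // s; nia.
case: (ex_maxnP ex bd) => s sn smax; exists s; rewrite sn /= ltnNge.
by apply/negP => /smax; rewrite ltnn.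
Qed.

Lemma leq_succ_sq n : (0 < n)%N -> (n.+1 * n.+1 <= 4 * (n * n))%N.
Proof. nia. Qed.

(** * Choice of the parameters *)

Section Asymptotics.
Variable R : realType.
Implicit Types (lam : R).

Definition threshold (d : nat) : R := d%:R `^ (- (1 / 4)) * (ln d%:R) `^ (3 / 4).

Lemma threshold_pow4 d : (0 < d)%N -> 0 <= ln d%:R :> R ->
  (threshold d ^+ 2) ^+ 2 = ln d%:R ^+ 3 / d%:R.
Proof.
move=> d0 L0; rewrite -exprM /threshold exprMn.
rewrite -!powR_mulrn ?powR_ge0 // -!powRrM.
have -> : - (1 / 4) * (2 * 2)%:R = - 1 :> R by field.
have -> : 3 / 4 * (2 * 2)%:R = 3%:R :> R by field.
by rewrite powR_inv1 // mulrC powR_mulrn.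
Qed.

Lemma expR_half_le2 : expR (2^-1 : R) <= 2.
Proof.
rewrite -[2^-1]opprK expRN -[leRHS]invrK lef_pV2 ?posrE ?expR_gt0 //.
apply: le_trans (expR_ge1Dx _); lra.
Qed.

Lemma up_log_le d : (4 <= d)%N -> 1 <= ln d%:R :> R -> (up_log 2 d)%:R <= 3 * ln d%:R :> R.
Proof.
move=> d4 L1; have d0 : 0 < d%:R :> R by rewrite ltr0n (leq_trans _ d4).
have d1 : (1 < d)%N by apply: leq_trans d4.
have /andP[H _] := up_log_bounds (ltnSn 1) d1.
have l0 : (0 < up_log 2 d)%N by rewrite up_log_gt0.
set l := up_log 2 d in H l0 *; rewrite -(prednK l0); set k := l.-1 in H *.
have H2 : expR (k%:R * 2^-1) <= d%:R :> R.
  rewrite expRM_natl; apply: (@le_trans _ _ (2 ^+ k)).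
    by apply: lerXn2r; rewrite ?nnegrE ?expR_ge0 // expR_half_le2.
  by rewrite -natrX ler_nat ltnW.
have : k%:R * 2^-1 <= ln d%:R :> R by rewrite -ler_expR lnK ?posrE.
rewrite -[k.+1%:R]natr1; move: (k%:R) (ln d%:R) L1 => kk ll L1 H3; lra.
Qed.

Lemma large_ln (K : R) : exists d0 : nat, (4 <= d0)%N /\ forall d : nat, (d0 <= d)%N -> K <= ln d%:R.
Proof.
exists (maxn 4 (Num.truncn (expR K)).+1); split; first exact: leq_maxl.
move=> d; rewrite geq_max => /andP[d4 dK].
rewrite -ler_expR lnK; last by rewrite posrE ltr0n (leq_trans _ d4).
by apply: ltW; apply: lt_le_trans (truncnS_gt _) _; rewrite ler_nat.
Qed.

(** [psi] is the integer square root of [d * l], with [l] the binary logarithm of [d] rounded up.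
    For [m] the minimum of [lam] and 1, the probabilities are [q = m ^+ 2 / 8] and [pr = m / 2]; the
    truncation keeps them below 1 when [lam] is large. *)
Lemma peierls_parameters : exists (C : R) (d0 : nat), [/\ 0 < C, (4 <= d0)%N &
  forall (d : nat) lam, (d0 <= d)%N -> C * threshold d < lam ->
  exists (psi l : nat) (q pr : R),
  [/\ [/\ (0 < psi)%N, (psi <= d)%N, (psi * psi <= d * l)%N, (0 < l)%N & (d.*2 <= 2 ^ l.+1)%N],
      [/\ 0 < lam, 0 <= q, q < 1, 0 <= pr & pr <= 1],
      pr / lam + q / (lam * (1 - q)) <= 1, q / (lam * (1 - q)) <= pr &
      forall n, peierls_sum q d psi l n <= (64 * d%:R ^+ 2)^-1] /\
  (64 * d%:R ^+ 2)^-1 < lam / (1 + lam) * (1 - d.*2%:R * (64 * d%:R ^+ 2)^-1)].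
Proof.
(* [60 = 26 * 2 + 8] is what [ysmall] needs: [2 ^+ 52] times the cube of [ln d] must be at most its
   fourth power over [2 ^+ 8]. *)
have [d0 [d04 Hd0]] := large_ln (2 ^+ 60).
(* Its square is the constant [2 ^+ 26] relating [mu] to [y]. *)
exists (2 ^+ 13), d0; split; rewrite ?exprn_gt0 //.
move=> d lam dd0 Hlam.
have d4 : (4 <= d)%N by apply: leq_trans dd0.
have dR : 0 < d%:R :> R by rewrite ltr0n (leq_trans _ d4).
have d1R : 1 <= d%:R :> R by rewrite ler1n (leq_trans _ d4).
pose Ln : R := ln d%:R.
have Lbig : 2 ^+ 60 <= Ln by apply: Hd0.
have L1 : 1 <= Ln by apply: le_trans Lbig; rewrite exprn_ege1 // ler1n.
have L0 : 0 <= Ln by apply: le_trans L1.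
pose g := threshold d; pose y := g ^+ 2.
have yE : y = g ^+ 2 by [].
have g0 : 0 < g by rewrite /g /threshold mulr_gt0 // powR_gt0 // (lt_le_trans _ L1).
have y0 : 0 < y by rewrite /y exprn_gt0.
have y2 : y ^+ 2 = Ln ^+ 3 / d%:R by apply: threshold_pow4 => //; apply: leq_trans d4.
rewrite -/g in Hlam; clearbody y; clearbody g.
have dy2 : d%:R * y ^+ 2 = Ln ^+ 3 by rewrite y2 mulrC divfK // gt_eqF.
have dy : 1 <= d%:R * y ^+ 2 by rewrite dy2 exprn_ege1.
have dL4 : Ln ^+ 4 / 256 <= d%:R.
  have <- : expR Ln = d%:R by rewrite lnK ?posrE.
  have -> : expR Ln = expR (Ln / 4) ^+ 4 by rewrite -expRM_natl; congr expR; field.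
  have -> : Ln ^+ 4 / 256 = (Ln / 4) ^+ 4 by field.
  apply: lerXn2r; rewrite ?nnegrE ?expR_ge0 ?divr_ge0 //.
  by apply: le_trans (expR_ge1Dx _); rewrite lerDr.
have ysmall : 2 ^+ 26 * y <= 1.
  suff : (2 ^+ 26 * y) ^+ 2 <= 1 by rewrite expr_le1 // mulr_ge0 ?exprn_ge0 // ltW.
  rewrite exprMn -exprM y2.
  rewrite mulrA ler_pdivrMr // mul1r; apply: le_trans dL4.
  have -> : Ln ^+ 4 / 256 = Ln ^+ 3 * (Ln / 256) by field.
  rewrite mulrC; apply: ler_wpM2l; first exact: exprn_ge0.
  rewrite ler_pdivlMr ?ltr0n //; apply: le_trans Lbig.
  by rewrite -[60%N]/(26 * 2 + 8)%N exprD; apply: ler_wpM2l; [exact: exprn_ge0|rewrite -natrX].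
pose l := up_log 2 d.
have d1 : (1 < d)%N by apply: leq_trans d4.
have l0 : (0 < l)%N by rewrite up_log_gt0.
have l2 : (d <= 2 ^ l)%N by apply: up_logP.
have ld : (l <= d)%N by apply: up_log_min => //; apply/ltnW/ltn_expl.
have [psi /andP[psi1 psi2]] := nat_sqrt_exists (d * l).
have psi0 : (0 < psi)%N.
  by rewrite lt0n; apply: contraTneq psi2 => ->; rewrite -leqNgt muln_gt0 (ltnW d1) l0.
have psid : (psi <= d)%N.
  have : (psi * psi <= d * d)%N by apply: leq_trans psi1 _; rewrite leq_mul2l ld orbT.
  by rewrite !mulnn leq_exp2r.
have l3 : l%:R <= 3 * Ln by apply: up_log_le.
have l2_le : (l * l)%:R <= 16 * y * psi%:R :> R.
  have r0 : 0 <= 16 * y * psi%:R by apply: mulr_ge0 => //; apply: mulr_ge0 => //; exact: ltW.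
  rewrite -(@ler_pXn2r _ 2) ?nnegrE // !exprMn y2.
  have H4 : d%:R * l%:R <= 4 * psi%:R ^+ 2 :> R.
    rewrite -natrX -!natrM ler_nat; apply: (@leq_trans (psi.+1 * psi.+1)); first exact: ltnW.
    by rewrite -mulnn leq_succ_sq.
  have H5 : 64 * (Ln ^+ 3 * l%:R) <= 16 ^+ 2 * (Ln ^+ 3 / d%:R) * psi%:R ^+ 2.
    have -> : 16 ^+ 2 * (Ln ^+ 3 / d%:R) * psi%:R ^+ 2 = 64 * (Ln ^+ 3 / d%:R) * (4 * psi%:R ^+ 2) by ring.
    have -> : 64 * (Ln ^+ 3 * l%:R) = 64 * (Ln ^+ 3 / d%:R) * (d%:R * l%:R).
      by field; rewrite gt_eqF.
    by apply: ler_wpM2l => //; rewrite mulr_ge0 // divr_ge0 // exprn_ge0.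
  apply: le_trans H5; rewrite natrM.
  have l00 : 0 <= l%:R :> R by [].
  have H6 : l%:R ^+ 3 <= (3 * Ln) ^+ 3 by apply: lerXn2r; rewrite ?nnegrE ?mulr_ge0.
  have H7 := ler_wpM2r l00 H6.
  apply: (@le_trans _ _ ((3 * Ln) ^+ 3 * l%:R)); first by apply: le_trans H7; rewrite le_eqVlt; apply/orP; left; apply/eqP; ring.
  have -> : (3 * Ln) ^+ 3 * l%:R = 27 * (Ln ^+ 3 * l%:R) by ring.
  by apply: ler_wpM2r; [rewrite mulr_ge0 // exprn_ge0|rewrite ler_nat].
have C0 : 0 <= 2 ^+ 13 * g by rewrite mulr_ge0 ?exprn_ge0 // ltW.
have lam0 : 0 < lam by apply: le_lt_trans Hlam.
pose m := Num.min lam 1; pose mu := m ^+ 2.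
have m0 : 0 < m by rewrite lt_min lam0 ltr01.
have m1 : m <= 1 by rewrite ge_min lexx orbT.
have mlam : m <= lam by rewrite ge_min lexx.
have mu1 : mu <= 1 by rewrite expr_le1 // ltW.
have mu0 : 0 < mu by apply: exprn_gt0.
have mum : mu <= m by rewrite /mu expr2 ler_piMl // ltW.
have mu_y : 2 ^+ 26 * y <= mu.
  have [lam1|lam1] := leP lam 1.
    have -> : mu = lam ^+ 2 by rewrite /mu /m min_l.
    have -> : 2 ^+ 26 * y = (2 ^+ 13 * g) ^+ 2 by rewrite yE exprMn -exprM.
    by apply: lerXn2r; rewrite ?nnegrE ?(ltW lam0) // ltW.
  have -> : mu = 1 by rewrite /mu /m min_r ?expr1n // ltW.
  exact: ysmall.
have q0 : 0 <= mu / 8 by rewrite divr_ge0 // ltW.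
have q8 : mu / 8 <= 8^-1 by rewrite ler_pdivrMr // mulVf // .
have K1 : mu / 8 / (lam * (1 - mu / 8)) <= m / 2.
  rewrite ler_pdivrMr; last by rewrite mulr_gt0 // subr_gt0; apply: le_lt_trans q8 _; rewrite invf_lt1 // ltr1n.
  apply: (@le_trans _ _ (m / 2 * (m * 2^-1))).
    by have -> : m / 2 * (m * 2^-1) = mu / 4; [rewrite /mu; field|move: (mu) mu0 => z z0; lra].
  apply: ler_wpM2l; first by rewrite divr_ge0 // ltW.
  by apply: ler_pM; rewrite ?(ltW m0) ?invr_ge0 //; lra.
exists psi, l, (mu / 8), (m / 2); split; first split.
- by split=> //; rewrite expnS mul2n leq_double.
- by split=> //; lra.
- have H1 : m / 2 / lam <= 2^-1 by rewrite ler_pdivrMr //; lra.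
  have H2 := le_trans K1 (_ : m / 2 <= 2^-1); lra.
- exact: K1.
- by move=> n; apply: (peierls_sum_le _ d1 l0 psi0 l2 y0 l2_le dy mu_y mu1).
have yd : d%:R^-1 <= y.
  rewrite -(@ler_pXn2r _ 2) ?nnegrE ?invr_ge0 ?(ltW y0) //.
  apply: (@le_trans _ _ (d%:R^-1)).
    by rewrite expr2 ler_piMl ?invr_ge0 // invf_le1.
  by rewrite -(ler_pM2l dR) mulfV ?gt_eqF.
have md : d%:R^-1 <= m.
  apply: le_trans yd _; apply: le_trans mum; apply: le_trans mu_y.
  by rewrite ler_peMl ?(ltW y0) // exprn_ege1 // ler1n.
have Hl : d%:R^-1 / 2 <= lam / (1 + lam).
  apply: (@le_trans _ _ (m / 2)); first by lra.
  rewrite ler_pdivlMr ?addr_gt0 // /m.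
  by move: (lam) lam0 => z z0; have [z1|z1] := leP z 1; clear -z0 z1; nra.
have E : d.*2%:R * (64 * d%:R ^+ 2)^-1 = d%:R^-1 / 32 :> R.
  by rewrite -mul2n natrM; field; rewrite gt_eqF.
rewrite E; move: (d%:R : R) dR d1R Hl => D dR d1R Hl; clear -dR d1R Hl.
have Di : D^-1 <= 1 by rewrite invf_le1.
have Di0 : 0 < D^-1 by rewrite invr_gt0.
apply: (@lt_le_trans _ _ (D^-1 / 2 * (1 - D^-1 / 32))); last first.
  by apply: ler_wpM2r => //; lra.
have -> : (64 * D ^+ 2)^-1 = D^-1 * D^-1 / 64 by field; rewrite gt_eqF.
nra.
Qed.
End Asymptotics.

(** * Infinite-volume limits *)

Definition cylinder (V : choiceType) (adj : rel V) (s r : seq V) : set (indsetM adj) :=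
  [set I | (forall v, v \in s -> sval I v) /\ (forall v, v \in r -> ~ sval I v)].

Arguments cylinder {V} adj s r.

Lemma measurable_occupied (V : choiceType) (adj : rel V) (v : V) :
  measurable (@occupied V adj v : set (indsetM adj)).
Proof. by apply: sub_sigma_algebra; exists v. Qed.

Lemma cylinder_consl (V : choiceType) (adj : rel V) (s r : seq V) v :
  cylinder adj (v :: s) r = cylinder adj s r `&` @occupied V adj v.
Proof.
apply/seteqP; split=> I /= [].
  by move=> H1 H2; split; [split=> // u us|]; apply: H1; rewrite inE ?us ?orbT ?eqxx.
by move=> [H1 H2] Iv; split=> // u; rewrite inE => /predU1P[->|]; [|exact: H1].
Qed.

Lemma cylinder_consr (V : choiceType) (adj : rel V) (s r : seq V) v :
  cylinder adj s (v :: r) = cylinder adj s r `\` @occupied V adj v.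
Proof.
apply/seteqP; split=> I /= [].
  by move=> H1 H2; split; [split=> // u us|]; apply: H2; rewrite inE ?us ?orbT ?eqxx.
by move=> [H1 H2] Iv; split=> // u; rewrite inE => /predU1P[->|]; [|exact: H2].
Qed.

Lemma cylinder_nil (V : choiceType) (adj : rel V) : cylinder adj [::] [::] = setT.
Proof. by apply/seteqP; split. Qed.

Lemma measurable_cylinder (V : choiceType) (adj : rel V) (s r : seq V) :
  measurable (cylinder adj s r).
Proof.
elim: s => [|v s IH]; last first.
  by rewrite cylinder_consl; apply: measurableI => //; exact: measurable_occupied.
elim: r => [|v r IH]; first by rewrite cylinder_nil; exact: measurableT.
by rewrite cylinder_consr; apply: measurableD => //; exact: measurable_occupied.
Qed.

(** * A measure with prescribed cylinder probabilities *)

Section Extension.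
Variables (V : choiceType) (adj : rel V) (R : realType) (en : nat -> V).
Hypothesis en_surj : forall v, exists k, en k = v.
Variable m : seq V -> seq V -> R.
Hypothesis m_ge0 : forall s r, 0 <= m s r.
Hypothesis m_nil : m [::] [::] = 1.
Hypothesis m_split : forall s r v, m s r = m (v :: s) r + m s (v :: r).
Hypothesis m_ext : forall s r s' r', s =i s' -> r =i r' -> m s r = m s' r'.
Hypothesis m_disjoint : forall s r v, v \in s -> v \in r -> m s r = 0.
Hypothesis m_independent : forall s r u v, adj u v -> u \in s -> v \in s -> m s r = 0.

(* Patterns list the states of [en (n - 1), ..., en 0], latest first. *)
Fixpoint sites (g : bitseq) : seq V * seq V :=
  if g is b :: g' then
    let v := en (size g') in
    if b then (v :: (sites g').1, (sites g').2) else ((sites g').1, v :: (sites g').2)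
  else ([::], [::]).
Definition prob (g : bitseq) : R := m (sites g).1 (sites g).2.

(* The interval [left_end g, left_end g + prob g[ carries the pattern g. *)
Fixpoint left_end (g : bitseq) : R :=
  if g is b :: g' then left_end g' + (if b then prob (false :: g') else 0) else 0.
Fixpoint pattern (u : R) (n : nat) : bitseq :=
  if n is n'.+1 then (left_end (true :: pattern u n') <= u) :: pattern u n' else [::].
Definition bit (u : R) (k : nat) : bool := left_end (true :: pattern u k) <= u.

Lemma prob_ge0 g : 0 <= prob g. Proof. exact: m_ge0. Qed.

Lemma prob_split g : prob g = prob (true :: g) + prob (false :: g).
Proof. exact: m_split. Qed.

Implicit Types (u : R).

Lemma size_pattern u n : size (pattern u n) = n.
Proof. by elim: n => //= n ->. Qed.

Lemma pattern_itv u n : 0 <= u < 1 ->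
  left_end (pattern u n) <= u < left_end (pattern u n) + prob (pattern u n).
Proof.
move=> u01; elim: n => [|n]; first by rewrite /= /prob m_nil add0r.
rewrite [pattern u n.+1]/= -/(bit u n).
set g := pattern u n; move=> /andP[lu ur].
have := prob_split g; rewrite /bit -/g /=.
have [H|H] := leP (left_end g + prob (false :: g)) u; rewrite ?addr0; lra.
Qed.

Lemma sub_itv b g : left_end g <= left_end (b :: g) /\
  left_end (b :: g) + prob (b :: g) <= left_end g + prob g.
Proof.
have := prob_split g; have := prob_ge0 (true :: g); have := prob_ge0 (false :: g).
case: b => /=; lra.
Qed.

Lemma itv_unit u g : left_end g <= u < left_end g + prob g -> 0 <= u < 1.
Proof.
elim: g => [|b g IH]; first by rewrite /= /prob m_nil add0r.
have [H1 H2] := sub_itv b g; move=> /andP[H3 H4]; apply: IH; lra.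
Qed.

Lemma pattern_unique u g : left_end g <= u < left_end g + prob g -> pattern u (size g) = g.
Proof.
elim: g => //= b g IH H.
have [H1 H2] := sub_itv b g.
have gE : pattern u (size g) = g by apply: IH; move: H => /andP[H3 H4]; move: H1 H2; rewrite /=; lra.
rewrite gE; congr (_ :: _); move: H => /=; case: b {H1 H2} => /andP[H3 H4]; first exact: H3.
by apply/negbTE; rewrite -ltNge; move: H3 H4; rewrite addr0.
Qed.

(** Empty for [u] outside the unit interval, so that it is an independent set for every [u]. *)
Definition configuration (u : R) : set V :=
  [set v | 0 <= u < 1 /\ exists k, en k = v /\ bit u k].

Lemma mem_sites u n k : (k < n)%N ->
  en k \in (if bit u k then (sites (pattern u n)).1 else (sites (pattern u n)).2).
Proof.
elim: n => // n IH; rewrite ltnS leq_eqVlt => /predU1P[->|kn].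
  by rewrite [pattern _ _]/= -/(bit u n) /= size_pattern; case: (bit u n); rewrite /= inE eqxx.
rewrite [pattern _ _]/= -/(bit u n) /=.
by have := IH kn; case: (bit u k); case: (bit u n) => //= H; rewrite inE H orbT.
Qed.

Lemma prob_pattern_gt0 u n : 0 <= u < 1 -> 0 < prob (pattern u n).
Proof. by move=> u01; have /andP[] := pattern_itv n u01; lra. Qed.

(** [en] may list a site several times. Conflicting bits at one site would give a pattern of
    probability 0, whose half-open interval contains no [u]. *)
Lemma configurationE u k : 0 <= u < 1 -> configuration u (en k) <-> bit u k.
Proof.
move=> u01; split; last by move=> H; split=> //; exists k.
case=> _ [k' [ek bk']]; apply: contraT => /negbTE nb.
set n := (maxn k k').+1; have kn : (k < n)%N by rewrite ltnS leq_maxl.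
have kn' : (k' < n)%N by rewrite ltnS leq_maxr.
have := prob_pattern_gt0 n u01; have := mem_sites u kn; have := mem_sites u kn'.
by rewrite nb bk' ek /prob => H1 H2; rewrite (m_disjoint H1 H2) ltxx.
Qed.

Lemma configuration_independent u : independent adj (configuration u).
Proof.
move=> x y [u01 [j [<- bj]]] [_ [k [<- bk]]]; apply/negP => jk.
set n := (maxn j k).+1; have jn : (j < n)%N by rewrite ltnS leq_maxl.
have kn : (k < n)%N by rewrite ltnS leq_maxr.
have := prob_pattern_gt0 n u01; have := mem_sites u jn; have := mem_sites u kn.
by rewrite bj bk /prob => H1 H2; rewrite (m_independent _ jk H2 H1) ltxx.
Qed.

Definition random_set (u : measurableTypeR R) : indsetM adj := exist _ _ (@configuration_independent u).

Definition unit_itv : set (measurableTypeR R) := `[0, 1[%classic.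
Lemma unit_itvE u : unit_itv u = (0 <= u < 1).
Proof. by rewrite /unit_itv /= in_itv. Qed.

Definition pattern_itv_set g : set (measurableTypeR R) := `[left_end g, left_end g + prob g[%classic.

Lemma pattern_itv_setE u g : pattern_itv_set g u <-> unit_itv u /\ pattern u (size g) = g.
Proof.
rewrite unit_itvE /pattern_itv_set /= in_itv /=; split=> [H|[H <-]].
  by split; [exact: itv_unit H|exact: pattern_unique].
exact: pattern_itv.
Qed.

Lemma measurable_random_set : measurable_fun setT random_set.
Proof.
apply: (@measurability _ _ _ _ setT random_set (range (@occupied V adj))) => // _ [_ [v _ <-] <-].
rewrite setTI; have [k <-] := en_surj v.
have -> : random_set @^-1` occupied (en k) =
    \bigcup_(g : k.-tuple bool) pattern_itv_set (true :: g).
  apply/seteqP; split=> [u /= H|u [g _ /pattern_itv_setE[u01]]].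
    have u01 : 0 <= u < 1 by case: H.
    exists (Tuple (introT eqP (size_pattern u k))) => //.
    apply/pattern_itv_setE; rewrite unit_itvE /= size_pattern; split=> //; congr (_ :: _).
    exact/(configurationE k u01).
  rewrite unit_itvE in u01; rewrite [size _]/= size_tuple [pattern _ _]/= => -[b _].
  by rewrite /=; apply/(configurationE k u01); rewrite /bit /= b.
by apply: fin_bigcup_measurable => [|g _]; [exact: finite_finset|exact: measurable_itv].
Qed.

Lemma unit_itv_measurable : measurable unit_itv. Proof. exact: measurable_itv. Qed.

Definition unit_measure : set (measurableTypeR R) -> \bar R :=
  mrestr (@lebesgue_measure R) unit_itv_measurable.

HB.instance Definition _ := Measure.on unit_measure.

Lemma unit_measure_setT : unit_measure setT = 1%E.
Proof.
by rewrite /unit_measure /mrestr setTI lebesgue_measure_itv /= lte_fin ltr01 oppr0 adde0.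
Qed.

HB.instance Definition _ := Measure_isProbability.Build _ _ _ unit_measure unit_measure_setT.
HB.instance Definition _ := isMeasurableFun.Build _ _ _ _ random_set measurable_random_set.

Fixpoint membership (s : seq V) (n : nat) : bitseq :=
  if n is n'.+1 then (en n' \in s) :: membership s n' else [::].

Lemma size_membership s n : size (membership s n) = n.
Proof. by elim: n => //= n ->. Qed.

Lemma pattern_membership u s n :
  pattern u n = membership s n <-> forall k, (k < n)%N -> bit u k = (en k \in s).
Proof.
elim: n => [|n [IH1 IH2]]; first by split.
split=> [[bn /IH1 H] k|H].
  by rewrite ltnS leq_eqVlt => /predU1P[->|/H].
have gn : pattern u n = membership s n by apply: IH2 => k kn; apply: H; exact: ltnW.
by rewrite [LHS]/= -/(bit u n) H //= gn.
Qed.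

Lemma mem_sites_membership s n v :
  ((v \in (sites (membership s n)).1) <-> (v \in s) /\ exists2 k, (k < n)%N & en k = v) /\
  ((v \in (sites (membership s n)).2) <-> (v \notin s) /\ exists2 k, (k < n)%N & en k = v).
Proof.
elim: n => [|n [IH1 IH2]]; first by split; split=> // -[_ []].
have step (P : Prop) : (P /\ exists2 k, (k < n.+1)%N & en k = v) <->
    (P /\ (en n = v \/ exists2 k, (k < n)%N & en k = v)).
  split=> -[p]; first by case=> k; rewrite ltnS leq_eqVlt => /predU1P[->|kn] e; split=> //; [left|right; exists k].
  by case=> [e|[k kn e]]; split=> //; [exists n|exists k => //; exact: ltnW].
rewrite !step {step} /= size_membership.
have [ens|ens] := boolP (en n \in s); rewrite inE; split; split.
- by move=> /predU1P[->|/IH1[-> H]]; split=> //; [left|right].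
- by case=> vs [->|H]; rewrite ?eqxx //; apply/orP; right; apply/IH1.
- by move=> /IH2[-> H]; split=> //; right.
- by case=> vs [e|H]; [rewrite -e ens in vs|apply/IH2].
- by move=> /IH1[-> H]; split=> //; right.
- by case=> vs [e|H]; [rewrite -e (negbTE ens) in vs|apply/IH1].
- by move=> /predU1P[->|/IH2[-> H]]; split=> //; [left|right].
- by case=> vs [->|H]; rewrite ?eqxx //; apply/orP; right; apply/IH2.
Qed.

Lemma cylinder_base n s r : (forall v, v \in s -> v \in r -> False) ->
  (forall v, (v \in s) || (v \in r) <-> exists2 k, (k < n)%N & en k = v) ->
  distribution unit_measure random_set (cylinder adj s r) = (m s r)%:E.
Proof.
move=> sr nP; set g := membership s n.
have gs : prob g = m s r.
  apply: m_ext => v; apply/idP/idP.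
  - by have [[H _] _] := mem_sites_membership s n v => /H[].
  - by have [[_ H] _] := mem_sites_membership s n v => vs; apply: H; split=> //; apply/nP; rewrite vs.
  - have [_ [H _]] := mem_sites_membership s n v => /H[vs /nP]; by rewrite (negbTE vs).
  - have [_ [_ H]] := mem_sites_membership s n v => vs; apply: H; split; last by apply/nP; rewrite vs orbT.
    by apply/negP => /sr; apply.
rewrite /distribution /pushforward /unit_measure /mrestr.
have H0 : random_set @^-1` cylinder adj s r `&` unit_itv = pattern_itv_set g.
  apply/seteqP; split=> [u [[/= H1 H2] u01]|u /pattern_itv_setE]; rewrite ?size_membership.
    apply/pattern_itv_setE; split=> //; rewrite size_membership; apply/pattern_membership => k kn.
    rewrite unit_itvE in u01.
    have /nP/orP[ks|kr] : exists2 k', (k' < n)%N & en k' = en k by exists k.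
      by rewrite ks; apply/(configurationE k u01)/H1.
    apply/idP/idP => [bk|/sr/(_ kr)//].
    by case: (H2 _ kr); apply/(configurationE k u01).
  case=> u01 /pattern_membership H; split=> //; rewrite unit_itvE in u01; split=> v vs /=.
    have [k kn ek] : exists2 k, (k < n)%N & en k = v by apply/nP; rewrite vs.
    by rewrite -ek; apply/(configurationE k u01); rewrite H // ek.
  have [k kn ek] : exists2 k, (k < n)%N & en k = v by apply/nP; rewrite vs orbT.
  by rewrite -ek => /(configurationE k u01); rewrite H // ek => /sr; apply.
transitivity (lebesgue_measure (pattern_itv_set g)); first by rewrite -H0.
rewrite /pattern_itv_set lebesgue_measure_itv /= -gs lte_fin -[X in (X < _)%R]addr0 ltrD2l.
have := prob_ge0 g; rewrite le_eqVlt => /predU1P[<-|->]; first by rewrite ltxx.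
by rewrite -EFinB addrAC subrr add0r.
Qed.

Lemma cylinder_split (mu : {measure set (indsetM adj) -> \bar R}) s r v :
  (mu (cylinder adj s r) = mu (cylinder adj (v :: s) r) + mu (cylinder adj s (v :: r)))%E.
Proof.
rewrite cylinder_consl cylinder_consr addeC; apply: measureDI.
  exact: measurable_cylinder.
exact: measurable_occupied.
Qed.

Theorem exists_limit_measure : exists mu : probability (indsetM adj) R,
  forall s r, mu (cylinder adj s r) = (m s r)%:E.
Proof.
pose mu : probability (indsetM adj) R := distribution unit_measure random_set.
exists mu => s r.
have [n nP] : exists n, forall v, (v \in s) || (v \in r) -> exists2 k, (k < n)%N & en k = v.
  suff [n nP] : exists n, forall v, v \in s ++ r -> exists2 k, (k < n)%N & en k = v.
    by exists n => v; rewrite -mem_cat; apply: nP.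
  elim: (s ++ r) => [|v t [n IH]]; first by exists 0%N.
  have [k ek] := en_surj v; exists (maxn n k.+1) => w; rewrite inE => /predU1P[->|/IH[j jn ej]].
    by exists k => //; rewrite leq_max ltnSn orbT.
  by exists j => //; rewrite leq_max jn.
(* The cylinder is split at one more site at a time until it decides all of [en 0, ..., en (n - 1)];
   then it is contradictory or the event of a single pattern. *)
suff main i : (i <= n)%N -> forall s r,
    (forall v, (v \in s) || (v \in r) -> exists2 k, (k < n)%N & en k = v) ->
    (forall k, (k < n - i)%N -> (en k \in s) || (en k \in r)) ->
    mu (cylinder adj s r) = (m s r)%:E.
  by apply: (main n) => // k; rewrite subnn.
elim: i {s r nP} => [_|i IH ltin] s r nP H.
  rewrite subn0 in H.
  have [[v vs vr]|sr] := EM (exists2 v, v \in s & v \in r).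
    have -> : cylinder adj s r = set0.
      by apply/seteqP; split=> // I [H1 H2]; apply: (H2 v vr); exact: H1.
    by rewrite (m_disjoint vs vr) measure0.
  apply: (@cylinder_base n) => v; first by move=> vs vr; apply: sr; exists v.
  by split=> [/nP|[k /H kn <-]].
pose v := en (n - i.+1)%N.
have vn : exists2 k, (k < n)%N & en k = v by exists (n - i.+1)%N => //; lia.
have knP k : (k < n - i)%N -> (en k == v) || ((en k \in s) || (en k \in r)).
  move=> kn; have [->|ne] := eqVneq k (n - i.+1)%N; first by rewrite eqxx.
  by rewrite H ?orbT //; lia.
rewrite (cylinder_split mu s r v) (m_split s r v) EFinD; congr (_ + _)%E; apply: IH.
- exact: ltnW.
- by move=> w; rewrite inE -orbA => /predU1P[->|/nP].
- by move=> k /knP; rewrite inE -orbA.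
- exact: ltnW.
- by move=> w; rewrite inE orbCA => /predU1P[->|/nP].
- by move=> k /knP; rewrite inE orbCA.
Qed.

End Extension.

(** The measurable space is arbitrary, so that the lemma also applies to the sub-sigma-algebras
    [outside] and [away]. *)
Lemma measurable_finite_trace d (T : measurableType d) (V : choiceType)
    (W U : {fset V}) (p : V -> T -> bool) :
  (forall w, w \in W -> measurable [set x | p w x]) ->
  measurable [set x | [fset w in W | p w x]%fset = U].
Proof.
move=> mp; have [UW|nUW] := boolP (U `<=` W)%fset; last first.
  rewrite (_ : [set _ | _] = set0); first exact: measurable0.
  apply/seteqP; split=> // x /= E; case/negP: nUW; rewrite -E; exact: fset_sub.
rewrite (_ : [set _ | _] = \bigcap_(w in [set` W]) [set x | p w x = (w \in U)]); last first.
  apply/seteqP; split=> x /=; first by move=> <- w /= wW; rewrite !inE wW.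
  move=> H; apply/fsetP => w; rewrite !inE; case: (boolP (w \in W)) => /= wW.
    exact: H.
  by apply/esym/negP => /(fsubsetP UW); exact/negP.
apply: fin_bigcap_measurable => [|w wW]; first exact: finite_fset.
case: (w \in U); first exact: mp.
rewrite (_ : [set _ | _] = ~` [set x | p w x]); first by apply: measurableC; exact: mp.
by apply/seteqP; split=> x /=; case: (p w x).
Qed.

Lemma measure_fibers d (T : measurableType d) (R : realType) (K : choiceType)
    (mu : {measure set T -> \bar R}) (h : T -> K) (r : seq K) (E : set T) :
  (forall k, measurable [set x | h x = k]) -> measurable E -> uniq r ->
  mu (E `&` [set x | h x \in r]) = (\sum_(k <- r) mu (E `&` [set x | h x = k]))%E.
Proof.
move=> mh mE; elim: r => [_|k r IH /= /andP[kr ur]].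
  by rewrite big_nil (_ : [set _ | _] = set0) ?setI0 ?measure0 //; apply/seteqP; split.
have mr : measurable [set x | h x \in r].
  elim: r {IH kr ur} => [|j r IHr].
    by rewrite (_ : [set _ | _] = set0); [exact: measurable0|apply/seteqP; split].
  rewrite (_ : [set _ | _] = [set x | h x = j] `|` [set x | h x \in r]).
    by apply: measurableU.
  apply/seteqP; split=> x /=; rewrite inE; first by case/predU1P; [left|right].
  by case=> [->|->]; rewrite ?eqxx ?orbT.
rewrite big_cons -IH // (_ : [set _ | _] = [set x | h x = k] `|` [set x | h x \in r]); last first.
  apply/seteqP; split=> x /=; rewrite inE; first by case/predU1P; [left|right].
  by case=> [->|->]; rewrite ?eqxx ?orbT.
rewrite setIUr measureU //; [exact: measurableI|exact: measurableI|].
apply/seteqP; split=> // x /= [[_ ->] [_]]; exact/negP.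
Qed.

(** * From the one-site identity to the hard-core property *)

Section Specification.
Variables (V : choiceType) (adj : rel V) (nbrs : V -> seq V) (R : realType) (lam : R).
Hypothesis lam_gt0 : 0 < lam.
Hypothesis nbrsP : forall u v, adj u v = (v \in nbrs u).
Hypothesis adj_irr : forall v, ~~ adj v v.
Variable mu : probability (indsetM adj) R.
Hypothesis flip : forall v s, v \notin s ->
  mu (cylinder adj (v :: s) (nbrs v)) = (lam%:E * mu (cylinder adj s (v :: nbrs v)))%E.

Definition away (v : V) : set_system (indsetM adj) := <<s @occupied V adj @` [set u | u != v] >>.
Definition isolated (v : V) : set (indsetM adj) := cylinder adj [::] (nbrs v).

Lemma cylinder_cat (s r : seq V) : cylinder adj s r = cylinder adj s [::] `&` cylinder adj [::] r.
Proof. by apply/seteqP; split=> I /=; [case=> H1 H2|case=> -[H1 _] [_ H2]]; do ?split. Qed.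

(** Both sides are finite measures in [E] and agree, by [flip], on the events that finitely many
    sites other than [v] are occupied; these form a pi-system generating [away v]. *)
Lemma flip_away v E : away v E ->
  mu (E `&` (isolated v `&` occupied v)) = (lam%:E * mu (E `&` (isolated v `\` occupied v)))%E.
Proof.
have mI : measurable (isolated v) by exact: measurable_cylinder.
have mO : measurable (@occupied V adj v : set (indsetM adj)) by exact: measurable_occupied.
have m1 : measurable (isolated v `&` occupied v) by exact: measurableI.
have m2 : measurable (isolated v `\` occupied v) by exact: measurableD.
pose G : set_system (indsetM adj) := [set E | exists2 s, v \notin s & E = cylinder adj s [::]].
have sub : away v `<=` <<s G >>.
  apply: sub_sigma_algebra2 => _ [u /= uv <-]; exists [:: u]; first by rewrite inE eq_sym.
  by rewrite cylinder_consl cylinder_nil setTI.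
move=> /sub; pose lam' := NngNum (ltW lam_gt0).
rewrite -[LHS]/(mrestr mu m1 E) -[RHS]/(mscale lam' (mrestr mu m2) E).
apply: (g_sigma_algebra_measure_unique G _ (fun=> setT)) => //.
- by move=> _ [s _ ->]; exact: measurable_cylinder.
- by move=> _; exists [::] => //; rewrite cylinder_nil.
- by rewrite bigcup_const.
- move=> _ _ [s vs ->] [t vt ->]; exists (s ++ t); first by rewrite mem_cat negb_or vs.
  apply/seteqP; split=> I /=.
    by case=> -[H1 _] [H2 _]; split=> // u; rewrite mem_cat => /orP[/H1|/H2].
  by case=> H _; split; split=> // u us; apply: H; rewrite mem_cat us ?orbT.
- move=> _ [s vs ->]; rewrite /= /mscale /= /mrestr.
  by rewrite setIA -cylinder_cat -cylinder_consl flip // setIDA -cylinder_cat -cylinder_consr.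
- by move=> _; rewrite /= /mrestr (le_lt_trans (probability_le1 _ _)) ?ltry //; exact: measurableI.
Qed.

Definition trace (W : {fset V}) (I : indsetM adj) : {fset V} := [fset w in W | `[< sval I w >]]%fset.

Lemma measurable_trace W B : measurable [set I | trace W I = B].
Proof.
apply: measurable_finite_trace => w _.
rewrite (_ : [set _ | _] = occupied w); first exact: measurable_occupied.
by apply/seteqP; split=> I /= /asboolP.
Qed.

Lemma outside_sub_away W w : w \in W -> outside W `<=` away w.
Proof.
move=> wW; apply: sub_sigma_algebra2 => _ [v /= vW <-]; exists v => //.
by apply: contraNneq vW => ->.
Qed.

Lemma outside_measurable W : outside W `<=` (measurable : set_system (indsetM adj)).
Proof. by apply: sub_sigma_algebra2 => _ [v _ <-]; exists v. Qed.

Lemma free_sitesE W : @free_sites V adj W =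
  fun I => [fset w in W | all (fun v => (v \notin W) ==> ~~ `[< sval I v >]) (nbrs w)]%fset.
Proof.
apply/funext => I; apply/fsetP => w; rewrite !inE; congr (_ && _).
apply/asboolP/allP => [H v vw|H v vW Iv].
  apply/implyP => vW; apply/negP => /asboolP Iv.
  by have := H v vW Iv; rewrite nbrsP vw.
apply/negP; rewrite nbrsP => /H; rewrite vW /= => /asboolP; exact.
Qed.

Lemma outside_free_sites W U : outside W [set I : indsetM adj | free_sites W I = U].
Proof.
rewrite free_sitesE; pose T' := g_sigma_algebraType (@occupied V adj @` [set v | v \notin W]).
apply: (@measurable_finite_trace _ T') => w _.
elim: (nbrs w) => [|v s IH].
  by rewrite [X in measurable X](_ : _ = setT); [exact: (@measurableT _ T')|apply/seteqP; split].
have [vW|vW] := boolP (v \in W).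
  rewrite [X in measurable X](_ : _ = [set I | all (fun v => (v \notin W) ==> ~~ `[< sval I v >]) s]) //.
  by apply/seteqP; split=> I /=; rewrite vW.
rewrite [X in measurable X](_ : _ = [set I | all (fun v => (v \notin W) ==> ~~ `[< sval I v >]) s] `\` occupied v).
  by apply: (@measurableD _ T') => //; apply: sub_sigma_algebra; exists v.
apply/seteqP; split=> I /=; rewrite vW /=; first by case/andP => /asboolPn ? ->.
by case=> -> ?; rewrite andbT; apply/asboolPn.
Qed.

(** Removes the sites of [B] one by one. With the rest of the trace fixed, all neighbours of the
    removed [w] are empty: inside [W] because [B] is independent, outside because [w] is free. So
    [flip_away] applies to [E'], an event away from [w]. *)
Lemma trace_weight W U B E : outside W E -> (forall I, E I -> free_sites W I = U) ->
  (B `<=` U)%fset -> independent adj [set` B] ->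
  mu (E `&` [set I | trace W I = B]) =
  ((lam ^+ #|` B|)%:E * mu (E `&` [set I | trace W I = fset0]))%E.
Proof.
move=> oE EU; move: {2}(#|` B|) (erefl #|` B|) => n; elim: n B => [|n IH] B.
  by move/cardfs0_eq => -> _ _; rewrite cardfs0 expr0 mul1e.
move=> Bn BU indB; have [w wB] : exists w, w \in B by apply/fset0Pn; rewrite -cardfs_gt0 Bn.
pose B' := (B `\ w)%fset.
have B'n : #|` B'| = n by have := cardfsD1 w B; rewrite wB Bn => -[].
have UW : (U `<=` W)%fset \/ E = set0.
  have [[I EI]|nE] := EM (exists I, E I).
    by left; rewrite -(EU I EI); exact: fset_sub.
  by right; apply/seteqP; split=> // I EI; apply: nE; exists I.
case: UW => [UW|->]; last by rewrite !set0I measure0 mule0.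
have wW : w \in W by apply: (fsubsetP UW); exact: (fsubsetP BU).
pose E' := E `&` [set I | trace (W `\ w)%fset I = B'].
have aE' : away w E'.
  pose T' := g_sigma_algebraType (@occupied V adj @` [set u | u != w]).
  apply: (@measurableI _ T'); first exact: outside_sub_away oE.
  apply: (@measurable_finite_trace _ T') => v; rewrite !inE => /andP[vw _].
  rewrite [X in measurable X](_ : _ = occupied v); first by apply: sub_sigma_algebra; exists v.
  by apply/seteqP; split=> I /= /asboolP.
have iso : E' `<=` isolated w.
  move=> I [EI /= tI]; split=> // v; rewrite -nbrsP => wv Iv.
  have [vW|vW] := boolP (v \in W).
    have vB : v \in B'.
      rewrite -tI !inE vW; apply/andP; split; last exact/asboolP.
      by rewrite andbT; apply: contraTneq wv => ->.
    by have /negP := indB w v wB (fsubsetP (fsubD1set _ _) _ vB); apply.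
  have : w \in free_sites W I by rewrite EU //; exact: (fsubsetP BU).
  by rewrite !inE wW => /asboolP/(_ v vW Iv); rewrite wv.
have tw I (b : bool) : trace (W `\ w)%fset I = B' -> `[< sval I w >] = b ->
    trace W I = if b then B else B'.
  move=> tI Ib; apply/fsetP => v; have [->|vw] := eqVneq v w.
    by rewrite !inE wW Ib; case: (b) => //=; rewrite ?wB ?inE ?eqxx.
  have /fsetP/(_ v) := tI; rewrite !inE vw /= => ->.
  by case: (b); rewrite ?inE ?vw.
have wt I : trace W I = B \/ trace W I = B' -> trace (W `\ w)%fset I = B'.
  move=> H; apply/fsetP => v; rewrite !inE; have [->//|vw] /= := eqVneq v w.
  by case: H => /fsetP/(_ v); rewrite !inE ?vw.
have E1 : E `&` [set I | trace W I = B] = E' `&` (isolated w `&` occupied w).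
  apply/seteqP; split=> I /=.
    move=> [EI tI]; have E'I : E' I by split=> //=; apply: wt; left.
    split=> //; split; first exact: iso.
    by move: wB; rewrite -tI !inE => /andP[_ /asboolP].
  move=> [[EI tI] [_ Iw]]; split=> //; apply: (tw I true) => //; exact/asboolP.
have E2 : E `&` [set I | trace W I = B'] = E' `&` (isolated w `\` occupied w).
  apply/seteqP; split=> I /=.
    move=> [EI tI]; have E'I : E' I by split=> //=; apply: wt; right.
    split=> //; split; first exact: iso.
    move=> Iw; suff : w \in B' by rewrite !inE eqxx.
    by rewrite -tI !inE wW; apply/asboolP.
  move=> [[EI tI] [_ Iw]]; split=> //; apply: (tw I false) => //; exact/asboolPn.
rewrite E1 flip_away // -E2 IH //.
- by rewrite muleA -EFinM Bn B'n exprS.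
- by apply: fsubset_trans BU; exact: fsubD1set.
- by move=> u v uB vB; apply: indB; apply: (fsubsetP (fsubD1set B w)).
Qed.

Definition admissible (U : {fset V}) : seq {fset V} :=
  [seq B <- fpowerset U | `[< independent adj [set` B] >]].

Lemma trace_admissible W U I : free_sites W I = U -> trace W I \in admissible U.
Proof.
move=> <-; rewrite mem_filter fpowersetE; apply/andP; split.
  apply/asboolP => u v /=; rewrite !inE => /andP[_ /asboolP Iu] /andP[_ /asboolP Iv].
  exact: (svalP I).
apply/fsubsetP => w; rewrite !inE => /andP[-> /asboolP Iw] /=.
by apply/asboolP => v _ Iv; exact: (svalP I).
Qed.

Lemma trace_hardcore W U A E : outside W E -> (forall I, E I -> free_sites W I = U) ->
  mu (E `&` [set I | trace W I = A]) = ((hardcore_fin adj lam U A)%:E * mu E)%E.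
Proof.
move=> oE EU.
have mE : measurable E by exact: outside_measurable oE.
have mF k : measurable [set I : indsetM adj | free_sites W I = k].
  exact: (@outside_measurable W _ (@outside_free_sites W k)).
have x_fin : mu (E `&` [set I | trace W I = fset0]) \is a fin_num.
  by apply: fin_num_measure; apply: measurableI => //; exact: measurable_trace.
set x := mu (E `&` [set I | trace W I = fset0]) in x_fin.
have term B : B \in admissible U -> mu (E `&` [set I | trace W I = B]) = (lam ^+ #|` B| * fine x)%:E.
  rewrite mem_filter fpowersetE => /andP[/asboolP indB BU].
  by rewrite (trace_weight oE EU BU indB) EFinM fineK.
have total : mu E = ((\sum_(B <- fpowerset U | `[< independent adj [set` B] >]) lam ^+ #|` B|) * fine x)%:E.
  have <- : E `&` [set I | trace W I \in admissible U] = E.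
    by apply/seteqP; split=> [I []//|I EI]; split=> //=; apply: trace_admissible; exact: EU.
  rewrite (@measure_fibers _ _ _ _ mu (trace W) (admissible U) E) //; last 2 first.
  - by move=> B; exact: measurable_trace.
  - by rewrite filter_uniq // fset_uniq.
  by rewrite mulr_suml -sumEFin -[RHS]big_filter -/(admissible U); apply: eq_big_seq => B /term.
have [AU|AU] := boolP (A \in admissible U).
  rewrite term // total /hardcore_fin; move: (AU); rewrite mem_filter fpowersetE andbC => ->.
  rewrite -EFinM; congr EFin; rewrite mulrA divfK // gt_eqF //.
  rewrite -big_filter -/(admissible U) (bigD1_seq A) //=; last by rewrite filter_uniq // fset_uniq.
  by apply: ltr_pwDl; [rewrite exprn_gt0|apply: sumr_ge0 => B _; rewrite exprn_ge0 // ltW].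
rewrite (_ : E `&` _ = set0) ?measure0; last first.
  apply/seteqP; split=> // I [/EU fI /= tI].
  by case/negP: AU; rewrite -tI; exact: trace_admissible.
rewrite /hardcore_fin ifF ?mul0e //; apply/negbTE; move: AU.
by rewrite mem_filter fpowersetE andbC.
Qed.

Lemma hardcore_fin_ge0 U A : 0 <= hardcore_fin adj lam U A.
Proof.
rewrite /hardcore_fin; case: ifP => // _; apply: divr_ge0; first by rewrite exprn_ge0 // ltW.
by apply: sumr_ge0 => B _; rewrite exprn_ge0 // ltW.
Qed.

(** The set of free sites is determined outside [W] and takes finitely many values, so the candidate
    conditional probability is a simple function and its integral a finite sum. *)
Theorem hardcore_of_flip : is_hardcore lam mu.
Proof.
move=> W A AW; pose hc U := hardcore_fin adj lam U A.
pose F U := [set I : indsetM adj | free_sites W I = U].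
have mF U : measurable (F U) by exact: (@outside_measurable W _ (@outside_free_sites W U)).
have free_sub (I : indsetM adj) : free_sites W I \in fpowerset W by rewrite fpowersetE; exact: fset_sub.
split.
  move=> B _; pose T' := g_sigma_algebraType (@occupied V adj @` [set v | v \notin W]).
  rewrite [X in outside W X](_ : _ = \bigcup_(U in [set U | U \in fpowerset W /\ B (hc U)]) F U); last first.
    apply/seteqP; split=> I /=; first by exists (free_sites W I).
    by case=> U [_ BU] fU; rewrite -/(hc _) fU.
  apply: (@fin_bigcup_measurable _ T') => [|U _]; last exact: outside_free_sites.
  apply: (@sub_finite_set _ _ [set` fpowerset W]); last exact: finite_fset.
  by move=> U [].
move=> E oE; have mE : measurable E by exact: outside_measurable oE.
have -> : [set I : indsetM adj | sval I `&` [set` W] = [set` A]] = [set I | trace W I = A].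
  apply/seteqP; split=> I /=.
    move=> /seteqP[H1 H2]; apply/fsetP => w; rewrite !inE.
    apply/andP/idP => [[wW /asboolP Iw]|wA]; first exact: (H1 w).
    by have [Iw wW] := H2 w wA; split=> //; apply/asboolP.
  move=> <-; apply/seteqP; split=> w /=; rewrite !inE.
    by case=> Iw ->; apply/asboolP.
  by move=> /andP[-> /asboolP].
have mt : measurable [set I | trace W I = A] by exact: measurable_trace.
transitivity (\sum_(U <- fpowerset W) (hc U)%:E * mu (E `&` F U))%E.
  have -> : [set I | trace W I = A] `&` E =
      ([set I | trace W I = A] `&` E) `&` [set I | free_sites W I \in fpowerset W].
    apply/seteqP; split=> [I H|I []//]; split=> //=; exact: free_sub.
  rewrite (@measure_fibers _ _ _ _ mu (@free_sites V adj W)) ?fset_uniq //; last exact: measurableI.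
  apply: eq_bigr => U _; rewrite -(@trace_hardcore W U A).
  - by congr (mu _); rewrite [_ `&` E]setIC setIAC.
  - pose T' := g_sigma_algebraType (@occupied V adj @` [set v | v \notin W]).
    by apply: (@measurableI _ T') => //; exact: outside_free_sites.
  - by move=> I [].
transitivity (\int[mu]_(I in E) (\sum_(U <- fpowerset W) (hc U)%:E * (\1_(F U) I)%:E))%E; last first.
  apply: eq_integral => I _; rewrite (big_fsetD1 (free_sites W I)) //= indicE mem_set // mule1.
  rewrite big_seq big1 ?adde0 // => U; rewrite !inE => /andP[UI _].
  rewrite indicE memNset ?mule0 //= => fU; by rewrite -fU eqxx in UI.
rewrite ge0_integral_sum //.
- apply: eq_bigr => U _; rewrite ge0_integralZl_EFin //.
  + by rewrite integral_indic // setIC.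
  + by apply/measurable_EFinP; exact: measurable_indic.
  + exact: hardcore_fin_ge0.
- by move=> U; apply: measurable_funeM; apply/measurable_EFinP; exact: measurable_indic.
- by move=> U I _; rewrite mule_ge0 // lee_fin hardcore_fin_ge0.
Qed.

End Specification.

(** * The lattice inside the torus *)

Section Embedding.
Variable d : nat.
Implicit Types (x y : 'rV[int]_d) (n : nat).
Local Notation D := ('I_d * bool)%type.

Definition lattice_step (t : D) : 'rV[int]_d := if t.2 then delta_mx 0 t.1 else - delta_mx 0 t.1.
Definition lattice_nbrs x : seq 'rV[int]_d := [seq x + lattice_step t | t <- enum {: D}].

Lemma abs_sum_eq1 (f : 'I_d -> int) : \sum_i `|f i| = 1 ->
  exists i, `|f i| = 1 /\ forall j, j != i -> f j = 0.
Proof.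
move=> S1; have [i fi] : exists i, f i != 0.
  apply/existsP; apply: contraPT S1 => /existsPn H; rewrite big1 // => i _.
  by move: (H i); rewrite negbK => /eqP ->; rewrite normr0.
move: S1; rewrite (bigD1 i) //= => S1.
have fi1 : 1 <= `|f i| by lia.
have S0 : 0 <= \sum_(j | j != i) `|f j| by apply: sumr_ge0.
have S2 : \sum_(j | j != i) `|f j| = 0.
  by move: S1 S0; move: (\sum_(j | _) _) => s; lia.
exists i; split; first by move: S1; rewrite S2 addr0.
move=> j ji; apply/eqP; rewrite -normr_eq0; apply/eqP.
by apply: (psumr_eq0P _ S2).
Qed.

Lemma latadjE x y : latadj x y = (y \in lattice_nbrs x).
Proof.
apply/idP/mapP => [/eqP/abs_sum_eq1[i [fi fj]]|[t _ ->]].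
  have [E|E] : x 0 i - y 0 i = 1 \/ x 0 i - y 0 i = -1 by lia.
    exists (i, false); rewrite ?mem_enum //; apply/rowP => j.
    rewrite /lattice_step /= !mxE eqxx /=; have [->|/fj H] := eqVneq j i; lia.
  exists (i, true); rewrite ?mem_enum //; apply/rowP => j.
  rewrite /lattice_step /= !mxE eqxx /=; have [->|/fj H] := eqVneq j i; lia.
rewrite /latadj (bigD1 t.1) //= big1 => [|j jt].
  by rewrite /lattice_step; case: t.2; rewrite !mxE !eqxx /=; lia.
by rewrite /lattice_step; case: t.2; rewrite !mxE eqxx (negbTE jt) /=; lia.
Qed.

Lemma latadj_irr x : ~~ latadj x x.
Proof. by rewrite /latadj big1 // => i _; rewrite subrr normr0. Qed.

Definition radius n : nat := n.*2.+2.
Local Notation Zn n := 'I_(radius n).+2.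
Local Notation T n := ('rV[Zn n]_d).

(* The cube [-n, n]^d is sent to [2, 2n + 2]^d, away from the wall. *)
Definition embed n x : T n := \row_i (x 0 i + n.+2%:Z)%:~R.

(** Valid for all [x], also outside the cube, because [embed] is a translation followed by reduction
    modulo the side. Large [n] matters only for injectivity and for avoiding the wall. *)
Lemma embed_step n x t : embed n (x + lattice_step t) = embed n x + stp (radius n) t.
Proof.
apply/rowP => i; rewrite !mxE addrAC rmorphD /=; congr (_ + _).
by rewrite stpE /lattice_step; case: t => j [] /=; rewrite !mxE /=; case: (i == j).
Qed.

Lemma natr_ord_neq0 p k : (0 < k < p.+2)%N -> (k%:R : 'I_p.+2) != 0.
Proof. by move=> /andP[k0 kp]; apply/eqP => /(congr1 val); rewrite Zp_nat /= modn_small //; lia. Qed.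

Lemma intr_ord_neq0 p (z : int) : z != 0 -> (`|z|%N < p.+2)%N -> (z%:~R : 'I_p.+2) != 0.
Proof.
move=> z0 zp; have k0 : (0 < `|z| < p.+2)%N by rewrite absz_gt0 z0.
have [zE|zE] : z = `|z|%N%:Z \/ z = - `|z|%N%:Z by lia.
  by rewrite zE; exact: natr_ord_neq0.
by rewrite zE rmorphN oppr_eq0; exact: natr_ord_neq0.
Qed.

Lemma embed_neq x y : x != y -> exists n0, forall n, (n0 <= n)%N -> embed n x != embed n y.
Proof.
move=> xy; have /existsP[i Hi] : [exists i, x 0 i != y 0 i].
  by apply: contraNT xy => /existsPn H; apply/eqP/rowP => i; apply/eqP; move: (H i); rewrite negbK.
exists (absz (x 0%R i - y 0%R i)%R) => n ln; apply/eqP => /rowP/(_ i); rewrite !mxE => /eqP.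
rewrite -subr_eq0 -rmorphB /= opprD addrACA subrr addr0; apply/negP.
apply: intr_ord_neq0; first by rewrite subr_eq0.
rewrite /radius; move: ln; move: (absz _) => k; lia.
Qed.

Lemma embed_wall x : exists n0, forall n, (n0 <= n)%N -> embed n x \notin wall d (radius n).
Proof.
exists (\sum_i absz (x 0%R i))%N => n xn; rewrite inE; apply/existsPn => i.
have {}xn : (absz (x 0%R i) <= n)%N by apply: leq_trans xn; rewrite (bigD1 i) //= leq_addr.
rewrite mxE negb_or; apply/andP; split.
  by apply: intr_ord_neq0; rewrite /radius; move: (x 0 i) xn => z; lia.
rewrite -addr_eq0 -[1]/(1%:~R) -rmorphD /=.
by apply: intr_ord_neq0; rewrite /radius; move: (x 0 i) xn => z; lia.
Qed.

End Embedding.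

(** * Limits of the torus measures *)

Section Limit.
Variables (R : realType) (d : nat) (lam : R) (b : nat -> bool).
Hypothesis lam_gt0 : 0 < lam.
Local Notation V := 'rV[int]_d.
Local Notation nbrs := (@lattice_nbrs d).
Implicit Types (s r : seq V) (u v : V) (n : nat).

Lemma radius_even n : ~~ odd (radius n).
Proof. by rewrite /radius /= negbK odd_double. Qed.

Definition torus_event n s r : pred {set 'rV['I_(radius n).+2]_d} :=
  fun I => all (fun v => embed n v \in I) s && all (fun v => embed n v \notin I) r.
(** The boundary parity [b n] varies with [n] because the parity of the image of a fixed lattice
    site does. *)
Definition torus_prob s r n : R := gibbs lam (b n) (@torus_event n s r).

Lemma gibbs_eq0 n (P : pred {set 'rV['I_(radius n).+2]_d}) :
  (forall I, ok (b n) I -> ~~ P I) -> gibbs lam (b n) P = 0.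
Proof.
move=> H; rewrite /gibbs /weight_sum big_pred0 ?mul0r // => I.
by apply/negbTE; rewrite negb_and; case: (boolP (ok (b n) I)) => //= /H ->.
Qed.

Lemma torus_prob_ge0 s r n : 0 <= torus_prob s r n.
Proof. exact: gibbs_ge0. Qed.

Lemma torus_prob_le1 s r n : torus_prob s r n <= 1.
Proof. by rewrite -(gibbsT d (radius_even n) lam_gt0 (b n)); apply: gibbs_sub. Qed.

Lemma torus_prob_nil n : torus_prob [::] [::] n = 1.
Proof. by rewrite -(gibbsT d (radius_even n) lam_gt0 (b n)). Qed.

Lemma torus_prob_split s r v n :
  torus_prob s r n = torus_prob (v :: s) r n + torus_prob s (v :: r) n.
Proof.
rewrite {1}/torus_prob (gibbsD _ _ _ (fun I => embed n v \in I)).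
congr (_ + _); apply: eq_gibbs => I _; rewrite /torus_event /=;
  by case: (all _ s) (all _ r) (embed n v \in I) => [] [] [].
Qed.

Lemma torus_prob_ext s r s' r' n : s =i s' -> r =i r' -> torus_prob s r n = torus_prob s' r' n.
Proof. by move=> ss rr; apply: eq_gibbs => I _; rewrite /torus_event (eq_all_r ss) (eq_all_r rr). Qed.

Lemma torus_prob_disjoint s r v n : v \in s -> v \in r -> torus_prob s r n = 0.
Proof.
move=> vs vr; apply: gibbs_eq0 => I _; apply/negP => /andP[/allP/(_ v vs) vI /allP/(_ v vr)].
by rewrite vI.
Qed.

Lemma torus_prob_independent s r u v n :
  latadj u v -> u \in s -> v \in s -> torus_prob s r n = 0.
Proof.
rewrite latadjE => /mapP[t _ ->] us vs; apply: gibbs_eq0 => I /okP[indI _].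
apply/negP => /andP[/allP H _]; have := H _ vs; rewrite embed_step; apply/negP.
by apply: indI; exact: H.
Qed.

(** Large [n] keeps the image of [v] off the wall and distinct from the images of [s] and of the
    neighbours. *)
Lemma torus_prob_flip s v : v \notin s ->
  \forall n \near \oo, torus_prob (v :: s) (nbrs v) n = lam * torus_prob s (v :: nbrs v) n.
Proof.
move=> vs; have [n0 Hn0] : exists n0, forall n, (n0 <= n)%N ->
    forall w, w \in s ++ nbrs v -> embed n w != embed n v.
  have : v \notin s ++ nbrs v by rewrite mem_cat negb_or vs -latadjE latadj_irr.
  elim: (s ++ nbrs v) => [|w t IH]; first by exists 0%N.
  rewrite inE negb_or => /andP[vw /IH[n0 H0]]; have [n1 H1] := embed_neq vw.
  exists (maxn n0 n1) => n; rewrite geq_max => /andP[nn0 nn1] x; rewrite inE => /predU1P[->|].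
    by rewrite eq_sym; exact: H1.
  exact: H0.
have [n1 Hn1] := embed_wall v.
exists (maxn n0 n1) => // n; rewrite /= geq_max => /andP[nn0 nn1].
have ne := Hn0 n nn0.
pose Q := @torus_event n s (nbrs v).
have Qv I : Q (embed n v |: I) = Q I.
  rewrite /Q /torus_event; congr (_ && _); apply: eq_in_all => w ws;
    by rewrite in_setU1 (negbTE (ne w _)) // mem_cat ws ?orbT.
have Qfree I : Q I -> forall t, embed n v + stp (radius n) t \notin I.
  move=> /andP[_ /allP H] t; rewrite -embed_step; apply: H.
  by apply: map_f; rewrite mem_enum.
have := gibbs_flip (radius_even n) lam (b n) (Hn1 n nn1) Qv Qfree.
rewrite /torus_prob => E; transitivity (gibbs lam (b n) (fun I => (embed n v \in I) && Q I)).
  by apply: eq_gibbs => I _; rewrite /Q /torus_event /= andbA.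
rewrite E; congr (_ * _); apply: eq_gibbs => I _; rewrite /Q /torus_event /=.
by rewrite andbCA.
Qed.

(** Compactness of the unit interval. An ultrafilter makes all cylinder probabilities converge at
    once, without a diagonal extraction. *)
Lemma ultrafilter_cvg (G : set_system nat) (f : nat -> R) : UltraFilter G ->
  (forall n, 0 <= f n <= 1) -> cvg (f n @[n --> G]).
Proof.
move=> UG f01.
have U : UltraFilter (f n @[n --> G]).
  split; first exact: fmap_proper_filter.
  move=> H PH GH; apply/seteqP; split=> [A HA|]; last exact: GH.
  have [//|GnA] := in_ultra_setVsetC (f @^-1` A) UG.
  have HnA : H (~` A) by apply: GH.
  by have := @filter_ex _ H _ _ (filterI HA HnA) => -[x []].
have cA := @segment_compact R 0 1; set A := [set` _] in cA.
have fA n : A (f n) by rewrite /A /= in_itv /= f01.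
have FA : (f n @[n --> G]) A.
  by change (G (f @^-1` A)); apply: filterE.
have [l [_ Hl]] : A `&` [set p | f n @[n --> G] --> p] !=set0.
  by move: cA; rewrite compact_ultra; apply.
by apply/cvg_ex; exists l.
Qed.

Theorem limit_hardcore : exists mu : probability (indsetM (@latadj d)) R,
  [/\ is_hardcore lam mu,
    forall v a, (forall n, torus_prob [:: v] [::] n <= a) -> (mu (occupied v) <= a%:E)%E &
    forall v a, (exists n0, forall n, (n0 <= n)%N -> a <= torus_prob [:: v] [::] n) ->
      (a%:E <= mu (occupied v))%E].
Proof.
have [G [UG subG]] := @ultraFilterLemma nat \oo _.
pose m s r : R := lim (torus_prob s r n @[n --> G]).
have mcvg s r : torus_prob s r n @[n --> G] --> m s r.
  by apply: ultrafilter_cvg => n; rewrite torus_prob_ge0 torus_prob_le1.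
have is_cvg s r : cvg (torus_prob s r n @[n --> G]) by apply/cvg_ex; exists (m s r).
have meq s r (f : nat -> R) l : f n @[n --> G] --> l ->
    (\forall n \near \oo, torus_prob s r n = f n) -> m s r = l.
  move=> fl /subG E; apply: (@cvg_unique _ (@Rhausdorff R) (f n @[n --> G])) => //.
  apply: cvg_trans (mcvg s r); exact: near_eq_cvg.
(* The default 0 makes the enumeration total; it is surjective but may repeat a site. *)
have [|||||||mu muE] := @exists_limit_measure _ (@latadj d) R
    (fun k => odflt 0 (choice.unpickle k : option V)) _ m.
- by move=> v; exists (choice.pickle v); rewrite choice.pickleK.
- by move=> s r; apply: limr_ge => //; apply: nearW => n; exact: torus_prob_ge0.
- apply: (meq _ _ (fun=> 1)); first exact: cvg_cst.
  by apply: nearW => n; exact: torus_prob_nil.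
- move=> s r v; apply: meq (cvgD (mcvg (v :: s) r) (mcvg s (v :: r))) _.
  by apply: nearW => n; exact: torus_prob_split.
- move=> s r s' r' ss rr; apply: meq (mcvg s' r') _.
  by apply: nearW => n; exact: torus_prob_ext.
- move=> s r v vs vr; apply: (meq _ _ (fun=> 0)); first exact: cvg_cst.
  by apply: nearW => n; exact: torus_prob_disjoint vs vr.
- move=> s r u v uv us vs; apply: (meq _ _ (fun=> 0)); first exact: cvg_cst.
  by apply: nearW => n; exact: torus_prob_independent uv us vs.
have occE v : occupied v = cylinder (@latadj d) [:: v] [::].
  by rewrite cylinder_consl cylinder_nil setTI.
exists mu; split.
- apply: (hardcore_of_flip lam_gt0 (@latadjE d) (@latadj_irr d)) => v s vs.
  rewrite !muE -EFinM; congr EFin; apply: (meq _ _ _ _ _ (torus_prob_flip vs)).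
  by apply: cvgMr; exact: mcvg.
- move=> v a H; rewrite occE muE lee_fin; apply: limr_le => //.
  by apply: nearW => n; exact: H.
- move=> v a [n0 H]; rewrite occE muE lee_fin; apply: limr_ge => //.
  by apply: subG; exists n0.
Qed.
End Limit.

(** The bound [eps] on odd sites holds for every torus and both parities. The parity is chosen so
    that the image of the origin is always even for [mu] and always odd for [nu]; the gap between
    the two bounds survives the limits. *)
Lemma large_activity_phase_transition (R : realType) : exists (C : R) (d0 : nat), 0 < C /\
  forall d lam, (d0 <= d)%N -> C * threshold R d < lam -> phase_transition (@latadj d) lam.
Proof.
have [C [d0 [C0 d04 params]]] := peierls_parameters R.
exists C, d0; split=> // d lam dd0 lamC.
have [psi [l [q [pr [[[psi0 psid psi2 l0 l2] [lam0 q0 q1 pr0 pr1] K1 K2 small] gap]]]]] :=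
  params d lam dd0 lamC.
have d4 : (4 <= d)%N by apply: leq_trans dd0.
pose i0 : 'I_d := Ordinal (ltnW (ltnW (ltnW d4))); pose i1 : 'I_d := Ordinal (ltnW (ltnW d4)).
have i10 : i1 != i0 by [].
have radius_gt1 n : (1 < radius n)%N by [].
set eps := (64 * d%:R ^+ 2)^-1 in small gap.
have odd_small n b v : par v = ~~ b -> gibbs lam b (fun I : {set 'rV['I_(radius n).+2]_d} => v \in I) <= eps.
  move=> vb; apply: le_trans (small _).
  exact: (gibbs_odd (radius_even n) (radius_gt1 n) lam0 i10 d4 psi0 psid psi2 l0 l2 q0 q1 pr0 pr1 K1 K2 vb).
pose v0 : 'rV[int]_d := 0.
pose parity n := par (embed n v0).
have occE (b : nat -> bool) n : torus_prob lam b [:: v0] [::] n = gibbs lam (b n) (fun I => embed n v0 \in I).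
  by apply: eq_gibbs => I _; rewrite /torus_event /= !andbT.
have [mu [hmu _ mu_ge]] := limit_hardcore d parity lam0.
have [nu [hnu nu_le _]] := limit_hardcore d (fun n => ~~ parity n) lam0.
exists mu, nu; split=> //; exists (occupied v0); first exact: measurable_occupied.
have H1 : (nu (occupied v0) <= eps%:E)%E.
  by apply: nu_le => n; rewrite occE; apply: odd_small; rewrite negbK.
have H2 : ((lam / (1 + lam) * (1 - d.*2%:R * eps))%:E <= mu (occupied v0))%E.
  have [n0 Hn0] := embed_wall v0; apply: mu_ge; exists n0 => n nn0; rewrite occE.
  apply: (gibbs_even (radius_even n) lam0) => //; first exact: Hn0.
  by move=> u; exact: odd_small.
move=> E; rewrite E in H2; have := le_trans H2 H1; rewrite lee_fin leNgt => /negP; exact.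
Qed.

Theorem theorem1p1 (R : realType) :
  exists (C : R) (d0 : nat), 0 < C /\
    forall d : nat, (d0 <= d)%N ->
      (lambda_hc R d <=
        (C * d%:R `^ (- (1 / 4)) * (ln d%:R) `^ (3 / 4))%:E)%E.
Proof.
have [C [d0 [C0 H]]] := large_activity_phase_transition R.
exists C, d0; split=> // d dd0; rewrite -mulrA -/(threshold R d).
apply: ge_ereal_sup => _ [lam [_ no_transition] <-]; rewrite lee_fin leNgt.
by apply/negP => /(H d lam dd0).
Qed.
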